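(* Let $\rho^1,\rho^2\in\mathbb{R}$ with $\rho^2>\rho^1$, let $T>0$, and let $f\in C([0,T];H^l(\mathbb{R}^2))$ with $l\ge 3$ be a (real-valued) solution on $[0,T]$ of the Muskat contour equation $$f_t(x,t)=\frac{\rho^2-\rho^1}{4\pi}\,\mathrm{PV}\!\int_{\mathbb{R}^2}\frac{(\nabla f(x,t)-\nabla f(x-y,t))\cdot y}{[|y|^2+(f(x,t)-f(x-y,t))^2]^{3/2}}\,dy,\qquad f(x,0)=f_0(x).$$ Put $\rho=(\rho^2-\rho^1)/2$. Then for every $t\in[0,T]$ $$\|f(\cdot,t)\|_{L^2}^2+\frac{\rho}{\pi}\int_0^t\int_{\mathbb{R}^2}\int_{\mathbb{R}^2}\left(\frac1{|y|}-\frac{1}{[|y|^2+(f(x,s)-f(x-y,s))^2]^{1/2}}\right)dx\,dy\,ds=\|f_0\|_{L^2}^2 .$$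
   Context: The contour equation describes the interface $x_3=f(x_1,x_2,t)$ between two incompressible fluids of constant densities $\rho^1$ (above) and $\rho^2$ (below) in a porous medium (the three dimensional Muskat problem); $\rho^2>\rho^1$ is the stable regime. The gradient $\nabla$ is in the variable $x\in\mathbb{R}^2$. The principal value is $\mathrm{PV}\int_{\mathbb{R}^2}=\lim_{\epsilon\to0,\,R\to\infty}\int_{\epsilon<|y|<R}$. *)

(* Defs.v *)
From HB Require Import structures.
From mathcomp Require Import all_boot all_order all_algebra.
From mathcomp Require Import all_classical all_reals all_analysis.

Set Implicit Arguments.
Unset Strict Implicit.
Unset Printing Implicit Defensive.

Import Order.TTheory GRing.Theory Num.Theory.
Import numFieldNormedType.Exports.

Local Open Scope classical_set_scope.
Local Open Scope ring_scope.

Definition leb2 (R : realType) :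
    {measure set (measurableTypeR R * measurableTypeR R) -> \bar R} :=
  (@lebesgue_measure R \x @lebesgue_measure R)%E.

(* The library's norm on [R * R] is the sup norm. *)
Definition enorm (R : realType) (y : R * R) : R :=
  Num.sqrt (y.1 ^+ 2 + y.2 ^+ 2).

Definition L2 (R : realType) (g : R * R -> R) : Prop :=
  g \in Lfun (leb2 R) 2%:E.

Definition L2norm (R : realType) (g : R * R -> R) : \bar R :=
  'N[leb2 R]_2%:E[EFin \o g]%E.

(** Sobolev spaces *)

Definition partial1 (R : realType) (g : R * R -> R) : R * R -> R :=
  fun x => 'D_((1, 0) : R * R) g x.

Definition partial2 (R : realType) (g : R * R -> R) : R * R -> R :=
  fun x => 'D_((0, 1) : R * R) g x.

Definition partial (R : realType) (a : nat * nat) (g : R * R -> R) :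
    R * R -> R :=
  iter a.1 (@partial1 R) (iter a.2 (@partial2 R) g).

(* Differentiability of every [partial a phi] makes all of them continuous,
   so mixed derivatives commute and [phi] is smooth. *)
Definition test_function (R : realType) (phi : R * R -> R) : Prop :=
  (forall (a : nat * nat) (x : R * R), differentiable (partial a phi) x) /\
  compact (closure [set x | phi x != 0]).

Definition is_weak_partial (R : realType) (a : nat * nat)
    (g h : R * R -> R) : Prop :=
  forall phi, test_function phi ->
    \int[leb2 R]_x (g x * partial a phi x) =
    (-1) ^+ (a.1 + a.2) * \int[leb2 R]_x (h x * phi x).

(* A square-integrable weak derivative, which is unique up to a null set; the
   value is meaningful only when there is one. *)
Definition weak_partial (R : realType) (a : nat * nat) (g : R * R -> R) :
    R * R -> R :=
  xget (fun=> 0) [set h | L2 h /\ is_weak_partial a g h].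

(* Squared Gagliardo (Slobodeckij) seminorm of order [0 < s < 1] on R^2, after
   the change of variables (x, x') = (x, x - y). *)
Definition gagliardo2 (R : realType) (s : R) (g : R * R -> R) : \bar R :=
  (\int[leb2 R]_y \int[leb2 R]_x
     ((g x - g (x - y)%R) ^+ 2 / (enorm y) `^ (2 + 2 * s))%R%:E)%E.

(* The norm of H^l for real [l >= 0], with [k] the integer part of [l]: the
   usual sum over multi-indices of order at most [k], plus, only when [l] is
   not an integer, the Gagliardo seminorms of order [l - k] of the derivatives
   of order [k]. *)
Definition sobolev_norm (R : realType) (l : R) (g : R * R -> R) : \bar R :=
  let k := Num.truncn l in
  let s := l - k%:R in
  ((\sum_(a < k.+1) \sum_(b < k.+1 | (a + b <= k)%N)
      L2norm (weak_partial (a : nat, b : nat) g) ^+ 2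
    + (if s == 0%R then 0
       else \sum_(a < k.+1) gagliardo2 s (weak_partial (a : nat, k - a)%N g)))
   `^ (2^-1)%R)%E.

Definition in_sobolev (R : realType) (l : R) (g : R * R -> R) : Prop :=
  [/\ L2 g,
      forall a : nat * nat, (a.1 + a.2 <= Num.truncn l)%N ->
        exists h, L2 h /\ is_weak_partial a g h
    & (sobolev_norm l g < +oo)%E].

(* [f] belongs to C([0,T]; H^l); only the times in [0,T] are constrained. *)
Definition continuous_in_sobolev (R : realType) (T l : R)
    (f : R -> R * R -> R) : Prop :=
  forall t : R, 0 <= t <= T ->
    in_sobolev l (f t) /\
    sobolev_norm l (f s \- f t) @[s --> within `[0, T] (nbhs t)] --> 0%E.

(** The contour equation *)

Definition has_pv (R : realType) (g : R * R -> R) (v : R) : Prop :=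
  let annulus (eps r : R) := [set y : R * R | eps < enorm y < r] in
  (forall eps r : R, 0 < eps -> eps < r ->
     (leb2 R).-integrable (annulus eps r) (EFin \o g)) /\
  \int[leb2 R]_(y in annulus er.1 er.2) g y
    @[er --> filter_prod (0 : R)^'+ +oo] --> v.

Definition muskat_integrand (R : realType) (g : R * R -> R) (x y : R * R) : R :=
  ((partial1 g x - partial1 g (x - y)) * y.1
   + (partial2 g x - partial2 g (x - y)) * y.2)
  / (enorm y ^+ 2 + (g x - g (x - y)) ^+ 2) `^ (3 / 2).

(* The equation is read pointwise, with one-sided time derivatives at [0] and
   [T]. Continuity of [f t] selects the continuous representative of its class
   in H^l, which is C^1 when [l >= 3]. *)
Definition muskat_solution (R : realType) (rho1 rho2 T : R)
    (f : R -> R * R -> R) (f0 : R * R -> R) : Prop :=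
  [/\ forall t : R, 0 <= t <= T -> continuous (f t),
      forall (t : R) (x : R * R), 0 <= t <= T ->
        exists v : R,
          has_pv (muskat_integrand (f t) x) v /\
          (f s x - f t x) / (s - t) @[s --> within `[0, T] t^']
            --> (rho2 - rho1) / (4 * pi) * v
    & forall x : R * R, f 0 x = f0 x].

(* Main.v *)
(** At a fixed time write g = f(.,t), d = g(x) - g(x-y), r = |y|,
    S = sqrt(r^2 + d^2), let V(x) be the principal value and D the integral of
    1/r - 1/S in x and y.  The equation says f_t = c V with 2c = rho/pi, so the
    claim is the integrated form of (d/dt) |f|^2 = 2c <f, V> and <g, V> = - D.

    For the second identity the kernel is damped by chi_N = N/(N + r^2).  For
    fixed y, Euler's identity gives
      g (y.(grad g(x) - grad g(x-y))) / S^3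
        = r^-2 (y.grad_x (g d/S) - (y.grad g(x)) d/S),
    where the first term has integral zero in x; translating x by y and then
    changing y to -y makes the second one - r^-2 (y.grad g(x-y)) d/S.  For fixed x,
    y.grad_y (S - r) = (y.grad g(x-y)) d/S - r^2 (1/r - 1/S), and the divergence
    theorem in y turns r^-2 (y.grad g(x-y)) d/S into 1/r - 1/S, up to a term
    that vanishes as N tends to infinity.

    V is bounded pointwise and in L^2 because the kernel differs from an odd
    function of y by the divergence of a field and by terms of size
    1/(r (1 + r^2)).

    H^3 enters through a C^1 representative whose gradient is bounded and
    Hoelder 1/2; since f is continuous in time with values in H^3, D is
    continuous in time.  The equation being only pointwise in x, the energy is
    differentiated after truncation to a box, and the mean value theorem with
    Cauchy-Schwarz carries the derivative over to the whole plane. *)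
Require Import Defs.
From HB Require Import structures.
From mathcomp Require Import all_boot all_order all_algebra.
From mathcomp Require Import all_classical all_reals all_analysis.
From mathcomp Require Import measurable_realfun ring lra zify.
Import Order.TTheory GRing.Theory Num.Theory.
Import numFieldNormedType.Exports.
Local Open Scope classical_set_scope.
Local Open Scope ring_scope.
Set Implicit Arguments.
Unset Strict Implicit.
Unset Printing Implicit Defensive.

(** * Integration on the plane *)

(** The principal value matters only at infinity: a gradient that is Hoelder 1/2 makes the kernel
    O(r^(-3/2)) at the origin, which is integrable, whereas at infinity it is of order |grad g(x)| /
    r^2. This forbids Fubini in (x, y). The damping gains a factor r^(-2) there, and the limits in N
    are taken by dominated convergence, in y alone and then in x alone, with majorants free of N.
    The term of the kernel that contains grad g(x-y) decays in y only as an L^2 function does;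
    estimated directly it gives a bound uniform in x, but not one in L^2. Therefore it is cancelled
    by a divergence with the weight N/((1 + r^2)(N + r^2)), regular at the origin, while the energy
    identity uses the weight N/(r^2 (N + r^2)). Integrability over the plane is reduced to [kk] and
    [kh], which are dominated by a product of functions of y.1 and y.2, so that no polar coordinates
    occur. From H^3 only bounds stable under pointwise limits are kept: sup, L^2, Hoelder 1/2, and
    L^2 bounds of translates, for g and its gradient. Hence mollification followed by a limit
    suffices. *)

Section plane_measure.
Context {R : realType}.

(** A copy of [leb2], convertible to it, that receives the sigma-finite structure needed for Tonelli
    and Fubini on pairs of points of the plane. *)
Definition sleb2_fun : set (measurableTypeR R * measurableTypeR R)%type -> \bar R :=
  leb2 R.

HB.instance Definition _ := Measure.copy sleb2_fun (leb2 R).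

Let sleb2_sigma_finite : sigma_finite setT sleb2_fun.
Proof.
have /sigma_finiteP[F [TF ndF Foo]] := sigma_finiteT (@lebesgue_measure R).
exists (fun n => F n `*` F n).
 rewrite -setXTT TF predeqE => -[x y]; split.
    move=> [/= [n _ Fnx] [k _ Gky]]; exists (maxn n k) => //; split.
    - by move: x Fnx; exact/subsetPset/ndF/leq_maxl.
    - by move: y Gky; exact/subsetPset/ndF/leq_maxr.
  by move=> [n _ []/= ? ?]; split; exists n.
move=> k; have [? ?] := Foo k.
split; first exact: measurableX.
by rewrite /sleb2_fun /leb2 /= product_measure1E// lte_mul_pinfty// ge0_fin_numE.
Qed.

HB.instance Definition _ := Measure_isSigmaFinite.Build _ _ _ sleb2_fun
  sleb2_sigma_finite.

Definition sleb2 : {sigma_finite_measure set (measurableTypeR R * measurableTypeR R)%type -> \bar R} := sleb2_fun.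

Lemma measurable_invr d (T : measurableType d) (f : T -> R) :
  measurable_fun setT f -> measurable_fun setT (fun x => (f x)^-1).
Proof.
move=> mf.
(* The power -1 is the inverse only on nonnegative arguments, hence the detour through the square;
   at a zero of [f] both sides are 0. *)
have -> : (fun x => (f x)^-1) = (fun x => f x * ((f x ^+ 2) `^ (-1))).
  apply/funext => x; have [->|f0] := eqVneq (f x) 0; first by rewrite invr0 mul0r.
  by rewrite powR_inv1 ?sqr_ge0// expr2 invfM mulrA divff// mul1r.
apply: measurable_funM => //.
apply: (@measurableT_comp _ _ _ _ _ _ (fun y : R => y `^ (-1)) _ (fun x => f x ^+ 2)); first exact: measurable_powR.
exact: measurable_funX.
Qed.

Lemma measurable_sqrtr d (T : measurableType d) (f : T -> R) :
  measurable_fun setT f -> measurable_fun setT (fun x => Num.sqrt (f x)).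
Proof.
move=> mf; apply: (@measurableT_comp _ _ _ _ _ _ (@Num.sqrt R) _ f) => //.
apply: continuous_measurable_fun; exact: sqrt_continuous.
Qed.

Definition pushm d (T : measurableType d) d' (T' : measurableType d')
    (mu : {measure set T -> \bar R}) (phi : T -> T')
    (mphi : measurable_fun setT phi) : {measure set T' -> \bar R} :=
  measure_function_pushforward__canonical__measure_function_Measure mu mphi.

Lemma integral_measure_preserving d (T : measurableType d)
    (mu : {measure set T -> \bar R}) (phi : T -> T) (f : T -> \bar R) :
  measurable_fun setT phi ->
  (forall A, measurable A -> mu (phi @^-1` A) = mu A) ->
  measurable_fun setT f ->
  (\int[mu]_x f (phi x) = \int[mu]_x f x)%E.
Proof.
move=> mphi mup mf.
have ge0P (g : T -> \bar R) : measurable_fun setT g -> (forall x, 0 <= g x)%E ->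
    (\int[mu]_x g (phi x) = \int[mu]_x g x)%E.
  move=> mg g0.
  rewrite [RHS](eq_measure_integral (pushm mu mphi)); last by move=> A mA _; rewrite -(mup _ mA).
  by apply: esym; rewrite [LHS](ge0_integral_pushforward mphi mu measurableT mg) // => x _; exact: g0.
rewrite [LHS]integralE [RHS]integralE; congr (_ - _)%E.
- rewrite -[RHS](ge0P f^\+%E (measurable_funepos mf) (funepos_ge0 f)).
  by apply: eq_integral => x _; rewrite !unlock.
- rewrite -[RHS](ge0P f^\-%E (measurable_funeneg mf) (funeneg_ge0 f)).
  by apply: eq_integral => x _; rewrite !unlock.
Qed.

Lemma lebesgue_shift (a : R) (A : set R) : measurable A ->
  lebesgue_measure ((fun x => x - a) @^-1` A) = lebesgue_measure A.
Proof.
move=> mA.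
have mf : measurable_fun [set: measurableTypeR R] (fun x : measurableTypeR R => x - a : measurableTypeR R).
  exact: measurable_funB.
pose m := pushm (@lebesgue_measure R) mf.
rewrite -[LHS]/(m A); apply: esym; apply: (@lebesgue_measure_unique _ m) => // X [[u v] /= uv <-].
rewrite /m /pushm /= /pushforward.
have -> : (fun x => x - a) @^-1` `]u, v] = `](u + a), (v + a)]%classic.
  by apply/seteqP; split=> x /=; rewrite !in_itv/= ltrBrDr lerBlDr.
rewrite !lebesgue_measure_itv/= !lte_fin ltrD2r.
by case: ifP => // _; rewrite -!EFinB; congr EFin; rewrite opprD addrACA subrr addr0.
Qed.

Lemma lebesgue_opp (A : set R) : measurable A ->
  lebesgue_measure (-%R @^-1` A) = lebesgue_measure A.
Proof.
move=> mA.
have mf : measurable_fun [set: measurableTypeR R] (fun x : measurableTypeR R => - x : measurableTypeR R).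
  exact: measurable_funN.
pose m := pushm (@lebesgue_measure R) mf.
rewrite -[LHS]/(m A); apply: esym; apply: (@lebesgue_measure_unique _ m) => // X [[u v] /= uv <-].
rewrite /m /pushm /= /pushforward.
have -> : -%R @^-1` `]u, v] = `[(- v), (- u)[%classic.
  by apply/seteqP; split=> x /=; rewrite !in_itv/= ltrNr lerNl andbC.
rewrite !lebesgue_measure_itv/= !lte_fin ltrN2.
by case: ifP => // _; rewrite opprK addeC.
Qed.

(** A product measure is determined by its values on rectangles, so it is enough that each
    coordinate map preserves length. *)
Lemma leb2_map (phi psi : measurableTypeR R -> measurableTypeR R)
    (A : set (measurableTypeR R * measurableTypeR R)) :
  measurable_fun setT phi -> measurable_fun setT psi ->
  (forall A, measurable A -> lebesgue_measure (phi @^-1` A) = lebesgue_measure A) ->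
  (forall A, measurable A -> lebesgue_measure (psi @^-1` A) = lebesgue_measure A) ->
  measurable A -> leb2 R ((fun x => (phi x.1, psi x.2)) @^-1` A) = leb2 R A.
Proof.
move=> mphi mpsi hphi hpsi mA.
have mf : measurable_fun setT (fun x : measurableTypeR R * measurableTypeR R => (phi x.1, psi x.2)).
  by apply: measurable_fun_pair; apply: measurableT_comp.
pose m := pushm (leb2 R) mf.
rewrite -[LHS]/(m A); apply: esym; apply: (product_measure_unique (m' := m)) => // B C mB mC.
rewrite /m /pushm /= /pushforward.
rewrite -(hphi _ mB) -(hpsi _ mC).
rewrite -[RHS]product_measure1E//.
- by rewrite -[X in measurable X]setTI; exact: mphi.
- by rewrite -[X in measurable X]setTI; exact: mpsi.
Qed.

Local Notation T2 := (measurableTypeR R * measurableTypeR R)%type.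

Lemma integral_leb2_shift (a : R * R) (f : T2 -> \bar R) : measurable_fun setT f ->
  (\int[leb2 R]_x f (x - a)%R = \int[leb2 R]_x f x)%E.
Proof.
move=> mf.
have m1 : measurable_fun [set: measurableTypeR R] (fun x : measurableTypeR R => x - a.1 : measurableTypeR R).
  exact: measurable_funB.
have m2 : measurable_fun [set: measurableTypeR R] (fun x : measurableTypeR R => x - a.2 : measurableTypeR R).
  exact: measurable_funB.
apply: (@integral_measure_preserving _ _ (leb2 R) (fun x => (x.1 - a.1, x.2 - a.2))) => //.
  by apply: measurable_fun_pair; [exact: (measurableT_comp m1 measurable_fst)|exact: (measurableT_comp m2 measurable_snd)].
by move=> A mA; apply: (leb2_map m1 m2) => // B mB; exact: lebesgue_shift.
Qed.

Lemma integral_leb2_opp (f : T2 -> \bar R) : measurable_fun setT f ->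
  (\int[leb2 R]_x f (- x)%R = \int[leb2 R]_x f x)%E.
Proof.
move=> mf.
have m1 : measurable_fun [set: measurableTypeR R] (fun x : measurableTypeR R => - x : measurableTypeR R).
  exact: measurable_funN.
apply: (@integral_measure_preserving _ _ (leb2 R) (fun x => (- x.1, - x.2))) => //.
  by apply: measurable_fun_pair; [exact: (measurableT_comp m1 measurable_fst)|exact: (measurableT_comp m1 measurable_snd)].
by move=> A mA; apply: (leb2_map m1 m1) => // B mB; exact: lebesgue_opp.
Qed.

Lemma integral_leb2_swap (f : T2 -> \bar R) : measurable_fun setT f ->
  (\int[leb2 R]_x f (x.2, x.1) = \int[leb2 R]_x f x)%E.
Proof.
move=> mf.
have msw : measurable_fun setT (fun x : T2 => (x.2, x.1)).
  exact: measurable_fun_pair.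
apply: (@integral_measure_preserving _ _ (leb2 R) (fun x => (x.2, x.1))) => //.
move=> A mA; pose m := pushm (leb2 R) msw.
rewrite -[LHS]/(m A); apply: esym; apply: (product_measure_unique (m' := m)) => // B C mB mC.
rewrite /m /pushm /= /pushforward.
have -> : (fun x : T2 => (x.2, x.1)) @^-1` (B `*` C) = C `*` B.
  by apply/seteqP; split=> -[x y] /= [].
have E : leb2 R (C `*` B) = (lebesgue_measure C * lebesgue_measure B)%E.
  exact: product_measure1E.
by rewrite E muleC.
Qed.
End plane_measure.
Notation "'RR' R" := (measurableTypeR R * measurableTypeR R)%type (at level 10, R at level 9).

(** * Measurability of explicit functions *)

Section measurability.
Context {R : realType} d (T : measurableType d).
Implicit Types (f g : T -> R) (u v : T -> RR R).

Lemma mfun_cst (c : R) : measurable_fun setT (fun _ : T => c).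
Proof. exact: measurable_cst. Qed.

Lemma mfun_add f g : measurable_fun setT f -> measurable_fun setT g ->
  measurable_fun setT (fun x => f x + g x).
Proof. exact: measurable_funD. Qed.

Lemma mfun_opp f : measurable_fun setT f -> measurable_fun setT (fun x => - f x).
Proof. exact: measurable_funN. Qed.

Lemma mfun_mul f g : measurable_fun setT f -> measurable_fun setT g ->
  measurable_fun setT (fun x => f x * g x).
Proof. exact: measurable_funM. Qed.

Lemma mfun_exp f n : measurable_fun setT f ->
  measurable_fun setT (fun x => f x ^+ n).
Proof. exact: measurable_funX. Qed.

Lemma mfun_norm f : measurable_fun setT f -> measurable_fun setT (fun x => `|f x|).
Proof. by move=> mf; exact: (measurableT_comp (@normr_measurable R setT) mf). Qed.

Lemma mfun_powR f (p : R) : measurable_fun setT f ->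
  measurable_fun setT (fun x => f x `^ p).
Proof.
move=> mf; apply: (@measurableT_comp _ _ _ _ _ _ (fun y : R => y `^ p) _ f) => //.
Qed.

Lemma mfun_EFin f : measurable_fun setT f -> measurable_fun setT (fun x => (f x)%:E).
Proof. by move=> mf; apply/measurable_EFinP. Qed.

Lemma mfun_comp d' (T' : measurableType d') d'' (T'' : measurableType d'')
  (g : T' -> T'') (u : T -> T') :
  measurable_fun setT g -> measurable_fun setT u ->
  measurable_fun setT (fun x => g (u x)).
Proof. by move=> mg mu; exact: (measurableT_comp mg). Qed.

Lemma mfun_fst d1 (T1 : measurableType d1) d2 (T2 : measurableType d2)
  (u : T -> T1 * T2) : measurable_fun setT u ->
  measurable_fun setT (fun x => (u x).1).
Proof. by move=> mu; exact: (measurableT_comp measurable_fst). Qed.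

Lemma mfun_snd d1 (T1 : measurableType d1) d2 (T2 : measurableType d2)
  (u : T -> T1 * T2) : measurable_fun setT u ->
  measurable_fun setT (fun x => (u x).2).
Proof. by move=> mu; exact: (measurableT_comp measurable_snd). Qed.

Lemma mfun_pair d1 (T1 : measurableType d1) d2 (T2 : measurableType d2)
  (f : T -> T1) (g : T -> T2) :
  measurable_fun setT f -> measurable_fun setT g ->
  measurable_fun setT (fun x => (f x, g x)).
Proof. exact: measurable_fun_pair. Qed.

Lemma mfun_add2 u v : measurable_fun setT u -> measurable_fun setT v ->
  measurable_fun setT (fun x => u x + v x : RR R).
Proof.
move=> mu mv; apply: (@measurable_fun_pair _ _ _ _ _ _ (fun x => (u x).1 + (v x).1) (fun x => (u x).2 + (v x).2)).
- by apply: mfun_add; exact: mfun_fst.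
- by apply: mfun_add; exact: mfun_snd.
Qed.

Lemma mfun_opp2 u : measurable_fun setT u ->
  measurable_fun setT (fun x => - u x : RR R).
Proof.
move=> mu; apply: (@measurable_fun_pair _ _ _ _ _ _ (fun x => - (u x).1) (fun x => - (u x).2)).
- by apply: mfun_opp; exact: mfun_fst.
- by apply: mfun_opp; exact: mfun_snd.
Qed.

Lemma mfun_id : measurable_fun setT (fun x : T => x).
Proof. exact: measurable_id. Qed.

Lemma mfun_enorm u : measurable_fun setT u -> measurable_fun setT (fun x => enorm (u x)).
Proof.
move=> mu; apply: measurable_sqrtr; apply: mfun_add; apply: mfun_exp.
exact: mfun_fst. exact: mfun_snd.
Qed.

End measurability.

(** Peels one operation off the function; a hypothesis on [g] handles [g (e x)] once [e] is
    measurable. Facts that are not structural are first put into the context with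
    [have := ... => ?]. *)
Ltac mfun1 :=
  first [ assumption
        | lazymatch goal with
          | |- measurable_fun _ (fun x => (_)%:E) => refine (mfun_EFin _)
          | |- measurable_fun _ (fun x => x) => exact: mfun_id
          | |- measurable_fun _ (fun x => (@GRing.inv _ _)) => refine (measurable_invr _)
          | |- measurable_fun _ (fun x => (@GRing.mul _ _ _)) => refine (mfun_mul _ _)
          | |- measurable_fun _ (fun x => (enorm _)) => refine (mfun_enorm _)
          | |- measurable_fun _ (fun x => Num.sqrt _) => refine (measurable_sqrtr _)
          | |- measurable_fun _ (fun x => (_ ^+ _)) => refine (mfun_exp _ _)
          | |- measurable_fun _ (fun x => (_ `^ _)) => refine (mfun_powR _ _)
          | |- measurable_fun _ (fun x => `|_|) => refine (mfun_norm _)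
          | |- measurable_fun _ (fun x => fst _) => refine (mfun_fst _)
          | |- measurable_fun _ (fun x => snd _) => refine (mfun_snd _)
          | |- measurable_fun _ (fun x => (_, _)) => first [exact: measurable_cst | refine (mfun_pair _ _)]
          | |- measurable_fun _ (fun x => - _) => first [refine (mfun_opp _) | refine (mfun_opp2 _)]
          | |- measurable_fun _ (fun x => _ + _) => first [refine (mfun_add _ _) | refine (mfun_add2 _ _)]
          end
        | match goal with
          | H : measurable_fun _ ?g |- measurable_fun _ (fun x => ?g (@?e x)) =>
              refine (mfun_comp H _)
          end
        | exact: measurable_fst | exact: measurable_snd
        | exact: (mfun_opp2 (@mfun_id _ _)) | exact: (mfun_opp (@mfun_id _ _))
        | exact: (mfun_enorm (@mfun_id _ _)) | exact: (measurable_sqrtr (@mfun_id _ _))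
        | exact: (mfun_norm (@mfun_id _ _)) | exact: (measurable_invr (@mfun_id _ _))
        | refine (mfun_cst _ _) | exact: measurable_cst ].
Ltac mfun := rewrite ?/comp /=; repeat mfun1.

(** * Fubini, Cauchy-Schwarz and integrals of derivatives *)

Section integration.
Context {R : realType}.
Local Notation leb := (@lebesgue_measure R).
Implicit Types (F : RR R -> \bar R).

Lemma leb2_tonelli1 F : measurable_fun setT F -> (forall x, 0 <= F x)%E ->
  (\int[leb2 R]_x F x = \int[leb]_a \int[leb]_b F (a, b))%E.
Proof. by move=> mF F0; exact: (fubini_tonelli1 (m1 := leb) (m2 := leb)). Qed.

Lemma tonelli4 (F : RR R * RR R -> \bar R) : measurable_fun setT F ->
  (forall x, 0 <= F x)%E ->
  (\int[leb2 R]_x \int[leb2 R]_y F (x, y) = \int[leb2 R]_y \int[leb2 R]_x F (x, y))%E.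
Proof. by move=> mF F0; exact: (fubini_tonelli (m1 := @sleb2 R) (m2 := @sleb2 R)). Qed.

Lemma tonelli4_measurable (F : RR R * RR R -> \bar R) : measurable_fun setT F ->
  (forall x, 0 <= F x)%E ->
  measurable_fun setT (fun x => \int[leb2 R]_y F (x, y))%E.
Proof. by move=> mF F0; exact: (measurable_fun_fubini_tonelli_F (m2 := @sleb2 R)). Qed.

Lemma tonelli4_measurable2 (F : RR R * RR R -> \bar R) : measurable_fun setT F ->
  (forall x, 0 <= F x)%E ->
  measurable_fun setT (fun y => \int[leb2 R]_x F (x, y))%E.
Proof. by move=> mF F0; exact: (measurable_fun_fubini_tonelli_G (m1 := @sleb2 R)). Qed.

Lemma fubini4 (F : RR R * RR R -> \bar R) : measurable_fun setT F ->
  (\int[leb2 R]_x \int[leb2 R]_y `|F (x, y)| < +oo)%E ->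
  (\int[leb2 R]_x \int[leb2 R]_y F (x, y) = \int[leb2 R]_y \int[leb2 R]_x F (x, y))%E.
Proof.
move=> mF iF.
have h : ((@sleb2 R) \x (@sleb2 R))%E.-integrable setT F.
  by apply: (integrable12ltyP (@sleb2 R) (@sleb2 R) mF).2.
exact: (Fubini (m1 := @sleb2 R) (m2 := @sleb2 R) h).
Qed.

Lemma fubini4_integrable1 (F : RR R * RR R -> \bar R) : measurable_fun setT F ->
  (\int[leb2 R]_x \int[leb2 R]_y `|F (x, y)| < +oo)%E ->
  (leb2 R).-integrable setT (fun x => \int[leb2 R]_y F (x, y))%E.
Proof.
move=> mF iF.
have h : ((@sleb2 R) \x (@sleb2 R))%E.-integrable setT F.
  by apply: (integrable12ltyP (@sleb2 R) (@sleb2 R) mF).2.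
exact: (integrable_fubini_F (m1 := @sleb2 R) (m2 := @sleb2 R) h).
Qed.

Lemma fubini4_integrable2 (F : RR R * RR R -> \bar R) : measurable_fun setT F ->
  (\int[leb2 R]_x \int[leb2 R]_y `|F (x, y)| < +oo)%E ->
  (leb2 R).-integrable setT (fun y => \int[leb2 R]_x F (x, y))%E.
Proof.
move=> mF iF.
have ms : measurable_fun setT (fun z : RR R * RR R => (z.2, z.1)) by mfun.
apply: (@fubini4_integrable1 (fun z => F (z.2, z.1))).
  exact: (mfun_comp mF ms).
rewrite -(@tonelli4 (fun z => `|F z|)%E) //.
exact: measurableT_comp.
Qed.

Lemma poweR2 (x : \bar R) : (0 <= x -> x `^ 2 = x ^+ 2)%E.
Proof.
case: x => [r| |] //; last by rewrite poweRyr ?pnatr_eq0// expe2 mulyy.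
by rewrite lee_fin => r0; rewrite poweR_EFin powR_mulrn// EFin_expe.
Qed.

Lemma L2norm_sqr (g : R * R -> R) :
  (L2norm g ^+ 2 = \int[leb2 R]_x (g x ^+ 2)%:E)%E.
Proof.
rewrite -poweR2 ?Lnorm_ge0// poweR_Lnorm//.
by apply: eq_integral => x _ /=; rewrite powR_mulrn// real_normK ?num_real.
Qed.

(** Squared and in the extended reals, so that neither factor has to be square integrable. *)
Lemma cauchy_schwarz d (T : measurableType d) (mu : {measure set T -> \bar R})
    (f g : T -> R) : measurable_fun setT f -> measurable_fun setT g ->
  ((\int[mu]_x `|f x * g x|%:E) ^+ 2 <=
    (\int[mu]_x (f x ^+ 2)%:E) * (\int[mu]_x (g x ^+ 2)%:E))%E.
Proof.
move=> mf mg.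
have N2 (h : T -> R) : ('N[mu]_2%:E[EFin \o h] ^+ 2 = \int[mu]_x (h x ^+ 2)%:E)%E.
  rewrite -poweR2 ?Lnorm_ge0// poweR_Lnorm//.
  by apply: eq_integral => x _ /=; rewrite powR_mulrn// real_normK ?num_real.
have h2 : (2^-1 + 2^-1 = 1 :> R) by lra.
have := hoelder mu mf mg (ltr0n _ 2) (ltr0n _ 2) h2.
rewrite Lnorm1 => h.
rewrite -!N2 [X in (_ <= X)%E](_ : _ = ('N[mu]_2%:E[EFin \o f] * 'N[mu]_2%:E[EFin \o g]) ^+ 2)%E.
  by rewrite lee_sqr ?integral_ge0// mule_ge0// Lnorm_ge0.
by rewrite !expe2 muleACA.
Qed.

Lemma integral_is_derive (w w1 : R -> R) (a b : R) : a <= b ->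
  (forall s : R, is_derive s 1 w (w1 s)) -> continuous w1 ->
  (\int[leb]_(s in `[a, b]) (w1 s)%:E = (w b - w a)%:E)%E.
Proof.
move=> + hd cw1; rewrite le_eqVlt => /predU1P[->|ab].
  by rewrite set_itv1 integral_set1 subrr.
have cw : continuous w.
  by move=> s; apply: differentiable_continuous; apply/derivable1_diffP; have [] := hd s.
rewrite EFinB; apply: (continuous_FTC2 ab).
- exact: continuous_subspaceT.
- split.
  + by move=> s _; have [] := hd s.
  + exact/cvg_at_right_filter/cw.
  + exact/cvg_at_left_filter/cw.
- by move=> s _; rewrite derive1E; have [_ ->] := hd s.
Qed.

Lemma integrable_le d (T : measurableType d) (mu : {measure set T -> \bar R})
    (f g : T -> R) (D : set T) : measurable D -> measurable_fun D f ->
  mu.-integrable D (EFin \o g) -> (forall s, D s -> `|f s| <= g s) ->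
  mu.-integrable D (EFin \o f).
Proof.
move=> mD mf ig fg; apply: (le_integrable mD _ _ ig).
  exact/measurable_EFinP.
by move=> s Ds /=; rewrite lee_fin (le_trans (fg _ Ds))// ler_norm.
Qed.

(** Integrates [w1 (x + s)] over x in the line and s in [0, 1] in both orders. Integrating first in
    s gives [w (x + 1) - w x], whose integral is zero by translation; integrating first in x gives
    the integral of [w1]. No limit of [w] at infinity is involved. *)
Lemma integral_derive0 (w w1 : R -> R) :
  (forall s : R, is_derive s 1 w (w1 s)) -> continuous w1 ->
  leb.-integrable setT (EFin \o w) -> leb.-integrable setT (EFin \o w1) ->
  (\int[leb]_s (w1 s)%:E = 0)%E.
Proof.
move=> hd cw1 iw iw1.
have mw1 : measurable_fun setT w1 by apply: continuous_measurable_fun.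
have mw : measurable_fun setT w by apply/measurable_EFinP; exact: (measurable_int leb iw).
have sh (h : measurableTypeR R -> \bar R) (a : R) : measurable_fun setT h ->
    (\int[leb]_x h (x + a)%R = \int[leb]_x h x)%E.
  move=> mh; apply: (@integral_measure_preserving R _ _ leb (fun x : measurableTypeR R => (x : R) + a : measurableTypeR R) h) => //.
    by mfun.
  move=> A mA; apply: (etrans _ (lebesgue_shift (- a) mA)).
  by congr (leb _); apply/seteqP; split=> x /=; rewrite opprK.
pose F (z : RR R) : \bar R := (w1 (z.1 + z.2) * \1_`[0, 1] z.2)%:E.
have m01 : measurable_fun setT (\1_`[(0:R), 1] : measurableTypeR R -> R) by [].
have mF : measurable_fun setT F.
  rewrite /F; apply: mfun_EFin; apply: mfun_mul.
    by apply: (mfun_comp mw1); mfun.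
  by apply: (mfun_comp m01); mfun.
have mw1E : measurable_fun setT (fun a : measurableTypeR R => `|(w1 a)%:E|%E).
  by apply: measurableT_comp => //; exact: mfun_EFin.
have iFb (b : R) : (\int[leb]_a `|F (a, b)| = (\1_`[0, 1] b)%:E * \int[leb]_a `|(w1 a)%:E|)%E.
  rewrite -ge0_integralZl//.
  rewrite -(sh (fun a => (\1_`[0, 1] b)%:E * `|(w1 a)%:E|)%E b); last first.
    by apply: measurable_funeM.
  apply: eq_integral => a _; rewrite /F /= -EFinM normrM mulrC; congr (_ * _)%:E.
  by rewrite ger0_norm.
have i01 : (\int[leb]_b (\1_`[0%R, 1%R] b)%:E = 1)%E.
  rewrite integral_indic//= setIT lebesgue_measure_itv/= lte_fin ltr01.
  by rewrite -EFinB subr0.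
have iF : (\int[leb]_b \int[leb]_a `|F (a, b)| < +oo)%E.
  under eq_integral do rewrite iFb.
  have /integrableP[_ h] := iw1.
  rewrite ge0_integralZr//; [|exact: mfun_EFin|by rewrite integral_ge0].
  by rewrite i01 mul1e.
have := Fubini (m1 := leb) (m2 := leb) ((integrable21ltyP leb leb mF).2 iF).
have -> : (\int[leb]_x \int[leb]_y F (x, y) = \int[leb]_x ((w (x + 1))%:E - (w x)%:E))%E.
  apply: eq_integral => x _; rewrite /F /=.
  under eq_integral do rewrite EFinM.
  have -> : (\int[leb]_s ((w1 (x + s))%:E * (\1_`[0%R, 1%R] s)%:E) = \int[leb]_(s in `[0%R, 1%R]) (w1 (x + s))%:E)%E.
    rewrite [RHS]integral_mkcond; apply: eq_integral => s _.
    by rewrite patchE indicE; case: ifP => _; rewrite ?mule1 ?mule0.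
  have hd' (s : R) : is_derive s (1 : R) (fun s => w (x + s)) (w1 (x + s)).
    have h : is_derive s (1 : R) (fun s => x + s) 1.
      by rewrite -[X in is_derive _ _ _ X]add0r; exact: (is_deriveD (is_derive_cst x s 1) (is_derive_id s 1)).
    have := @is_derive1_comp _ w (fun s => x + s) s _ _ (hd (x + s)) h.
    by rewrite mulr1.
  rewrite (integral_is_derive ler01 hd') ?addr0 ?EFinB// => s.
  apply: (continuous_comp (f := fun s => x + s)); last exact: cw1.
  by apply: cvgD; [exact: cvg_cst|exact: cvg_id].
have -> : (\int[leb]_b \int[leb]_a F (a, b) = \int[leb]_s (w1 s)%:E)%E.
  have E b : (\int[leb]_a F (a, b) = (\1_`[0, 1] b)%:E * \int[leb]_a (w1 a)%:E)%E.
    rewrite -(sh (EFin \o w1) b); last exact: mfun_EFin.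
    have iw1b : leb.-integrable setT (fun a => (w1 (a + b))%:E).
      apply/integrableP; split; first by apply: mfun_EFin; apply: (mfun_comp mw1); mfun.
      by rewrite (sh (fun a => `|(w1 a)%:E|%E) b)//; have /integrableP[] := iw1.
    rewrite -integralZl//.
    by apply: eq_integral => a _; rewrite /F /= muleC.
  under eq_integral do rewrite E.
  have fw : (\int[leb]_a (w1 a)%:E)%E \is a fin_num by exact: integrable_fin_num.
  under eq_integral do rewrite muleC -(fineK fw).
  rewrite integralZl// ?i01 ?mule1 ?fineK//.
  apply/integrableP; split; first exact: mfun_EFin.
  under eq_integral do rewrite /= ger0_norm//.
  by rewrite i01 ltry.
move=> <-.
rewrite integralB//.
  by rewrite (sh (EFin \o w)) ?subee//; [exact: integrable_fin_num|exact: mfun_EFin].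
apply/integrableP; split; first by apply: mfun_EFin; apply: (mfun_comp mw); mfun.
rewrite (sh (fun a => `|(w a)%:E|%E) 1)//; first by (have /integrableP[] := iw).
by apply: measurableT_comp => //; exact: mfun_EFin.
Qed.

(** The null set [N] of exceptional lines is there for fields that are singular at the origin: they
    are C^1 along every other line parallel to the axis, so [N] is then the single point 0. *)
Lemma leb2_derive0 (W W1 : RR R -> R) (N : set R) :
  leb.-negligible N ->
  (forall s b : R, ~ N b -> is_derive s 1 (fun s => W (s, b)) (W1 (s, b))) ->
  (forall b, ~ N b -> continuous (fun s => W1 (s, b))) ->
  (leb2 R).-integrable setT (EFin \o W) -> (leb2 R).-integrable setT (EFin \o W1) ->
  (\int[leb2 R]_x (W1 x)%:E = 0)%E.
Proof.
move=> nN hd hc iW iW1.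
rewrite -(integral21_prod_meas1 (m1 := leb) (m2 := leb) iW1).
have aW := ae_integrable2 (m1 := leb) (m2 := leb) iW.
have aW1 := ae_integrable2 (m1 := leb) (m2 := leb) iW1.
have aN : (\forall b \ae leb, ~ N b).
  by apply: negligibleS nN => b /= /contrapT.
rewrite -(integral0 leb setT); apply: ae_eq_integral => //.
  exact: (measurable_fubini_G (m1 := leb) (m2 := leb) iW1).
apply: filterS3 aW aW1 aN => b h h1 nb _.
by apply: (integral_derive0 (w := fun s => W (s, b))) => // s; [exact: hd|exact: hc].
Qed.

Lemma leb2_derive0_snd (W W1 : RR R -> R) (N : set R) :
  leb.-negligible N ->
  (forall (s a : R), ~ N a -> is_derive s 1 (fun s => W (a, s)) (W1 (a, s))) ->
  (forall a, ~ N a -> continuous (fun s => W1 (a, s))) ->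
  (leb2 R).-integrable setT (EFin \o W) -> (leb2 R).-integrable setT (EFin \o W1) ->
  (\int[leb2 R]_x (W1 x)%:E = 0)%E.
Proof.
move=> nN hd hc iW iW1.
have sw (h : RR R -> R) : (leb2 R).-integrable setT (EFin \o h) ->
    (leb2 R).-integrable setT (EFin \o (fun x => h (x.2, x.1))).
  move=> /integrableP[mh ih]; apply/integrableP; split.
    apply: mfun_EFin; apply: (mfun_comp (g := h)); first exact/measurable_EFinP.
    by mfun.
  have E := @integral_leb2_swap R (fun x => `|(h x)%:E|%E).
  by rewrite -E in ih; last exact: measurableT_comp.
have mW1 : measurable_fun setT (EFin \o W1) by exact: measurable_int iW1.
rewrite -(integral_leb2_swap mW1).
apply: (leb2_derive0 (W := fun x => W (x.2, x.1)) (W1 := fun x => W1 (x.2, x.1)) nN) => //; exact: sw.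
Qed.
End integration.

(** * The kernel [1 / (r (1 + r^2))] *)

Section derivation.
Context {R : realType}.
Implicit Types (f g : R -> R) (s a b : R).

Lemma der_eq s f a b : is_derive s 1 f a -> a = b -> is_derive s 1 f b.
Proof. by move=> h <-. Qed.

Lemma der_cst s a : is_derive s 1 (fun _ : R => a) 0.
Proof. exact: is_derive_cst. Qed.

Lemma der_id s : is_derive s 1 (fun x : R => x) 1.
Proof. exact: is_derive_id. Qed.

Lemma der_add s f g a b : is_derive s 1 f a -> is_derive s 1 g b ->
  is_derive s 1 (fun x => f x + g x) (a + b).
Proof. by move=> ? ?; exact: is_deriveD. Qed.

Lemma der_opp s f a : is_derive s 1 f a -> is_derive s 1 (fun x => - f x) (- a).
Proof. by move=> ?; exact: is_deriveN. Qed.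

Lemma der_mul s f g a b : is_derive s 1 f a -> is_derive s 1 g b ->
  is_derive s 1 (fun x => f x * g x) (a * g s + f s * b).
Proof.
move=> ha hb; apply: der_eq (@is_deriveM _ _ _ _ _ _ _ _ ha hb) _.
by rewrite addrC mulrC; congr (_ + _).
Qed.

Lemma der_exp s f a n : is_derive s 1 f a ->
  is_derive s 1 (fun x => f x ^+ n) (n%:R * f s ^+ n.-1 * a).
Proof.
move=> h; elim: n => [|n IH].
  by rewrite !mul0r; exact: der_cst.
under eq_fun do rewrite exprS.
apply: der_eq (der_mul h IH) _ => /=.
rewrite -natr1; case: n {IH} => [|n]; first by rewrite expr0; ring.
by rewrite /= exprS; ring.
Qed.

Lemma der_comp s f g a b : is_derive (f s) 1 g b -> is_derive s 1 f a ->
  is_derive s 1 (fun x => g (f x)) (b * a).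
Proof. by move=> hg hf; exact: (@is_derive1_comp _ g f). Qed.

Lemma der_inv s f a : is_derive s 1 f a -> f s != 0 ->
  is_derive s 1 (fun x => (f x)^-1) (- a / f s ^+ 2).
Proof.
move=> h f0; have h1 := @is_deriveV R f s a 1 f0 h.
apply: (der_eq h1).
by rewrite /GRing.scale /= !mulNr mulrC.
Qed.

Lemma der_sqrt s f a : is_derive s 1 f a -> 0 < f s ->
  is_derive s 1 (fun x => Num.sqrt (f x)) (a / (2 * Num.sqrt (f s))).
Proof.
move=> h f0; apply: (der_eq (der_comp (is_derive1_sqrt f0) h)).
by rewrite mulrC.
Qed.

Lemma der_shift s f a c : is_derive (s + c) 1 f a -> is_derive s 1 (fun x => f (x + c)) a.
Proof.
move=> h; apply: der_eq (der_comp (f := fun x => x + c) h (der_add (der_id s) (der_cst s c))) _.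
by rewrite addr0 mulr1.
Qed.

Lemma der_continuous s f a : is_derive s 1 f a -> {for s, continuous f}.
Proof.
by move=> h; apply: differentiable_continuous; apply/derivable1_diffP; case: h.
Qed.
End derivation.

Ltac der1 := first
  [ eassumption
  | exact: der_cst
  | exact: der_id
  | eapply der_opp
  | eapply der_add
  | eapply der_mul
  | eapply der_inv
  | eapply der_sqrt
  | eapply der_exp ].

Section kernel.
Context {R : realType}.
Local Notation leb := (@lebesgue_measure R).

Lemma integral_is_derive_in (w w1 : R -> R) (a b : R) : a < b ->
  (forall s : R, a <= s <= b -> is_derive s 1 w (w1 s)) ->
  (forall s : R, a <= s <= b -> {for s, continuous w1}) ->
  (\int[leb]_(s in `[a, b]) (w1 s)%:E = (w b - w a)%:E)%E.
Proof.
move=> ab hd cw1.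
have cw (s : R) : a <= s <= b -> {for s, continuous w} by move=> /hd; exact: der_continuous.
rewrite EFinB; apply: (continuous_FTC2 ab).
- by apply: continuous_in_subspaceT => s; rewrite inE/= in_itv/=; exact: cw1.
- split.
  + move=> s; rewrite in_itv/= => /andP[/ltW h1 /ltW h2]; have hs : a <= s <= b by rewrite h1 h2.
    by have [] := hd s hs.
  + by apply: cvg_at_right_filter; apply: cw; rewrite lexx ltW.
  + by apply: cvg_at_left_filter; apply: cw; rewrite lexx ltW.
- move=> s; rewrite in_itv/= => /andP[/ltW h1 /ltW h2]; rewrite derive1E.
  have hs : a <= s <= b by rewrite h1.
  by have [_ ->] := hd s hs.
Qed.

Definition root4 (s : R) := Num.sqrt (Num.sqrt `|s|).

(** On the positive axis this is the derivative of 4 atan(s^(1/4)), hence integrable: it is of order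
    |s|^(-3/4) at zero and |s|^(-5/4) at infinity. Products of two such factors dominate the kernels
    on the plane. *)
Definition itk (s : R) := ((1 + root4 s ^+ 2) * (root4 s ^+ 3))^-1.

Lemma root4_ge0 s : 0 <= root4 s. Proof. exact: sqrtr_ge0. Qed.

Lemma root4_gt0 s : s != 0 -> 0 < root4 s.
Proof. by move=> s0; rewrite !sqrtr_gt0 normr_gt0. Qed.

Lemma root4X4 s : root4 s ^+ 4 = `|s|.
Proof. by rewrite (exprM _ 2 2) !sqr_sqrtr ?sqrtr_ge0. Qed.

Lemma itk_ge0 s : 0 <= itk s.
Proof.
by rewrite invr_ge0 mulr_ge0 ?exprn_ge0 ?root4_ge0// addr_ge0// exprn_ge0 ?root4_ge0.
Qed.

Lemma measurable_itk : measurable_fun setT (itk : measurableTypeR R -> R).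
Proof. by rewrite /itk /root4; mfun. Qed.

Lemma der_itk (s : R) : 0 < s ->
  is_derive s 1 (fun s => 4 * atan (Num.sqrt (Num.sqrt s))) (itk s).
Proof.
move=> s0; have ss0 : 0 < Num.sqrt s by rewrite sqrtr_gt0.
have sss0 : 0 < Num.sqrt (Num.sqrt s) by rewrite sqrtr_gt0.
apply: (der_eq (der_mul (der_cst s 4) (der_comp (is_derive1_atan _) (der_sqrt (der_sqrt (der_id s) s0) ss0)))).
rewrite /itk /root4 gtr0_norm// mul0r add0r.
set q := Num.sqrt (Num.sqrt s).
have -> : Num.sqrt s = q ^+ 2 by rewrite sqr_sqrtr ?sqrtr_ge0.
have q0 : q != 0 by rewrite gt_eqF.
have q1 : 1 + q ^+ 2 != 0 by rewrite gt_eqF// ltr_pwDl// sqr_ge0.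
by field; rewrite q0 q1.
Qed.

Lemma itk_continuous (s : R) : 0 < s -> {for s, continuous itk}.
Proof.
move=> s0; rewrite /itk /root4.
have c1 : {for s, continuous root4}.
  apply: (@continuous_comp _ _ _ (fun s => Num.sqrt `|s|) (@Num.sqrt R)); last exact: sqrt_continuous.
  apply: (@continuous_comp _ _ _ (fun s : R => `|s|) (@Num.sqrt R)); last exact: sqrt_continuous.
  exact: norm_continuous.
have q0 := root4_gt0 (lt0r_neq0 s0).
apply: cvgV; first by rewrite gt_eqF// mulr_gt0 ?exprn_gt0// ltr_pwDl ?sqr_ge0.
apply: cvgM; last exact: (continuous_comp c1 (@exprn_continuous R _ _)).
by apply: cvgD; [exact: cvg_cst|exact: (continuous_comp c1 (@exprn_continuous R _ _))].
Qed.

Lemma integral_itk_lty : (\int[leb]_s (itk s)%:E < +oo)%E.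
Proof.
pose a s := itk s * \1_`]0, +oo[ s.
have m1 : measurable_fun setT (\1_`](0:R), +oo[ : measurableTypeR R -> R) by [].
have mi := measurable_itk.
have ma : measurable_fun setT (a : measurableTypeR R -> R) by rewrite /a; mfun.
have a0 s : 0 <= a s by rewrite mulr_ge0// itk_ge0.
(* The identity also holds at 0, where [itk] is 0 because the inverse of 0 is 0. *)
have E s : itk s = a s + a (- s).
  rewrite /a !indicE !mem_setE !in_itv/= !andbT oppr_gt0.
  have -> : itk (- s) = itk s by rewrite /itk /root4 normrN.
  have [s0|s0|->] := ltgtP s 0; rewrite /= ?mulr1 ?mulr0 ?addr0 ?add0r//.
  by rewrite /itk /root4 normr0 !sqrtr0 !expr0n /= mulr0 invr0.
under eq_integral do rewrite E EFinD.
have mEa : measurable_fun setT (fun s : measurableTypeR R => (a s)%:E) by exact: mfun_EFin.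
have mEaN : measurable_fun setT (fun s : measurableTypeR R => (a (- s))%:E).
  by apply: mfun_EFin; apply: (mfun_comp ma); mfun.
rewrite ge0_integralD//; [|by move=> s _; rewrite lee_fin|by move=> s _; rewrite lee_fin].
have -> : (\int[leb]_s (a (- s))%:E = \int[leb]_s (a s)%:E)%E.
  apply: (@integral_measure_preserving R _ _ leb (fun x : measurableTypeR R => - (x : R) : measurableTypeR R) (fun s => (a s)%:E)) => //.
    by mfun.
  by move=> A mA; exact: lebesgue_opp.
suff h : (\int[leb]_s (a s)%:E <= (4 * pi)%:E)%E.
  by apply: (@le_lt_trans _ _ ((4 * pi)%:E + (4 * pi)%:E)%E); [exact: leeD|rewrite -EFinD ltry].
have -> : (\int[leb]_s (a s)%:E = \int[leb]_(s in `]0%R, +oo[) (itk s)%:E)%E.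
  rewrite [RHS]integral_mkcond; apply: eq_integral => s _.
  by rewrite patchE /a indicE; case: ifP => _; rewrite ?mulr1 ?mulr0.
pose F (n : nat) : set (measurableTypeR R) := `[n.+2%:R^-1, n.+2%:R]%classic.
have UF : `]0%R, +oo[%classic = \bigcup_n F n.
  apply/seteqP; split => s /=.
    rewrite in_itv/= andbT => s0; pose n := Num.Def.archi_bound (s + s^-1); exists n => //.
    have si0 : 0 < s^-1 by rewrite invr_gt0.
    have hn : s + s^-1 < n%:R := archi_boundP (addr_ge0 (ltW s0) (ltW si0)).
    have hn2 : n%:R <= n.+2%:R :> R by rewrite ler_nat; lia.
    rewrite /F /= in_itv/=; apply/andP; split; last lra.
    rewrite -[leRHS]invrK lef_pV2 ?posrE ?ltr0n//; lra.
  move=> [n _]; rewrite /F /= !in_itv/= andbT => /andP[h _]; apply: lt_le_trans h; by rewrite invr_gt0 ltr0n.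
rewrite UF.
have mF n : measurable (F n) by exact: measurable_itv.
have cv : (\int[leb]_(s in F n) (itk s)%:E @[n --> \oo] --> \int[leb]_(s in \bigcup_n F n) (itk s)%:E)%E.
  apply: (@ge0_nondecreasing_set_cvg_integral _ _ _ F (fun s => (itk s)%:E) leb) => //.
  - apply/nondecreasing_seqP => n; apply/subsetPset => s; rewrite /F /= !in_itv/= => /andP[h1 h2].
    rewrite (le_trans _ h1) ?(le_trans h2) ?ler_nat// lef_pV2 ?ler_nat// ?posrE ?ltr0n//.
  - by move=> n; apply: measurable_funTS; exact: mfun_EFin.
  - by move=> n s _; rewrite lee_fin itk_ge0.
apply: (cvge_to_le cv).
apply: nearW => n.
have n0 : 0 < n.+2%:R^-1 :> R by rewrite invr_gt0 ltr0n.
have nn : n.+2%:R^-1 < n.+2%:R :> R.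
  by rewrite (@lt_trans _ _ 1)// ?ltr1n// invf_lt1 ?ltr1n// ltr0n.
have h1 (s : R) : n.+2%:R^-1 <= s <= n.+2%:R ->
    is_derive s 1 (fun s => 4 * atan (Num.sqrt (Num.sqrt s))) (itk s).
  by move=> /andP[h _]; apply: der_itk; apply: lt_le_trans h.
have h2 (s : R) : n.+2%:R^-1 <= s <= n.+2%:R -> {for s, continuous itk}.
  by move=> /andP[h _]; apply: itk_continuous; apply: lt_le_trans h.
rewrite /F (integral_is_derive_in nn h1 h2) lee_fin -mulrBr ler_pM2l//.
have := @atan_ltpi2 R (Num.sqrt (Num.sqrt n.+2%:R)).
have := @atan_gtNpi2 R (Num.sqrt (Num.sqrt n.+2%:R^-1)).
lra.
Qed.

End kernel.

Section kk.
Context {R : realType}.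
Local Notation leb := (@lebesgue_measure R).
Implicit Types y : RR R.

Definition kk y : R := (enorm y * (1 + enorm y ^+ 2))^-1.
(** The additional factor r^(-1/2) near the origin is what a gradient that is only Hoelder 1/2
    leaves of the contour kernel. *)
Definition kh y : R := kk y * (1 + (Num.sqrt (enorm y))^-1).

Lemma enorm_ge0 y : 0 <= enorm y. Proof. exact: sqrtr_ge0. Qed.

Lemma enorm_sqr y : enorm y ^+ 2 = y.1 ^+ 2 + y.2 ^+ 2.
Proof. by rewrite sqr_sqrtr// addr_ge0 ?sqr_ge0. Qed.

Lemma enorm_fst y : `|y.1| <= enorm y.
Proof. by rewrite -sqrtr_sqr ler_wsqrtr// lerDl sqr_ge0. Qed.

Lemma enorm_snd y : `|y.2| <= enorm y.
Proof. by rewrite -sqrtr_sqr ler_wsqrtr// lerDr sqr_ge0. Qed.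

Lemma enormN y : enorm (- y) = enorm y.
Proof. by rewrite /enorm /= !sqrrN. Qed.

Lemma kk_ge0 y : 0 <= kk y.
Proof. by rewrite invr_ge0 mulr_ge0 ?enorm_ge0// addr_ge0 ?sqr_ge0. Qed.

Lemma kk_le_kh y : kk y <= kh y.
Proof. by rewrite /kh ler_peMr ?kk_ge0// lerDl invr_ge0 sqrtr_ge0. Qed.

Lemma kh_ge0 y : 0 <= kh y.
Proof. exact: le_trans (kk_ge0 y) (kk_le_kh y). Qed.

Lemma measurable_kk : measurable_fun setT kk.
Proof. by rewrite /kk; mfun. Qed.

Lemma measurable_kh : measurable_fun setT kh.
Proof. by have := measurable_kk; rewrite /kh => ?; mfun. Qed.

(** Both |y.1| and |y.2| are at most r and [itk] decreases in the modulus, so the product is at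
    least the square of [itk r]. With u = sqrt r the claim becomes (1 + u)^3 <= 8 (1 + u^4). *)
Lemma kh_tensor y : y.1 != 0 -> y.2 != 0 -> kh y <= 8 * (itk y.1 * itk y.2).
Proof.
move=> y1 y2.
have a0 := root4_gt0 y1; have b0 := root4_gt0 y2.
have r0 : 0 < enorm y by apply: lt_le_trans (enorm_fst y); rewrite normr_gt0.
pose q := root4 (enorm y).
have q0 : 0 < q by apply: root4_gt0; rewrite gt_eqF.
have aq : root4 y.1 <= q.
  by rewrite /q /root4 (ger0_norm (ltW r0)) !ler_wsqrtr// enorm_fst.
have bq : root4 y.2 <= q.
  by rewrite /q /root4 (ger0_norm (ltW r0)) !ler_wsqrtr// enorm_snd.
have q4 : enorm y = q ^+ 4 by rewrite root4X4 gtr0_norm.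
have q2 : Num.sqrt (enorm y) = q ^+ 2.
  by rewrite /q /root4 gtr0_norm// sqr_sqrtr ?sqrtr_ge0.
rewrite /kh /kk q2 q4 /itk.
move: aq bq; set a := root4 y.1; set b := root4 y.2 => aq bq.
have le1 (c : R) : 0 < c -> c <= q -> ((1 + q ^+ 2) * q ^+ 3)^-1 <= ((1 + c ^+ 2) * c ^+ 3)^-1.
  move=> c0 cq; have c1 := ltW c0; have qq := ltW q0.
  rewrite lef_pV2 ?posrE ?mulr_gt0 ?exprn_gt0// ?addr_gt0 ?exprn_gt0//.
  by apply: ler_pM; rewrite ?addr_ge0 ?exprn_ge0 ?lerD2l ?lerXn2r ?nnegrE//.
apply: (@le_trans _ _ (8 * (((1 + q ^+ 2) * q ^+ 3)^-1 * ((1 + q ^+ 2) * q ^+ 3)^-1))); last first.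
  rewrite ler_pM2l//; have h0 : 0 <= ((1 + q ^+ 2) * q ^+ 3)^-1.
    by rewrite invr_ge0 mulr_ge0 ?addr_ge0 ?exprn_ge0// ltW.
  by apply: ler_pM => //; exact: le1.
have u0 : 0 < q ^+ 2 by rewrite exprn_gt0.
have p1 : q ^+ 4 = (q ^+ 2) ^+ 2 by rewrite -exprM.
have p3 : q ^+ 3 * q ^+ 3 = (q ^+ 2) ^+ 3 by rewrite -exprM -exprD.
rewrite p1 -invfM mulrACA p3; set u := q ^+ 2 in u0 *.
have e1 : 1 + u ^-1 = (1 + u) / u by field; rewrite gt_eqF.
rewrite e1 mulrA ler_pdivrMr// mulrC ler_pdivrMr ?mulr_gt0 ?addr_gt0 ?exprn_gt0//.
have e2 : 8 * ((1 + u) * (1 + u) * u ^+ 3)^-1 * u * (u ^+ 2 * (1 + (u ^+ 2) ^+ 2)) = 8 * (1 + u ^+ 4) / (1 + u) ^+ 2.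
  by field; rewrite !gt_eqF//= addr_gt0.
rewrite [leRHS](_ : _ = 8 * (1 + u ^+ 4) / (1 + u) ^+ 2); last by rewrite -e2; ring.
rewrite ler_pdivlMr ?exprn_gt0 ?addr_gt0//.
have h1 : 0 <= (u - 1) ^+ 2 by exact: sqr_ge0.
have h2 : 0 <= (u ^+ 2 - u) ^+ 2 by exact: sqr_ge0.
have h3 : 0 <= (u ^+ 2 - 1) ^+ 2 by exact: sqr_ge0.
nra.
Qed.

(** [kh_tensor] excludes the axes, where [itk] takes its default value 0. The same null set later
    serves to discard the origin. *)
Lemma axes_negligible : (leb2 R).-negligible [set y : RR R | y.1 = 0 \/ y.2 = 0].
Proof.
exists (([set 0] `*` setT) `|` (setT `*` [set 0])); split.
- by apply: measurableU; apply: measurableX.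
- apply/eqP; rewrite -measure_le0.
  have m1 : measurable ([set (0:measurableTypeR R)] `*` [set: measurableTypeR R]) by apply: measurableX.
  have m2 : measurable ([set: measurableTypeR R] `*` [set (0:measurableTypeR R)]) by apply: measurableX.
  apply: (le_trans (measureU2 (leb2 R) m1 m2)).
  have e1 : leb2 R ([set (0:measurableTypeR R)] `*` [set: measurableTypeR R]) = 0%E.
    transitivity (leb [set (0%R:R)] * leb [set: R])%E; first exact: product_measure1E.
    by rewrite lebesgue_measure_set1 mul0e.
  have e2 : leb2 R ([set: measurableTypeR R] `*` [set (0:measurableTypeR R)]) = 0%E.
    transitivity (leb [set: R] * leb [set (0%R:R)])%E; first exact: product_measure1E.
    by rewrite lebesgue_measure_set1 mule0.
  rewrite -[leRHS]adde0; apply: leeD; rewrite le_eqVlt; apply/orP; left; apply/eqP.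
    exact: e1.
  exact: e2.
- by move=> [a b] /= [->|->]; [left|right].
Qed.

Lemma kh_lty : (\int[leb2 R]_y (kh y)%:E < +oo)%E.
Proof.
have mi := @measurable_itk R.
have mt : measurable_fun setT (fun y => 8 * (itk y.1 * itk y.2)).
  apply: mfun_mul; first exact: mfun_cst.
  by apply: mfun_mul; [apply: (mfun_comp mi)|apply: (mfun_comp mi)]; mfun.
have t0 y : 0 <= 8 * (itk y.1 * itk y.2) by rewrite !mulr_ge0 ?itk_ge0.
apply: (@le_lt_trans _ _ (\int[leb2 R]_y (8 * (itk y.1 * itk y.2))%:E)%E).
  apply: ae_ge0_le_integral => //.
  - by move=> y _; rewrite lee_fin kh_ge0.
  - by apply: mfun_EFin; exact: measurable_kh.
  - by move=> y _; rewrite lee_fin.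
  - exact: mfun_EFin.
  - apply: (negligibleS _ axes_negligible) => y /= h; apply: contrapT => /not_orP[h1 h2].
    by apply: h => _; rewrite lee_fin; apply: kh_tensor; apply/eqP.
rewrite leb2_tonelli1//; last exact: mfun_EFin.
have E a : (\int[leb]_b (8 * (itk a * itk b))%:E = (8 * itk a)%:E * \int[leb]_b (itk b)%:E)%E.
  rewrite -ge0_integralZl//.
  - by apply: eq_integral => b _; rewrite -EFinM mulrA.
  - exact: mfun_EFin.
  - by move=> b _; rewrite lee_fin itk_ge0.
  - by rewrite lee_fin mulr_ge0// itk_ge0.
under eq_integral do rewrite /= E.
have If := @integral_itk_lty R.
have I0 : (0 <= \int[leb]_b (itk b)%:E)%E by apply: integral_ge0 => b _; rewrite lee_fin itk_ge0.
rewrite ge0_integralZr//; last 2 first.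
- by apply: mfun_EFin; mfun.
- by move=> b _; rewrite lee_fin mulr_ge0// itk_ge0.
under eq_integral do rewrite EFinM.
rewrite ge0_integralZl//; last 2 first.
- exact: mfun_EFin.
- by move=> b _; rewrite lee_fin itk_ge0.
have -> : (\int[leb]_b (itk b)%:E = (fine (\int[leb]_b (itk b)%:E))%:E)%E.
  by rewrite fineK// ge0_fin_numE.
by rewrite -!EFinM ltry.
Qed.

Lemma kk_lty : (\int[leb2 R]_y (kk y)%:E < +oo)%E.
Proof.
apply: le_lt_trans kh_lty; apply: ge0_le_integral => //.
- by move=> y _; rewrite lee_fin kk_ge0.
- by apply: mfun_EFin; exact: measurable_kk.
- by apply: mfun_EFin; exact: measurable_kh.
- by move=> y _; rewrite lee_fin kk_le_kh.
Qed.

End kk.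

(** * Mollification *)

Section bump.
Context {R : realType}.
Local Notation leb := (@lebesgue_measure R).
Implicit Types (f g : R -> R) (p q : {poly R}).

Lemma near_ltr (s a : R) : s < a -> \forall t \near s, t < a.
Proof.
move=> sa; exists (a - s) => /=; first by rewrite subr_gt0.
by move=> t /=; rewrite distrC => /(le_lt_trans (ler_norm _)); rewrite ltrD2r.
Qed.

Lemma near_gtr (s a : R) : a < s -> \forall t \near s, a < t.
Proof.
move=> sa; exists (s - a) => /=; first by rewrite subr_gt0.
by move=> t /= /(le_lt_trans (ler_norm _)); rewrite ltrD2l ltrN2.
Qed.

(** The polynomial factor makes the family closed under differentiation, so that smoothness of
    exp(-1/s) extended by 0 is an induction. *)
Definition flat p (s : R) : R := if 0 < s then p.[s^-1] * expR (- s^-1) else 0.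

Lemma poly_expR_bound p : exists2 C : R, 0 <= C &
  forall u : R, 0 <= u -> `|p.[u] * expR (- u)| <= C.
Proof.
(* Termwise, u^i <= i! exp(u). *)
exists (\sum_(i < size p) `|p`_i| * (i`!)%:R).
  by apply: sumr_ge0 => i _; rewrite mulr_ge0.
move=> u u0; rewrite horner_coef normrM (ger0_norm (expR_ge0 _)).
apply: (@le_trans _ _ (\sum_(i < size p) (`|p`_i| * u ^+ i) * expR (- u))).
  rewrite -mulr_suml ler_wpM2r ?expR_ge0//.
  apply: (le_trans (ler_norm_sum _ _ _)); apply: ler_sum => i _.
  by rewrite normrM (ger0_norm (exprn_ge0 _ u0)).
apply: ler_sum => i _; rewrite -mulrA ler_wpM2l//.
rewrite expRN ler_pdivrMr ?expR_gt0//.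
case: i => -[|i] _ /=.
  by rewrite expr0 fact0 mul1r; have := expR_ge1Dx u; lra.
have h := expR_ge1Dxn i u0.
have f0 : 0 < (i.+1)`!%:R :> R by rewrite ltr0n fact_gt0.
rewrite mulrC -ler_pdivrMr//; lra.
Qed.

Lemma flat_le p : exists2 C : R, 0 <= C & forall s : R, `|flat p s| <= C.
Proof.
have [C C0 hC] := poly_expR_bound p; exists C => // s.
rewrite /flat; case: ifPn => s0; last by rewrite normr0.
by apply: hC; rewrite invr_ge0 ltW.
Qed.

(** The bound for X^2 p at the point 1/s. Quadratic smallness is what makes the derivative at 0
    exist and vanish. *)
Lemma flat_sqr_le p : exists2 C : R, 0 <= C & forall s : R, `|flat p s| <= C * s ^+ 2.
Proof.
have [C C0 hC] := poly_expR_bound ('X^2 * p); exists C => // s.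
rewrite /flat; case: ifPn => s0; last by rewrite normr0 mulr_ge0// sqr_ge0.
have /hC : 0 <= s^-1 by rewrite invr_ge0 ltW.
rewrite hornerM hornerXn -mulrA normrM [X in X * _]ger0_norm ?sqr_ge0//.
by rewrite exprVn mulrC ler_pdivrMr ?exprn_gt0.
Qed.

Lemma flat_le0 p s : s <= 0 -> flat p s = 0.
Proof. by rewrite /flat ltNge => ->. Qed.

Lemma der_flat p (s : R) : is_derive s 1 (flat p) (flat ('X^2 * (p - p^`())) s).
Proof.
have [s0|s0|->] := ltgtP s 0.
- rewrite [X in is_derive _ _ _ X]flat_le0 ?ltW//.
  apply: near_eq_is_derive (der_cst s 0).
  near=> t; rewrite flat_le0// ltW//; near: t; exact: near_ltr.
- have h : is_derive s 1 (fun t : R => p.[t^-1] * expR (- t^-1)) (flat ('X^2 * (p - p^`())) s).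
    have hi : is_derive s 1 (fun t : R => t^-1) (- 1 / s ^+ 2).
      by apply: (der_inv (der_id s)); rewrite gt_eqF.
    have hp := der_comp (f := fun t : R => t^-1) (is_derive_poly p s^-1) hi.
    have he := der_comp (f := fun t : R => - t^-1) (is_derive_expR (- s^-1)) (der_opp hi).
    apply: (der_eq (der_mul hp he)).
    rewrite /flat s0 hornerM hornerXn hornerD hornerN; field.
    by rewrite gt_eqF.
  apply: near_eq_is_derive h.
  near=> t; rewrite /flat ifT//; near: t; exact: near_gtr.
- rewrite [X in is_derive _ _ _ X]flat_le0//.
  have [C C0 hC] := flat_sqr_le p.
  have F0 : flat p 0 = 0 by rewrite flat_le0.
  suff h : (fun h : R => h^-1 *: (flat p (h *: 1 + 0) - flat p 0)) h @[h --> 0^'] --> (0 : R).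
    apply: DeriveDef; first by apply/cvg_ex; exists 0; exact: h.
    by apply/cvg_lim.
  have C1 : 0 < C + 1 by lra.
  apply/cvgrPdist_le => e e0; have he0 : 0 < e / (C + 1) by rewrite divr_gt0.
  near=> h.
  have h0 : h != 0 by near: h; exact: nbhs_dnbhs_neq.
  rewrite sub0r normrN F0 subr0 addr0 /GRing.scale /= mulr1 normrM normfV.
  rewrite mulrC ler_pdivrMr ?normr_gt0//.
  apply: (le_trans (hC h)); rewrite -[h ^+ 2]real_normK ?num_real// expr2 mulrA.
  rewrite ler_wpM2r//.
  have he : `|h| <= e / (C + 1).
    near: h; exact: dnbhs0_le.
  apply: (@le_trans _ _ ((C + 1) * `|h|)).
    by rewrite ler_wpM2r// lerDl.
  by rewrite mulrC -ler_pdivlMr.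
Unshelve. all: end_near. Qed.

Lemma indic_itvE (u v s : R) : \1_`[u, v] s = ((u <= s <= v)%R)%:R :> R.
Proof. by rewrite indicE mem_setE in_itv. Qed.

(** Differentiability of order n with the derivatives as witnesses, so that products and reflections
    go by induction on n. *)
Fixpoint Cn (n : nat) (f : R -> R) : Prop :=
  if n is n'.+1 then exists2 f', (forall s : R, is_derive s 1 f (f' s)) & Cn n' f' else True.

Lemma CnS n f : Cn n.+1 f -> Cn n f.
Proof. by elim: n f => // n IH f [f' hf /IH h]; exists f'. Qed.

Lemma CnD n f g : Cn n f -> Cn n g -> Cn n (fun s => f s + g s).
Proof.
elim: n f g => // n IH f g [f' hf Cf] [g' hg Cg].
exists (fun s => f' s + g' s); last exact: IH.
by move=> s; exact: der_add.
Qed.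

Lemma CnM n f g : Cn n f -> Cn n g -> Cn n (fun s => f s * g s).
Proof.
elim: n f g => // n IH f g fn gn; have [f' hf Cf] := fn; have [g' hg Cg] := gn.
exists (fun s => f' s * g s + f s * g' s); first by move=> s; exact: der_mul.
by apply: CnD; apply: IH => //; exact: CnS.
Qed.

Lemma Cn_cst n c : Cn n (fun=> c).
Proof. by elim: n c => // n IH c; exists (fun=> 0); [move=> s; exact: der_cst|exact: IH]. Qed.

Lemma Cn_flat n p : Cn n (flat p).
Proof. by elim: n p => // n IH p; eexists; [move=> s; exact: der_flat|exact: IH]. Qed.

Lemma Cn_refl n f c : Cn n f -> Cn n (fun s => f (c - s)).
Proof.
elim: n f => // n IH f [f' hf Cf]; exists (fun s => -1 * f' (c - s)).
  move=> s; have h : is_derive s 1 (fun s : R => c - s) (0 - 1).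
    by apply: (der_add (der_cst s c)); exact: der_opp (der_id s).
  by apply: (der_eq (der_comp (f := fun s : R => c - s) (hf _) h)); ring.
by apply: CnM; [exact: Cn_cst|exact: IH].
Qed.

Lemma Cn_tower f : (forall n, Cn n f) ->
  forall k (s : R), is_derive s 1 (derive1n k f) (derive1n k.+1 f s).
Proof.
move=> hf k s.
have {}hf n : Cn n (derive1n k f).
  elim: k n => [|k IH] n; first by rewrite derive1n0.
  have [f' hd Cf'] := IH n.+1.
  rewrite derive1nS (_ : derive1 (derive1n k f) = f')//.
  by apply/funext => t; rewrite derive1E; have [_ ->] := hd t.
have [f' hd _] := hf 1%N.
by rewrite derive1nS derive1E; apply: DeriveDef => //; have [] := hd s.
Qed.

(** All derivatives belong to the structure, since those of tensor products are computed from them.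
    The support is one-sided: at [x] one averages over the square with lower left corner [x] and
    side [d]. *)
Record mollifier (d : R) := Mollifier {
  moll :> nat -> R -> R;
  moll_der : forall k (s : R), is_derive s 1 (moll k) (moll k.+1 s);
  moll_ge0 : forall s, 0 <= moll 0 s;
  moll_out : forall k s, ~~ (0 <= s <= d) -> moll k s = 0;
  moll_int : (\int[leb]_s (moll 0 s)%:E = 1)%E }.

(** The complement of [a, b] is open, so the preceding derivative vanishes in a neighbourhood of the
    point. *)
Lemma tower_out (D : nat -> R -> R) (a b : R) :
  (forall k (s : R), is_derive s 1 (D k) (D k.+1 s)) ->
  (forall s, ~~ (a <= s <= b) -> D 0%N s = 0) ->
  forall k s, ~~ (a <= s <= b) -> D k s = 0.
Proof.
move=> hD h0; elim=> // k IH s hs.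
have h : is_derive s 1 (D k) 0.
  apply: near_eq_is_derive (der_cst s 0).
  move: hs; rewrite negb_and -!ltNge => /orP[sa|bs].
    near=> t; rewrite IH// negb_and -!ltNge; apply/orP; left; near: t; exact: near_ltr.
  near=> t; rewrite IH// negb_and -!ltNge; apply/orP; right; near: t; exact: near_gtr.
by have [_ <-] := hD k s; have [_ ->] := h.
Unshelve. all: end_near. Qed.

Lemma mollifier_exists (d : R) : 0 < d -> exists m : mollifier d, True.
Proof.
move=> d0.
pose b s := flat 1 s * flat 1 (d - s).
have Cb n : Cn n b by apply: CnM; [exact: Cn_flat|apply: Cn_refl; exact: Cn_flat].
have f0 s : 0 <= flat 1 s.
  by rewrite /flat; case: ifP => // _; rewrite hornerC mul1r expR_ge0.
have b0 s : 0 <= b s by rewrite mulr_ge0.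
have bout s : ~~ (0 <= s <= d) -> b s = 0.
  rewrite negb_and -!ltNge => /orP[h|h]; rewrite /b.
    by rewrite flat_le0 ?mul0r// ltW.
  by rewrite (@flat_le0 _ (d - s)) ?mulr0// subr_le0 ltW.
have bd := Cn_tower Cb.
have mb : measurable_fun setT (b : measurableTypeR R -> R).
  apply: continuous_measurable_fun => s; exact: der_continuous (bd 0%N s).
have [C C0 hC] := flat_le 1.
pose I := (\int[leb]_s (b s)%:E)%E.
have mE (u v : R) : measurable_fun setT (\1_`[u, v] : measurableTypeR R -> R) by [].
have mbE : measurable_fun setT (fun s : measurableTypeR R => (b s)%:E) by exact: mfun_EFin.
have intE (k u v : R) : 0 <= k -> u < v -> (\int[leb]_s (k * \1_`[u, v] s)%:E = (k * (v - u))%:E)%E.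
  move=> k0 uv; under eq_integral do rewrite EFinM.
  rewrite ge0_integralZl//; last exact/measurable_EFinP.
  by rewrite integral_indic//= setIT lebesgue_measure_itv/= lte_fin uv -EFinB -EFinM.
have I_lty : (I < +oo)%E.
  apply: (@le_lt_trans _ _ (\int[leb]_s (C * C * \1_`[0, d] s)%:E)%E); last first.
    by rewrite intE ?mulr_ge0// ltry.
  apply: ge0_le_integral => //.
  - by move=> s _; rewrite lee_fin.
  - by apply: mfun_EFin; apply: mfun_mul; [exact: mfun_cst|exact: mE].
  - move=> s _; rewrite lee_fin indic_itvE; case: (boolP (0 <= s <= d)) => sd /=.
      by rewrite mulr1; apply: ler_pM => //; exact: le_trans (ler_norm _) (hC _).
    by rewrite bout// mulr0.
have I_gt0 : (0 < I)%E.
  (* On the middle third of [0, d] both factors are at least [m], which bounds the integral from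
     below. *)
  pose m := expR (- (d / 3)^-1).
  have m0 : 0 < m by exact: expR_gt0.
  have d3 : d / 3 < d - d / 3 by lra.
  have flm s : d / 3 <= s -> m <= flat 1 s.
    move=> ds; have s0 : 0 < s by apply: lt_le_trans ds; rewrite divr_gt0.
    rewrite /flat s0 hornerC mul1r /m ler_expR lerN2 lef_pV2 ?posrE ?divr_gt0//.
  apply: (@lt_le_trans _ _ (\int[leb]_s (m * m * \1_`[d / 3, d - d / 3] s)%:E)%E).
    by rewrite intE ?mulr_ge0 ?ltW// lte_fin !mulr_gt0// subr_gt0.
  apply: ge0_le_integral => //.
  - by move=> s _; rewrite lee_fin indic_itvE !mulr_ge0// ltW.
  - by apply: mfun_EFin; apply: mfun_mul; [exact: mfun_cst|exact: mE].
  - move=> s _; rewrite lee_fin indic_itvE; case: (boolP (d / 3 <= s <= d - d / 3)) => [/andP[s1 s2]|_] /=.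
      by rewrite mulr1; apply: ler_pM; [exact: ltW|exact: ltW|exact: flm|apply: flm; lra].
    by rewrite mulr0.
pose c := fine I.
have c0 : 0 < c by rewrite fine_gt0// I_gt0.
have Ic : I = c%:E by rewrite fineK// ge0_fin_numE// ltW.
pose D k s := c^-1 * derive1n k b s.
have hD k (s : R) : is_derive s 1 (D k) (D k.+1 s).
  by apply: (der_eq (der_mul (der_cst s c^-1) (bd k s))); rewrite mul0r add0r.
have D0 s : 0 <= D 0%N s by apply: mulr_ge0; [rewrite invr_ge0 ltW|exact: b0].
have Do : forall k s, ~~ (0 <= s <= d) -> D k s = 0.
  by apply: tower_out => // s hs; rewrite /D derive1n0 bout ?mulr0.
have Di : (\int[leb]_s (D 0%N s)%:E = 1)%E.
  rewrite /D; under eq_integral do rewrite derive1n0 EFinM.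
  rewrite ge0_integralZl//.
  - by rewrite -/I Ic -EFinM mulVf// gt_eqF.
  - by move=> s _; rewrite lee_fin.
  - by rewrite lee_fin invr_ge0 ltW.
by exists (Mollifier hD D0 Do Di).
Qed.

End bump.

(** * Partial derivatives of tensor products *)

Section partials.
Context {R : realType}.
Implicit Types (g : R * R -> R).

Lemma partial1E g x : partial1 g x = derive1 (fun s => g (s, x.2)) x.1.
Proof.
rewrite /partial1 /derive /derive1.
have -> : (fun h : R => h^-1 *: ((g \o shift x) (h *: ((1, 0) : R * R)) - g x)) =
    (fun h : R => h^-1 *: (g (h + x.1, x.2) - g (x.1, x.2))); last by [].
apply/funext => h /=; congr (_ *: (g _ - g _)); last by case: x.
rewrite /GRing.scale /= {1}/GRing.add /= /add_pair /scale_pair /=.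
by congr pair; rewrite /GRing.scale /= ?mulr1// mulr0 add0r.
Qed.

Lemma partial2E g x : partial2 g x = derive1 (fun s => g (x.1, s)) x.2.
Proof.
rewrite /partial2 /derive /derive1.
have -> : (fun h : R => h^-1 *: ((g \o shift x) (h *: ((0, 1) : R * R)) - g x)) =
    (fun h : R => h^-1 *: (g (x.1, h + x.2) - g (x.1, x.2))); last by [].
apply/funext => h /=; congr (_ *: (g _ - g _)); last by case: x.
rewrite /GRing.scale /= {1}/GRing.add /= /add_pair /scale_pair /=.
by congr pair; rewrite /GRing.scale /= ?mulr1// mulr0 add0r.
Qed.

Lemma partial1_der g (x : R * R) (a : R) : is_derive x.1 1 (fun s => g (s, x.2)) a -> partial1 g x = a.
Proof. by move=> h; rewrite partial1E derive1E; have [_ ->] := h. Qed.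

Lemma partial2_der g (x : R * R) (a : R) : is_derive x.2 1 (fun s => g (x.1, s)) a -> partial2 g x = a.
Proof. by move=> h; rewrite partial2E derive1E; have [_ ->] := h. Qed.

Lemma differentiable_tensor (F G : R -> R) (x : R * R) :
  (forall s : R, derivable F s 1) -> (forall s : R, derivable G s 1) ->
  differentiable (fun z : R * R => F z.1 * G z.2) x.
Proof.
move=> dF dG.
have d1 : differentiable (fun z : R * R => F z.1) x.
  apply: (@differentiable_comp _ _ _ _ (fst : R * R -> R) F).
    by apply: linear_differentiable => z; exact: cvg_fst.
  exact/derivable1_diffP.
have d2 : differentiable (fun z : R * R => G z.2) x.
  apply: (@differentiable_comp _ _ _ _ (snd : R * R -> R) G).
    by apply: linear_differentiable => z; exact: cvg_snd.
  exact/derivable1_diffP.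
exact: differentiableM d1 d2.
Qed.

Variables (d : R) (m : mollifier d).

Lemma moll_der_shift k (s c : R) : is_derive s 1 (fun s => m k (s - c)) (m k.+1 (s - c)).
Proof. exact: (der_shift (moll_der m k _)). Qed.

Lemma partial_tensor (c : R * R) (a : nat * nat) :
  partial a (fun z => m 0 (z.1 - c.1) * m 0 (z.2 - c.2)) =
  (fun z => m a.1 (z.1 - c.1) * m a.2 (z.2 - c.2)).
Proof.
rewrite /partial.
have -> : iter a.2 (@partial2 R) (fun z => m 0 (z.1 - c.1) * m 0 (z.2 - c.2)) =
    (fun z => m 0 (z.1 - c.1) * m a.2 (z.2 - c.2)).
  elim: a.2 => // n /= ->; apply/funext => z; apply: partial2_der.
  apply: (der_eq (der_mul (der_cst z.2 (m 0 (z.1 - c.1))) (moll_der_shift n z.2 c.2))).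
  by rewrite mul0r add0r.
elim: a.1 => // n /= ->; apply/funext => z; apply: partial1_der.
apply: (der_eq (der_mul (moll_der_shift n z.1 c.1) (der_cst z.1 (m a.2 (z.2 - c.2))))).
by rewrite mulr0 addr0.
Qed.

Lemma moll_box k l (c z : R * R) : m k (z.1 - c.1) * m l (z.2 - c.2) != 0 ->
  (c.1 <= z.1 <= c.1 + d) && (c.2 <= z.2 <= c.2 + d).
Proof.
apply: contraR; rewrite negb_and => /orP[h|h].
  rewrite (@moll_out _ _ m k) ?mul0r//; apply: contra h => /andP[? ?]; lra.
rewrite (@moll_out _ _ m l) ?mulr0//; apply: contra h => /andP[? ?]; lra.
Qed.

Lemma tensor_test (c : R * R) :
  test_function (fun z => m 0 (z.1 - c.1) * m 0 (z.2 - c.2)).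
Proof.
split.
  move=> a x; rewrite partial_tensor.
  apply: (@differentiable_tensor (fun s => m a.1 (s - c.1)) (fun s => m a.2 (s - c.2))) => s;
    by have [] := moll_der_shift a.1 s c.1; have [] := moll_der_shift a.2 s c.2.
have K : compact (`[c.1, c.1 + d]%classic `*` `[c.2, c.2 + d]%classic : set (R * R)).
  by apply: compact_setX; exact: segment_compact.
apply: (subclosed_compact _ K); first exact: closed_closure.
have cK := compact_closed (@norm_hausdorff _ (R * R)%type) K.
have /closure_id cE := cK; rewrite [X in _ `<=` X]cE.
apply: closure_subset => z /= /moll_box /andP[h1 h2].
by rewrite !in_itv.
Qed.

Lemma moll_bounded k : exists2 B : R, 0 <= B & forall s, `|m k s| <= B.
Proof.
have [d0|d0] := leP 0 d; last first.
  exists 0 => // s; rewrite moll_out ?normr0//; apply/negP => /andP[? ?]; lra.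
have c : {within `[0, d], continuous (fun s => `|m k s|)}.
  apply: continuous_subspaceT => s.
  apply: (@continuous_comp _ _ _ (m k) (fun x : R => `|x|)); last exact: norm_continuous.
  exact: der_continuous (moll_der m k s).
have [e _ he] := EVT_max d0 c; exists `|m k e| => // s.
have [h|h] := boolP (0 <= s <= d); first exact: he.
by rewrite moll_out// normr0.
Qed.

End partials.

(** * Mollification of square-integrable functions *)

Section mollify.
Context {R : realType} (d : R) (m : mollifier d).
Local Notation leb := (@lebesgue_measure R).

Lemma measurable_moll k : measurable_fun setT (m k : measurableTypeR R -> R).
Proof. by apply: continuous_measurable_fun => s; exact: der_continuous (moll_der m k s). Qed.

Definition box (a b c e : R) (z : R * R) : R := \1_`[a, b] z.1 * \1_`[c, e] z.2.

Lemma boxE a b c e z : box a b c e z = ((a <= z.1 <= b)%R && (c <= z.2 <= e)%R)%:R.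
Proof. by rewrite /box !indic_itvE -natrM mulnb. Qed.

Lemma measurable_box a b c e : measurable_fun setT (box a b c e : RR R -> R).
Proof.
have m1 : measurable_fun setT (\1_`[a, b] : measurableTypeR R -> R) by [].
have m2 : measurable_fun setT (\1_`[c, e] : measurableTypeR R -> R) by [].
by rewrite /box; mfun.
Qed.

Lemma box_integrable a b c e : (leb2 R).-integrable setT (EFin \o box a b c e).
Proof.
have mb := measurable_box a b c e.
have b0 z : 0 <= box a b c e z by rewrite boxE.
have m1 : measurable_fun setT (\1_`[a, b] : measurableTypeR R -> R) by [].
have m2 : measurable_fun setT (\1_`[c, e] : measurableTypeR R -> R) by [].
have itvE (u v : R) : (\int[leb]_s (\1_`[u, v] s)%:E < +oo)%E.
  rewrite integral_indic//= setIT lebesgue_measure_itv/=; case: ifP => _ //.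
  by rewrite -EFinB ltry.
apply/integrableP; split; first exact: mfun_EFin.
under eq_integral do rewrite /= ger0_norm//.
rewrite leb2_tonelli1//; last exact: mfun_EFin.
have E s : (\int[leb]_t (box a b c e (s, t))%:E = (\1_`[a, b] s)%:E * \int[leb]_t (\1_`[c, e] t)%:E)%E.
  rewrite -ge0_integralZl//; exact: mfun_EFin.
under eq_integral do rewrite E.
have I0 : (0 <= \int[leb]_t (\1_`[c, e] t)%:E)%E by apply: integral_ge0.
rewrite ge0_integralZr//; last exact: mfun_EFin.
rewrite lte_mul_pinfty//; first by apply: integral_ge0.
by rewrite ge0_fin_numE//; apply: integral_ge0.
Qed.

Lemma L2P (g : R * R -> R) : L2 g <-> measurable_fun setT (g : RR R -> R) /\
  (\int[leb2 R]_x (g x ^+ 2)%:E < +oo)%E.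
Proof.
rewrite -L2norm_sqr /L2 inE/=; split.
  move=> /andP[]; rewrite !inE /= /finite_norm => mg h; split => //.
  by rewrite /= lte_mul_pinfty ?Lnorm_ge0// ge0_fin_numE ?Lnorm_ge0.
move=> [mg h]; apply/andP; split; rewrite inE//= /finite_norm.
rewrite ltey; apply/eqP => e; move: h; by rewrite /L2norm e /= mulyy ltxx.
Qed.

(** A correlation rather than a convolution: as a function of [z] the kernel is a translated test
    function, so a weak derivative can be tested against it directly. The price is a factor -1 for
    each derivative in [x]. *)
Definition mol (h : R * R -> R) i j (x : R * R) : R :=
  \int[leb2 R]_z (h z * (m i (z.1 - x.1) * m j (z.2 - x.2))).

Lemma mol_weak g h i j x : is_weak_partial (i, j) g h ->
  mol g i j x = (-1) ^+ (i + j) * mol h 0 0 x.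
Proof.
move=> w; have := w _ (tensor_test m x).
by under eq_Rintegral do rewrite (partial_tensor m x (i, j)) /=.
Qed.

Lemma sqr_integrable g : L2 g -> (leb2 R).-integrable setT (EFin \o (fun z => g z ^+ 2)).
Proof.
move=> /L2P[mg g2]; apply/integrableP; split; first by mfun.
by under eq_integral do rewrite /= ger0_norm ?sqr_ge0//.
Qed.

(** Differentiation under the integral needs a majorant uniform over the centres [c] near [x]. On
    the box that contains all the supports, |g| <= g^2 + 1 supplies one. *)
Lemma mol_bound g i j x : L2 g -> exists G : RR R -> R,
  [/\ (forall z, 0 <= G z), (leb2 R).-integrable setT (EFin \o G) &
   forall (c : R * R) z, `|c.1 - x.1| <= 1 -> `|c.2 - x.2| <= 1 ->
     `|g z * (m i (z.1 - c.1) * m j (z.2 - c.2))| <= G z].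
Proof.
move=> g2; have [A A0 hA] := moll_bounded m i; have [B B0 hB] := moll_bounded m j.
pose bx := box (x.1 - 1) (x.1 + 1 + d) (x.2 - 1) (x.2 + 1 + d).
have bx0 z : 0 <= bx z by rewrite /bx boxE.
exists (fun z => A * B * (g z ^+ 2 + bx z)); split.
- by move=> z; rewrite !mulr_ge0// addr_ge0 ?sqr_ge0.
- rewrite (_ : EFin \o _ = (fun z => (A * B)%:E * ((g z ^+ 2)%:E + (bx z)%:E))%E); last by apply/funext.
  apply: integrableZl => //.
  by apply: integrableD => //; [exact: sqr_integrable|exact: box_integrable].
- move=> c z c1 c2.
  have [->|n0] := eqVneq (m i (z.1 - c.1) * m j (z.2 - c.2)) 0.
    by rewrite mulr0 normr0 !mulr_ge0// addr_ge0 ?sqr_ge0.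
  have /andP[/andP[h1 h2] /andP[h3 h4]] := moll_box n0.
  have /andP[c1a c1b] : -1 <= c.1 - x.1 <= 1 by rewrite -ler_norml.
  have /andP[c2a c2b] : -1 <= c.2 - x.2 <= 1 by rewrite -ler_norml.
  have -> : bx z = 1.
    rewrite /bx boxE (_ : _ && _ = true)//; apply/andP; split; apply/andP; split; lra.
  rewrite normrM mulrC ler_pM//.
    by rewrite normrM ler_pM.
  have := sqr_ge0 (`|g z| - 1); rewrite -(real_normK (num_real (g z))).
  by have := normr_ge0 (g z); nra.
Qed.

Lemma mol_integrable g i j x : L2 g ->
  (leb2 R).-integrable setT (EFin \o (fun z => g z * (m i (z.1 - x.1) * m j (z.2 - x.2)))).
Proof.
move=> g2; have [G [G0 iG hG]] := mol_bound i j x g2.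
have /L2P[mg _] := g2.
apply: (integrable_le _ _ iG) => //.
  have := measurable_moll i; have := measurable_moll j => mj mi; mfun.
by move=> z _; apply: hG; rewrite subrr normr0.
Qed.

Lemma mol_der1 g i j (x : R * R) : L2 g ->
  is_derive x.1 1 (fun s => mol g i j (s, x.2)) (- mol g i.+1 j x).
Proof.
move=> g2; have [G [G0 iG hG]] := mol_bound i.+1 j x g2.
pose f (s : R) (z : RR R) := g z * (m i (z.1 - s) * m j (z.2 - x.2)).
have df (s : R) z : is_derive s 1 (f^~ z) (- (g z * (m i.+1 (z.1 - s) * m j (z.2 - x.2)))).
  have h1 : is_derive s 1 (fun s : R => z.1 - s) (0 - 1).
    by apply: (der_add (der_cst s z.1)); exact: der_opp (der_id s).
  have h2 := der_comp (f := fun s : R => z.1 - s) (moll_der m i (z.1 - s)) h1.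
  apply: (der_eq (der_mul (der_cst _ (g z)) (der_mul h2 (der_cst _ _)))); ring.
have Ia : `](x.1 - 1), (x.1 + 1)[%classic x.1 by rewrite /= in_itv/=; lra.
have If s : `](x.1 - 1), (x.1 + 1)[%classic s -> (leb2 R).-integrable setT (EFin \o f s).
  by move=> _; exact: (mol_integrable i j (s, x.2) g2).
have Df (s : R) z : `](x.1 - 1), (x.1 + 1)[%classic s -> [set: RR R] z -> derivable (f^~ z) s 1.
  by move=> _ _; have [] := df s z.
have Ub s z : `](x.1 - 1), (x.1 + 1)[%classic s -> [set: RR R] z -> `|partial1of2 f s z| <= G z.
  rewrite /= in_itv/= => /andP[s1 s2] _; rewrite /partial1of2 derive1E.
  have [_ ->] := df s z; rewrite normrN.
  apply: (hG (s, x.2)) => /=; last by rewrite subrr normr0.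
  by rewrite ler_norml; lra.
apply: DeriveDef.
  exact: (derivable_under_integral measurableT Ia If Df G0 iG Ub).
rewrite -derive1E (differentiation_under_integral measurableT Ia If Df G0 iG Ub).
rewrite /mol -mulN1r -RintegralZl//; last exact: mol_integrable.
apply: eq_Rintegral => z _; rewrite /partial1of2 derive1E.
by have [_ ->] := df x.1 z; rewrite mulN1r.
Qed.

Lemma mol_der2 g i j (x : R * R) : L2 g ->
  is_derive x.2 1 (fun s => mol g i j (x.1, s)) (- mol g i j.+1 x).
Proof.
move=> g2; have [G [G0 iG hG]] := mol_bound i j.+1 x g2.
pose f (s : R) (z : RR R) := g z * (m i (z.1 - x.1) * m j (z.2 - s)).
have df (s : R) z : is_derive s 1 (f^~ z) (- (g z * (m i (z.1 - x.1) * m j.+1 (z.2 - s)))).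
  have h1 : is_derive s 1 (fun s : R => z.2 - s) (0 - 1).
    by apply: (der_add (der_cst s z.2)); exact: der_opp (der_id s).
  have h2 := der_comp (f := fun s : R => z.2 - s) (moll_der m j (z.2 - s)) h1.
  apply: (der_eq (der_mul (der_cst _ (g z)) (der_mul (der_cst _ _) h2))); ring.
have Ia : `](x.2 - 1), (x.2 + 1)[%classic x.2 by rewrite /= in_itv/=; lra.
have If s : `](x.2 - 1), (x.2 + 1)[%classic s -> (leb2 R).-integrable setT (EFin \o f s).
  by move=> _; exact: (mol_integrable i j (x.1, s) g2).
have Df (s : R) z : `](x.2 - 1), (x.2 + 1)[%classic s -> [set: RR R] z -> derivable (f^~ z) s 1.
  by move=> _ _; have [] := df s z.
have Ub s z : `](x.2 - 1), (x.2 + 1)[%classic s -> [set: RR R] z -> `|partial1of2 f s z| <= G z.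
  rewrite /= in_itv/= => /andP[s1 s2] _; rewrite /partial1of2 derive1E.
  have [_ ->] := df s z; rewrite normrN.
  apply: (hG (x.1, s)) => /=; first by rewrite subrr normr0.
  by rewrite ler_norml; lra.
apply: DeriveDef.
  exact: (derivable_under_integral measurableT Ia If Df G0 iG Ub).
rewrite -derive1E (differentiation_under_integral measurableT Ia If Df G0 iG Ub).
rewrite /mol -mulN1r -RintegralZl//; last exact: mol_integrable.
apply: eq_Rintegral => z _; rewrite /partial1of2 derive1E.
by have [_ ->] := df x.2 z; rewrite mulN1r.
Qed.

End mollify.

(** * Sobolev bounds *)

Section line.
Context {R : realType}.
Local Notation leb := (@lebesgue_measure R).
Implicit Types (u v : R -> R).

Lemma continuous_mfun u : continuous u -> measurable_fun setT (u : measurableTypeR R -> R).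
Proof. exact: continuous_measurable_fun. Qed.

Lemma le_integral_setT (A : set R) (f : R -> \bar R) : measurable A ->
  measurable_fun setT (f : measurableTypeR R -> \bar R) -> (forall s, 0 <= f s)%E ->
  (\int[leb]_(s in A) f s <= \int[leb]_s f s)%E.
Proof. by move=> mA mf f0; apply: ge0_subset_integral. Qed.

Lemma line_diff u v (a b : R) : a <= b -> (forall s : R, is_derive s 1 u (v s)) ->
  continuous v ->
  (((u b - u a) ^+ 2)%:E <= (b - a)%:E * \int[leb]_(s in `[a, b]) (v s ^+ 2)%:E)%E.
Proof.
move=> ab hd cv; have mv := continuous_mfun cv.
have m1 : measurable_fun setT (\1_`[a, b] : measurableTypeR R -> R) by [].
have -> : (\int[leb]_(s in `[a, b]) (v s ^+ 2)%:E = \int[leb]_s ((v s * \1_`[a, b] s) ^+ 2)%:E)%E.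
  rewrite [LHS]integral_mkcond; apply: eq_integral => s _.
  by rewrite patchE indicE; case: ifP => _; rewrite ?mulr1 ?mulr0 ?expr0n.
have mv1 : measurable_fun setT (fun s : measurableTypeR R => v s * \1_`[a, b] s) by mfun.
have := cauchy_schwarz leb mv1 m1.
have -> : (\int[leb]_x (\1_`[a, b] x ^+ 2)%:E = (b - a)%:E)%E.
  have sq s : \1_`[a, b] s ^+ 2 = \1_`[a, b] s :> R by rewrite indic_itvE; case: (_ <= _ <= _); rewrite ?expr1n ?expr0n.
  under eq_integral do rewrite sq.
  rewrite integral_indic//= setIT lebesgue_measure_itv/= lte_fin.
  case: ifPn => [_|]; first by rewrite EFinB.
  by rewrite -leNgt => ba; have -> : a = b; [apply/le_anti/andP|rewrite subrr].
rewrite muleC => h; apply: le_trans h.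
have /= E := integral_is_derive ab hd cv.
rewrite -(real_normK (num_real (u b - u a))) EFin_expe.
have -> : (\int[leb]_x `|v x * \1_`[a, b] x * \1_`[a, b] x|%:E = \int[leb]_(x in `[a, b]) `|(v x)%:E|)%E.
  rewrite [RHS]integral_mkcond; apply: eq_integral => s _.
  by rewrite patchE indicE; case: ifP => _; rewrite ?mulr1 ?mulr0 ?normr0.
rewrite lee_sqr ?lee_fin ?integral_ge0//.
rewrite -[leLHS]/(`|(u b - u a)%:E|%E) -E.
apply: le_abse_integral => //.
by apply: measurable_funTS; exact: mfun_EFin.
Qed.

(** Compares [u x] with the minimum of u^2 on [x, x + 1]: the minimum is at most the mean over this
    unit interval, and the difference is the integral of 2 u v, which is at most that of u^2 +
    v^2. *)
Lemma line_sup u v (x : R) : (forall s : R, is_derive s 1 u (v s)) -> continuous v ->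
  ((u x ^+ 2)%:E <= 2%:E * \int[leb]_s (u s ^+ 2 + v s ^+ 2)%:E)%E.
Proof.
move=> hd cv; have mv := continuous_mfun cv.
have cu : continuous u by move=> s; exact: der_continuous (hd s).
have mu := continuous_mfun cu.
have x1 : x <= x + 1 by lra.
have [y] : exists2 c, c \in `[x, x + 1] & forall t, t \in `[x, x + 1] -> u c ^+ 2 <= u t ^+ 2.
  apply: EVT_min => //; apply: continuous_subspaceT => s.
  exact: (continuous_comp (cu s) (@exprn_continuous R 2 _)).
rewrite in_itv/= => /andP[xy yx] ymin.
pose w s := u s ^+ 2; pose w1 s := 2 * u s * v s.
have hw (s : R) : is_derive s 1 w (w1 s).
  by apply: (der_eq (der_exp 2 (hd s))); rewrite /w1 /= expr1.
have cw1 : continuous w1.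
  move=> s; apply: cvgM; last exact: cv.
  by apply: cvgM; [exact: cvg_cst|exact: cu].
have E := integral_is_derive xy hw cw1.
have mw1 := continuous_mfun cw1.
have pos (s : R) : (0 <= (u s ^+ 2 + v s ^+ 2)%:E)%E by rewrite lee_fin addr_ge0 ?sqr_ge0.
have mS : measurable_fun setT (fun s : measurableTypeR R => (u s ^+ 2 + v s ^+ 2)%:E) by mfun.
have h1 : ((u x ^+ 2 - u y ^+ 2)%:E <= \int[leb]_s (u s ^+ 2 + v s ^+ 2)%:E)%E.
  apply: (@le_trans _ _ `|(w y - w x)%:E|%E).
    by rewrite lee_fin -normrN opprB ler_norm.
  rewrite -E; apply: le_trans (le_abse_integral _ _ _) _ => //.
    by apply: measurable_funTS; exact: mfun_EFin.
  apply: le_trans (le_integral_setT (A := `[x, y]) (measurable_itv _) mS pos).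
  apply: ge0_le_integral => //.
  - by apply: measurable_funTS; apply: measurableT_comp => //; exact: mfun_EFin.
  - exact: measurable_funTS.
  - move=> s _; rewrite lee_fin /w1 !normrM ger0_norm//.
    rewrite -(real_normK (num_real (u s))) -(real_normK (num_real (v s))).
    by have := sqr_ge0 (`|u s| - `|v s|); nra.
have h2 : ((u y ^+ 2)%:E <= \int[leb]_s (u s ^+ 2 + v s ^+ 2)%:E)%E.
  apply: le_trans (le_integral_setT (A := `[x, x + 1]) (measurable_itv _) mS pos).
  have -> : ((u y ^+ 2)%:E = \int[leb]_(s in `[x, (x + 1)%R]) (cst (u y ^+ 2)%:E) s)%E.
    rewrite integral_cst//= lebesgue_measure_itv/= lte_fin ltrDl ltr01.
    by rewrite -EFinB addrAC subrr add0r mule1.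
  apply: ge0_le_integral => //.
  - by move=> s _; rewrite lee_fin sqr_ge0.
  - exact: measurable_funTS.
  - by move=> s /= sx; rewrite lee_fin (le_trans (ymin _ sx))// lerDl sqr_ge0.
have -> : u x ^+ 2 = (u x ^+ 2 - u y ^+ 2) + u y ^+ 2 by ring.
by rewrite EFinD mule_natl mule2n; exact: leeD.
Qed.

End line.

Section plane.
Context {R : realType}.
Local Notation leb := (@lebesgue_measure R).
Implicit Types (U V : RR R -> R).

Definition der1 U V := forall x : R * R, is_derive x.1 1 (fun s => U (s, x.2)) (V x).
Definition der2 U V := forall x : R * R, is_derive x.2 1 (fun s => U (x.1, s)) (V x).
Definition cont1 V := forall b : R, continuous (fun s => V (s, b)).
Definition cont2 V := forall a : R, continuous (fun s => V (a, s)).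
(** Kept in the extended reals, so that L^2 bounds can be compared before finiteness is known. *)
Definition sqn U : \bar R := (\int[leb2 R]_x (U x ^+ 2)%:E)%E.
Definition swp U : RR R -> R := fun x => U (x.2, x.1).

Lemma sqn_ge0 U : (0 <= sqn U)%E.
Proof. by apply: integral_ge0 => x _; rewrite lee_fin sqr_ge0. Qed.

Lemma measurable_swp U : measurable_fun setT U -> measurable_fun setT (swp U).
Proof. by move=> mU; rewrite /swp; mfun. Qed.

Lemma sqn_swp U : measurable_fun setT U -> sqn (swp U) = sqn U.
Proof. by move=> mU; rewrite /sqn -(@integral_leb2_swap _ (fun x => (U x ^+ 2)%:E)) //; mfun. Qed.

Lemma sqn_shift U (a : R * R) : measurable_fun setT U -> sqn (fun x => U (x - a)) = sqn U.
Proof. by move=> mU; rewrite /sqn -(@integral_leb2_shift _ a (fun x => (U x ^+ 2)%:E)) //; mfun. Qed.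

Lemma der2_swp U V : der2 U V -> der1 (swp U) (swp V).
Proof. by move=> h x; exact: (h (x.2, x.1)). Qed.

Lemma der1_swp U V : der1 U V -> der2 (swp U) (swp V).
Proof. by move=> h x; exact: (h (x.2, x.1)). Qed.

Lemma der1_line U V (b : R) : der1 U V -> forall s : R, is_derive s 1 (fun s => U (s, b)) (V (s, b)).
Proof. by move=> h s; exact: (h (s, b)). Qed.

Lemma pairB (a b c e : R) : (a, b) - (c, e) = (a - c, b - e) :> R * R.
Proof. by []. Qed.

(** A trace estimate: [line_sup] on each vertical line, integrated over the first coordinate. *)
Lemma slice_snd U V V2 (b : R) : der2 U V -> cont2 V ->
  measurable_fun setT U -> measurable_fun setT V -> V2 = V ->
  (\int[leb]_s (U (s, b) ^+ 2)%:E <= 2%:E * (sqn U + sqn V))%E.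
Proof.
move=> hd hc mU mV _.
have mS : measurable_fun setT (fun x => (U x ^+ 2 + V x ^+ 2)%:E) by mfun.
have pS x : (0 <= (U x ^+ 2 + V x ^+ 2)%:E)%E by rewrite lee_fin addr_ge0 ?sqr_ge0.
have -> : (sqn U + sqn V = \int[leb2 R]_x (U x ^+ 2 + V x ^+ 2)%:E)%E.
  rewrite /sqn -ge0_integralD//; last 4 first.
  - by move=> x _; rewrite lee_fin sqr_ge0.
  - by mfun.
  - by move=> x _; rewrite lee_fin sqr_ge0.
  - by mfun.
rewrite leb2_tonelli1//.
have mF : measurable_fun setT (fun a : measurableTypeR R => \int[leb]_t (U (a, t) ^+ 2 + V (a, t) ^+ 2)%:E)%E.
  exact: (measurable_fun_fubini_tonelli_F (m2 := leb) _ mS pS).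
rewrite -ge0_integralZl//; last by move=> a _; apply: integral_ge0 => t _; exact: pS.
apply: ge0_le_integral => //.
- by move=> s _; rewrite lee_fin sqr_ge0.
- by mfun.
- exact: measurable_funeM.
- move=> s _; apply: (line_sup (u := fun t => U (s, t)) (v := fun t => V (s, t)) b).
    by move=> t; exact: (hd (s, t)).
  exact: hc.
Qed.

(** [line_sup] along the first coordinate, then [slice_snd] for [U] and for [U1]; among the second
    derivatives only the mixed one enters. The constant is 2 * 2. *)
Lemma plane_sup U U1 U2 U12 (x : R * R) : der1 U U1 -> cont1 U1 -> der2 U U2 -> cont2 U2 ->
  der2 U1 U12 -> cont2 U12 ->
  measurable_fun setT U -> measurable_fun setT U1 -> measurable_fun setT U2 ->
  measurable_fun setT U12 ->
  ((U x ^+ 2)%:E <= 4%:E * (sqn U + sqn U2 + (sqn U1 + sqn U12)))%E.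
Proof.
move=> d1 c1 d2 c2 d12 c12 mU mU1 mU2 mU12.
case: x => a b.
have := line_sup a (der1_line b d1) (c1 b).
rewrite /= => H; apply: (le_trans H).
have e4 (y : \bar R) : (4%:E * y = 2%:E * (2%:E * y))%E by rewrite muleA -EFinM -natrM.
rewrite e4; apply: lee_wpmul2l; first by rewrite lee_fin.
under eq_integral do rewrite EFinD.
rewrite ge0_integralD//; last 4 first.
- by move=> s _; rewrite lee_fin sqr_ge0.
- by mfun.
- by move=> s _; rewrite lee_fin sqr_ge0.
- by mfun.
have p1 : (0 <= sqn U + sqn U2)%E by apply: adde_ge0; exact: sqn_ge0.
have p2 : (0 <= sqn U1 + sqn U12)%E by apply: adde_ge0; exact: sqn_ge0.
rewrite (ge0_muleDr _ p1 p2).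
by apply: leeD; [exact: (slice_snd b d2 c2)|exact: (slice_snd b d12 c12)].
Qed.

(** [line_diff] yields the factor |b - a|, and [slice_snd] bounds the derivative on the one line
    concerned. *)
Lemma plane_hoelder1 U U1 U12 (a b c : R) : der1 U U1 -> cont1 U1 ->
  der2 U1 U12 -> cont2 U12 -> measurable_fun setT U1 -> measurable_fun setT U12 ->
  (((U (b, c) - U (a, c)) ^+ 2)%:E <= `|b - a|%:E * (2%:E * (sqn U1 + sqn U12)))%E.
Proof.
move=> d1 c1 d12 c12 m1 m12.
wlog ab : a b / a <= b.
  move=> H; have [ab|/ltW ba] := leP a b; first exact: H.
  by have := H _ _ ba; rewrite -sqrrN opprB distrC.
rewrite ger0_norm ?subr_ge0//.
have := line_diff ab (der1_line c d1) (c1 c).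
rewrite /= => H; apply: (le_trans H).
apply: lee_wpmul2l; first by rewrite lee_fin subr_ge0.
apply: le_trans (slice_snd c d12 c12 m1 m12 erefl).
apply: le_integral_setT => //; first by mfun.
by move=> s; rewrite lee_fin sqr_ge0.
Qed.

Lemma integral_leb_shift (f : R -> \bar R) (c : R) :
  measurable_fun setT (f : measurableTypeR R -> \bar R) ->
  (\int[leb]_s f (s + c)%R = \int[leb]_s f s)%E.
Proof.
move=> mf; apply: (@integral_measure_preserving R _ _ leb (fun x : measurableTypeR R => (x : R) + c : measurableTypeR R) f) => //.
  by mfun.
move=> A mA; apply: (etrans _ (lebesgue_shift (- c) mA)).
by congr (leb _); apply/seteqP; split=> x /=; rewrite opprK.
Qed.

(** One factor h comes from [line_diff], the other from integrating over the intermediate shifts in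
    [0, h] after exchanging the integrals. *)
Lemma plane_diff1 U U1 (h : R) : der1 U U1 -> cont1 U1 ->
  measurable_fun setT U -> measurable_fun setT U1 ->
  (sqn (fun x => (U (x.1 + h, x.2) - U x)%R) <= (h ^+ 2)%:E * sqn U1)%E.
Proof.
move=> d1 c1 mU mU1.
wlog h0 : h / 0 <= h.
  (* A negative shift becomes its opposite after translating the plane by (h, 0). *)
  move=> H; have [h0|h0] := leP 0 h; first exact: H.
  have Nh : 0 <= - h by lra.
  have := H _ Nh; rewrite sqrrN; apply: le_trans.
  rewrite -(@sqn_shift _ (h, 0)) /=; last by mfun.
  rewrite le_eqVlt; apply/orP; left; apply/eqP; apply: eq_integral => -[a b] _; congr EFin.
  by rewrite pairB /= subrK subr0 -sqrrN opprB.
pose F (z : RR R * measurableTypeR R) : \bar R := ((U1 (z.1.1 + z.2, z.1.2)) ^+ 2 * \1_`[0, h] z.2)%:E.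
have m01 : measurable_fun setT (\1_`[0, h] : measurableTypeR R -> R) by [].
have mF : measurable_fun setT F by rewrite /F; mfun.
have F0 z : (0 <= F z)%E by rewrite lee_fin mulr_ge0// sqr_ge0.
have E1 x : (((U (x.1 + h, x.2) - U x) ^+ 2)%:E <= h%:E * \int[leb]_t F (x, t))%E.
  case: x => a b /=.
  have ah : a <= a + h by lra.
  have := line_diff ah (der1_line b d1) (c1 b).
  rewrite /= (_ : a + h - a = h); last by ring.
  move=> H; apply: (le_trans H); apply: lee_wpmul2l => //.
  rewrite integral_mkcond -(integral_leb_shift a); last first.
    by apply/(measurable_restrictT _ (measurable_itv _)); apply: measurable_funTS; mfun.
  rewrite le_eqVlt; apply/orP; left; apply/eqP; apply: eq_integral => t _.
  rewrite patchE /F /= indic_itvE mem_setE in_itv/=.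
  rewrite (_ : (a <= t + a <= a + h) = (0 <= t <= h)); last by apply/idP/idP => /andP[? ?]; apply/andP; split; lra.
  by case: (0 <= t <= h); rewrite ?mulr1 ?mulr0// addrC.
apply: (@le_trans _ _ (\int[leb2 R]_x (h%:E * \int[leb]_t F (x, t)))%E).
  apply: ge0_le_integral => //.
  - by move=> x _; rewrite lee_fin sqr_ge0.
  - by mfun.
  - by apply: measurable_funeM; exact: (measurable_fun_fubini_tonelli_F (m2 := leb) _ mF F0).
rewrite ge0_integralZl//; last 2 first.
- exact: (measurable_fun_fubini_tonelli_F (m2 := leb) _ mF F0).
- by move=> x _; apply: integral_ge0 => t _; exact: F0.
rewrite expr2 EFinM -muleA; apply: lee_wpmul2l; first by rewrite lee_fin.
have := fubini_tonelli (m1 := @sleb2 R) (m2 := leb) F mF F0.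
rewrite /= => ->.
have E2 t : (\int[leb2 R]_x F (x, t) = (\1_`[0, h] t)%:E * sqn U1)%E.
  rewrite /F /=; under eq_integral do rewrite mulrC EFinM.
  rewrite ge0_integralZl//; last 2 first.
  - by mfun.
  - by move=> x _; rewrite lee_fin sqr_ge0.
  congr (_ * _)%E; rewrite -(@sqn_shift U1 (- t, 0))//; apply: eq_integral => -[a b] _.
  by rewrite pairB opprK subr0.
under eq_integral do rewrite E2.
rewrite ge0_integralZr//; last 2 first.
- exact/measurable_EFinP.
- exact: sqn_ge0.
apply: lee_wpmul2r; first exact: sqn_ge0.
rewrite integral_indic//= setIT lebesgue_measure_itv/= lte_fin.
by case: ifPn => _; [rewrite oppr0 adde0|rewrite lee_fin].
Qed.

End plane.
Section mollify_bounds.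
Context {R : realType}.
Local Notation leb := (@lebesgue_measure R).

(** No integrability is assumed: the integral is [fine] of a difference of two Tonelli integrals,
    which is measurable in any case. *)
Lemma measurable_param (F : RR R * RR R -> R) : measurable_fun setT F ->
  measurable_fun setT (fun x => \int[leb2 R]_y F (x, y)).
Proof.
move=> mF; have mE : measurable_fun setT (EFin \o F) by exact: mfun_EFin.
apply: (@measurableT_comp _ _ _ _ _ _ fine _ (fun x => \int[leb2 R]_y (F (x, y))%:E)%E).
  exact: fine_measurable.
under eq_fun do rewrite integralE.
apply: emeasurable_funB.
- have h := @tonelli4_measurable _ (EFin \o F)^\+%E (measurable_funepos mE) (funepos_ge0 _).
  apply: (eq_measurable_fun _ _ h) => x _; apply: eq_integral => y _.
  by rewrite !unlock.
- have h := @tonelli4_measurable _ (EFin \o F)^\-%E (measurable_funeneg mE) (funeneg_ge0 _).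
  apply: (eq_measurable_fun _ _ h) => x _; apply: eq_integral => y _.
  by rewrite !unlock.
Qed.

Variables (d : R) (m : mollifier d).

Let phi (x z : RR R) : R := m 0 (z.1 - x.1) * m 0 (z.2 - x.2).

Lemma phi_ge0 x z : 0 <= phi x z.
Proof. by rewrite mulr_ge0// moll_ge0. Qed.

Lemma measurable_phi : measurable_fun setT (fun z : RR R * RR R => phi z.1 z.2).
Proof. by have := measurable_moll m 0 => m0; rewrite /phi; mfun. Qed.

Lemma phi_int x : (\int[leb2 R]_z (phi x z)%:E = 1)%E.
Proof.
have m0 := measurable_moll m 0.
rewrite leb2_tonelli1; last 2 first.
- by rewrite /phi; mfun.
- by move=> z; rewrite lee_fin phi_ge0.
have i1 (c : R) : (\int[leb]_s (m 0 (s - c))%:E = 1)%E.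
  by rewrite (integral_leb_shift (f := fun s => (m 0 s)%:E)) ?moll_int//; mfun.
rewrite /phi /=.
have E a : (\int[leb]_b (m 0 (a - x.1) * m 0 (b - x.2))%:E = (m 0 (a - x.1))%:E)%E.
  under eq_integral do rewrite EFinM.
  rewrite ge0_integralZl ?i1 ?mule1//; first by mfun.
  - by move=> b _; rewrite lee_fin moll_ge0.
  - by rewrite lee_fin moll_ge0.
by under eq_integral do rewrite E.
Qed.

Lemma phi_int2 z : (\int[leb2 R]_x (phi x z)%:E = 1)%E.
Proof.
have m0 := measurable_moll m 0.
have mF : measurable_fun setT (fun x : RR R => (phi 0 x)%:E) by rewrite /phi; mfun.
rewrite -(phi_int 0) -(integral_leb2_opp mF).
have mF2 : measurable_fun setT (fun x : RR R => (phi 0 (- x))%:E) by rewrite /phi; mfun.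
rewrite -(integral_leb2_shift z mF2).
by apply: eq_integral => x _; rewrite /phi /= !subr0 !opprB.
Qed.

Lemma measurable_mol h i j : measurable_fun setT (h : RR R -> R) ->
  measurable_fun setT (mol m h i j : RR R -> R).
Proof.
move=> mh; have mi := measurable_moll m i; have mj := measurable_moll m j.
apply: (measurable_param (F := fun w => h w.2 * (m i (w.2.1 - w.1.1) * m j (w.2.2 - w.1.2)))).
by mfun.
Qed.

(** Jensen's inequality for the probability density [phi], in the form of Cauchy-Schwarz with the
    weight split as sqrt(phi) sqrt(phi), followed by Tonelli. *)
Lemma mol_sqn h : L2 h -> (sqn (mol m h 0 0) <= sqn h)%E.
Proof.
move=> h2; have /L2P[mh _] := h2; have mp := measurable_phi.
have mpx (x : RR R) : measurable_fun setT (phi x).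
  by apply: (mfun_comp (u := fun z => (x, z)) mp); mfun.
have key x : ((mol m h 0 0 x ^+ 2)%:E <= \int[leb2 R]_z (h z ^+ 2 * phi x z)%:E)%E.
  have mf : measurable_fun setT (fun z => h z * Num.sqrt (phi x z)).
    by have := mpx x => ?; mfun.
  have ms : measurable_fun setT (fun z => Num.sqrt (phi x z)) by have := mpx x => ?; mfun.
  have := cauchy_schwarz (leb2 R) mf ms.
  have -> : (\int[leb2 R]_z (Num.sqrt (phi x z) ^+ 2)%:E = 1)%E.
    by rewrite -(phi_int x); apply: eq_integral => z _; rewrite sqr_sqrtr// phi_ge0.
  rewrite mule1 [X in (_ <= X)%E](_ : _ = \int[leb2 R]_z (h z ^+ 2 * phi x z)%:E)%E; last first.
    by apply: eq_integral => z _; rewrite exprMn sqr_sqrtr// phi_ge0.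
  apply: le_trans; rewrite -(real_normK (num_real (mol m h 0 0 x))) EFin_expe.
  rewrite lee_sqr ?lee_fin ?integral_ge0//.
  rewrite /mol EFin_normr_Rintegral//; last exact: (mol_integrable m 0 0 x h2).
  apply: le_trans (le_abse_integral _ _ _) _ => //.
    by have := mpx x => ?; apply: mfun_EFin; rewrite -/(phi x _); mfun.
  rewrite le_eqVlt; apply/orP; left; apply/eqP; apply: eq_integral => z _.
  by rewrite -mulrA -expr2 sqr_sqrtr ?phi_ge0.
have mF : measurable_fun setT (fun w : RR R * RR R => (h w.2 ^+ 2 * phi w.1 w.2)%:E) by mfun.
have F0 (w : RR R * RR R) : (0 <= (h w.2 ^+ 2 * phi w.1 w.2)%:E)%E.
  by rewrite lee_fin mulr_ge0 ?sqr_ge0// phi_ge0.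
apply: (@le_trans _ _ (\int[leb2 R]_x \int[leb2 R]_z (h z ^+ 2 * phi x z)%:E)%E).
  apply: ge0_le_integral => //.
  - by move=> x _; rewrite lee_fin sqr_ge0.
  - by have := measurable_mol 0 0 mh => ?; mfun.
  - exact: (tonelli4_measurable mF F0).
have T4 := tonelli4 mF F0.
rewrite /= in T4; rewrite T4.
rewrite le_eqVlt; apply/orP; left; apply/eqP; apply: eq_integral => z _.
under eq_integral do rewrite EFinM.
rewrite ge0_integralZl ?phi_int2 ?mule1//.
- by apply: mfun_EFin; apply: (mfun_comp (u := fun x => (x, z)) mp); mfun.
- by move=> x _; rewrite lee_fin phi_ge0.
- by rewrite lee_fin sqr_ge0.
Qed.

Lemma mol_near g (x : R * R) (e : R) : L2 g -> 0 <= e ->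
  (forall z, x.1 <= z.1 <= x.1 + d -> x.2 <= z.2 <= x.2 + d -> `|g z - g x| <= e) ->
  `|mol m g 0 0 x - g x| <= e.
Proof.
move=> g2 e0 hg; have /L2P[mg _] := g2; have mp := measurable_phi.
have mpx : measurable_fun setT (phi x).
  by apply: (mfun_comp (u := fun z => (x, z)) mp); mfun.
have ip : (leb2 R).-integrable setT (EFin \o phi x).
  apply/integrableP; split; first exact: mfun_EFin.
  under eq_integral do rewrite /= ger0_norm ?phi_ge0//.
  by rewrite phi_int ltry.
have Ip : \int[leb2 R]_z (phi x z) = 1 by rewrite /Rintegral phi_int.
have -> : mol m g 0 0 x - g x = \int[leb2 R]_z ((g z - g x) * phi x z).
  under eq_Rintegral do rewrite mulrBl.
  rewrite RintegralB//; last 2 first.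
  - exact: (mol_integrable m 0 0 x g2).
  - rewrite (_ : EFin \o _ = (fun z => (g x)%:E * (phi x z)%:E)%E)//; exact: integrableZl.
  by rewrite RintegralZl// Ip mulr1.
have ig : (leb2 R).-integrable setT (EFin \o (fun z => (g z - g x) * phi x z)).
  rewrite (_ : EFin \o _ = (fun z => (g z * phi x z)%:E - (g x)%:E * (phi x z)%:E)%E); last first.
    by apply/funext => z /=; rewrite mulrBl EFinB.
  apply: integrableB => //; first exact: (mol_integrable m 0 0 x g2).
  exact: integrableZl.
apply: le_trans (le_normr_Rintegral _ ig) _ => //.
have -> : e = \int[leb2 R]_z (e * phi x z) by rewrite RintegralZl// Ip mulr1.
apply: le_Rintegral => //.
- rewrite (_ : EFin \o _ = (abse \o (EFin \o (fun z => (g z - g x) * phi x z))))//.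
  exact: integrable_abse.
- rewrite (_ : EFin \o _ = (fun z => e%:E * (phi x z)%:E)%E)//; exact: integrableZl.
move=> z _; have [->|n0] := eqVneq (phi x z) 0; first by rewrite !mulr0 normr0.
rewrite normrM (ger0_norm (phi_ge0 _ _)) ler_wpM2r ?phi_ge0//.
by have /andP[h1 h2] := moll_box n0; exact: hg.
Qed.

End mollify_bounds.

(** * Pointwise limits of functions and of their derivatives *)

Section limits.
Context {R : realType}.
Local Notation leb := (@lebesgue_measure R).
Implicit Types (U V : RR R -> R).

(** Fatou's lemma for the squares. *)
Lemma sqn_lim (U_ : nat -> RR R -> R) U (K : R) : (forall n, measurable_fun setT (U_ n)) ->
  (forall x, U_ ^~ x @ \oo --> U x) -> (forall n, sqn (U_ n) <= K%:E)%E ->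
  measurable_fun setT U /\ (sqn U <= K%:E)%E.
Proof.
move=> mU cU hU.
have mU' : measurable_fun setT U.
  by apply: (measurable_fun_cvg mU) => x _; exact: cU.
split => //.
have m2 n : measurable_fun setT (fun x => (U_ n x ^+ 2)%:E) by have := mU n => ?; mfun.
have c2 x : (U_ n x ^+ 2)%:E @[n --> \oo] --> (U x ^+ 2)%:E.
  apply: cvg_EFin; first exact: nearW.
  exact: (cvgM (cU x) (cU x)).
have := @fatou _ _ _ (leb2 R) setT measurableT (fun n x => (U_ n x ^+ 2)%:E) m2
  (fun n x _ => ltac:(by rewrite lee_fin sqr_ge0)).
have -> : (\int[leb2 R]_x limn_einf ((fun n x => (U_ n x ^+ 2)%:E)^~ x) = sqn U)%E.
  apply: eq_integral => x _; rewrite is_cvg_limn_einfE.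
    by apply/cvg_lim => //; exact: c2.
  by apply/cvg_ex; eexists; exact: c2.
move=> /le_trans; apply.
rewrite limn_einf_lim; apply: lime_le; first exact: is_cvg_einfs.
apply: nearW => n; apply: (le_trans _ (hU n)).
by apply: ereal_inf_lbound; exists n => /=.
Qed.

Lemma cvg_le_cst (u : nat -> R) (l c : R) : u @ \oo --> l -> (forall n, u n <= c) -> l <= c.
Proof. by move=> ul uc; apply: (cvgr_to_le ul); exact: nearW. Qed.

(** For fixed h the difference quotients of [U_ n] converge, and the mean value theorem with the
    Hoelder bound puts them within sqrt(|h| H) of [V_ n], uniformly in n. This forces the
    derivatives to converge and identifies their limit. *)
Lemma limit_C1 (U_ V_ : nat -> RR R -> R) U (H : R) : 0 <= H ->
  (forall n, der1 (U_ n) (V_ n)) ->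
  (forall n (a b c : R), (V_ n (b, c) - V_ n (a, c)) ^+ 2 <= `|b - a| * H) ->
  (forall x, U_ ^~ x @ \oo --> U x) ->
  exists V, der1 U V /\ (forall x, V_ ^~ x @ \oo --> V x).
Proof.
move=> H0 dU hV cU.
pose Q (f : RR R -> R) (a c h : R) := h^-1 * (f (a + h, c) - f (a, c)).
have q1 n (a c h : R) : h != 0 -> `|Q (U_ n) a c h - V_ n (a, c)| <= Num.sqrt (`|h| * H).
  move=> h0.
  have cl : continuous (fun s => U_ n (s, c)).
    by move=> s; exact: der_continuous (der1_line c (dU n) s).
  have [xi hxi ->] : exists2 xi, `|xi - a| <= `|h| & Q (U_ n) a c h = V_ n (xi, c).
    rewrite /Q; have [hp|hn] := ltP 0 h.
      have ab : a < a + h by lra.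
      have [xi] := MVT ab (fun s _ => der1_line c (dU n) s) (continuous_subspaceT cl).
      rewrite in_itv/= => /andP[x1 x2] E; exists xi.
        by rewrite !ger0_norm; lra.
      by rewrite E; field.
    have {}hn : h < 0 by rewrite lt_neqAle h0.
    have ab : a + h < a by lra.
    have [xi] := MVT ab (fun s _ => der1_line c (dU n) s) (continuous_subspaceT cl).
    rewrite in_itv/= => /andP[x1 x2] E; exists xi.
      by rewrite !ler0_norm; lra.
    by rewrite -[_ (a + h, c) - _]opprB E; field.
  rewrite -sqrtr_sqr ler_sqrt ?mulr_ge0//.
  by apply: le_trans (hV n a xi c) _; rewrite ler_wpM2r.
have cQ (a c h : R) : Q (U_ n) a c h @[n --> \oo] --> Q U a c h.
  by apply: cvgM; [exact: cvg_cst|apply: cvgB; exact: cU].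
have sq (e : R) : 0 < e -> exists2 h0 : R, 0 < h0 & forall h : R, `|h| <= h0 -> Num.sqrt (`|h| * H) <= e.
  move=> e0; exists (e ^+ 2 / (H + 1)); first by rewrite divr_gt0 ?exprn_gt0//; lra.
  move=> h; rewrite ler_pdivlMr; last lra.
  move=> hh; rewrite -[leRHS](ger0_norm (ltW e0)) -(sqrtr_sqr e) ler_sqrt ?sqr_ge0//.
  by apply: le_trans hh; rewrite ler_wpM2l//; lra.
have cV x : cvg (V_ ^~ x @ \oo).
  case: x => a c; apply/cauchy_cvgP/cauchyP => e e0.
  (* At this step size the quotient of the limit [U] is within e/2 of [V_ n] for all large n, so it
     can be taken as the centre in the Cauchy criterion. *)
  have [h0 h0p hh] := sq (e / 4) ltac:(lra).
  have h0n : h0 != 0 by rewrite gt_eqF.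
  have h0e : Num.sqrt (`|h0| * H) <= e / 4 by apply: hh; rewrite ger0_norm// ltW.
  exists (Q U a c h0).
  suff : \forall n \near \oo, ball (Q U a c h0) e (V_ n (a, c)) by [].
  near=> n.
  have h1 := q1 n a c h0 h0n.
  have h2 : `|Q U a c h0 - Q (U_ n) a c h0| <= e / 4.
    near: n; move/cvgrPdist_le : (cQ a c h0); apply; lra.
  rewrite /ball/=; apply: (@le_lt_trans _ _ (e / 4 + e / 4)); last lra.
  have -> : Q U a c h0 - V_ n (a, c) = (Q U a c h0 - Q (U_ n) a c h0) + (Q (U_ n) a c h0 - V_ n (a, c)) by ring.
  by apply: le_trans (ler_normD _ _) _; apply: lerD => //; exact: le_trans h1 h0e.
exists (fun x => lim (V_ ^~ x @ \oo)); split; last by move=> x; exact: cV.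
have q2 (a c h : R) : h != 0 -> `|Q U a c h - lim (V_ ^~ (a, c) @ \oo)| <= Num.sqrt (`|h| * H).
  move=> h0; apply: (@cvg_le_cst (fun n => `|Q (U_ n) a c h - V_ n (a, c)|)).
    by apply: cvg_norm; apply: cvgB; [exact: cQ|exact: cV].
  by move=> n; exact: q1.
case=> a c /=; set v := lim _.
suff h : (fun h : R => h^-1 *: (U (h *: 1 + a, c) - U (a, c))) h @[h --> 0^'] --> v.
  apply: DeriveDef; first by apply/cvg_ex; exists v; exact: h.
  by apply/cvg_lim.
apply/cvgrPdist_le => e e0; have [h0 h0p hh] := sq e e0; near=> h.
have hn : h != 0 by near: h; exact: nbhs_dnbhs_neq.
have E : h *: (1 : R) + a = a + h by rewrite /GRing.scale /= mulr1 addrC.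
rewrite E distrC; apply: (le_trans (q2 a c h hn)).
by apply: hh; near: h; exact: dnbhs0_le.
Unshelve. all: end_near. Qed.

End limits.
Section regularity.
Context {R : realType}.
Local Notation leb := (@lebesgue_measure R).
Implicit Types (U V w : RR R -> R) (K : R).

(* The bounds of [w] that survive pointwise limits. *)
Record nice K w : Prop := Nice {
  nice_m : measurable_fun setT w;
  nice_sup : forall x, w x ^+ 2 <= 16 * K;
  nice_sqn : (sqn w <= K%:E)%E;
  nice_h1 : forall a b c : R, (w (b, c) - w (a, c)) ^+ 2 <= `|b - a| * (4 * K);
  nice_h2 : forall a b c : R, (w (a, b) - w (a, c)) ^+ 2 <= `|b - c| * (4 * K);
  nice_d1 : forall h : R, (sqn (fun x => (w (x.1 + h, x.2) - w x)%R) <= (h ^+ 2 * K)%:E)%E;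
  nice_d2 : forall h : R, (sqn (fun x => (w (x.1, x.2 + h) - w x)%R) <= (h ^+ 2 * K)%:E)%E }.

Lemma nice_lim K (W : nat -> RR R -> R) w : (forall n, nice K (W n)) ->
  (forall x, W ^~ x @ \oo --> w x) -> nice K w.
Proof.
move=> nW cW.
have cB x y : (W n x - W n y) ^+ 2 @[n --> \oo] --> (w x - w y) ^+ 2.
  have h : W n x - W n y @[n --> \oo] --> w x - w y by apply: cvgB; exact: cW.
  exact: (cvgM h h).
have [mw sw] := sqn_lim (fun n => nice_m (nW n)) cW (fun n => nice_sqn (nW n)).
split => //.
- by move=> x; apply: (cvg_le_cst (cvgM (cW x) (cW x))) => n; exact: (nice_sup (nW n)).
- by move=> a b c; apply: (cvg_le_cst (cB _ _)) => n; exact: (nice_h1 (nW n)).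
- by move=> a b c; apply: (cvg_le_cst (cB _ _)) => n; exact: (nice_h2 (nW n)).
- move=> h; apply: (proj2 (@sqn_lim _ (fun n x => W n (x.1 + h, x.2) - W n x) _ _ _ _ (fun n => nice_d1 (nW n) h))).
    by move=> n; have := nice_m (nW n) => ?; mfun.
  by move=> x; apply: cvgB; exact: cW.
- move=> h; apply: (proj2 (@sqn_lim _ (fun n x => W n (x.1, x.2 + h) - W n x) _ _ _ _ (fun n => nice_d2 (nW n) h))).
    by move=> n; have := nice_m (nW n) => ?; mfun.
  by move=> x; apply: cvgB; exact: cW.
Qed.

Lemma cont1_der1 U V : der1 U V -> cont1 U.
Proof. by move=> h b s; exact: der_continuous (der1_line b h s). Qed.

Lemma cont2_der2 U V : der2 U V -> cont2 U.
Proof. by move=> h a s; exact: der_continuous (h (a, s)). Qed.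

(* An infinite family of classical derivatives [u i j = d_1^i d_2^j u], of
   which only those of order at most 3 are controlled in L^2. *)
Record family K (u : nat -> nat -> RR R -> R) : Prop := Family {
  fam_1 : forall i j, der1 (u i j) (u i.+1 j);
  fam_2 : forall i j, der2 (u i j) (u i j.+1);
  fam_m : forall i j, measurable_fun setT (u i j);
  fam_K : forall i j, (i + j <= 3)%N -> (sqn (u i j) <= K%:E)%E }.

Lemma family_swp K u : family K u -> family K (fun i j => swp (u j i)).
Proof.
move=> [f1 f2 fm fK]; split.
- by move=> i j; apply: der2_swp; exact: f2.
- by move=> i j; apply: der1_swp; exact: f1.
- by move=> i j; apply: measurable_swp; exact: fm.
- by move=> i j ij; rewrite sqn_swp//; apply: fK; rewrite addnC.
Qed.

Lemma family_hoelder1 K u i j (a b c : R) : family K u -> (i + j <= 1)%N ->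
  (u i j (b, c) - u i j (a, c)) ^+ 2 <= `|b - a| * (4 * K).
Proof.
move=> fu ij; have [f1 f2 fm fK] := fu; rewrite -lee_fin.
apply: (le_trans (plane_hoelder1 a b c (f1 i j) (cont1_der1 (f1 _ _)) (f2 i.+1 j) (cont2_der2 (f2 _ _)) (fm _ _) (fm _ _))).
rewrite EFinM; apply: lee_wpmul2l; first by rewrite lee_fin.
rewrite (_ : 4 * K = 2 * (K + K)); last by ring.
rewrite [leRHS]EFinM [(K + K)%:E]EFinD; apply: lee_wpmul2l; first by rewrite lee_fin.
by apply: leeD; apply: fK; lia.
Qed.

(** For i + j <= 1 the estimates use two further derivatives at most, in distinct directions, hence
    order at most 3. The constant 16 is 4 from [plane_sup] times its four terms. *)
Lemma family_nice K u i j : family K u -> (i + j <= 1)%N -> nice K (u i j).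
Proof.
move=> fu ij; have [f1 f2 fm fK] := fu; split.
- exact: fm.
- move=> x; rewrite -lee_fin.
  apply: (le_trans (plane_sup x (f1 i j) (cont1_der1 (f1 _ _)) (f2 i j) (cont2_der2 (f2 _ _)) (f2 i.+1 j) (cont2_der2 (f2 _ _)) (fm _ _) (fm _ _) (fm _ _) (fm _ _))).
  rewrite (_ : 16 * K = 4 * ((K + K) + (K + K))); last by ring.
  rewrite EFinM !EFinD; apply: lee_wpmul2l; first by rewrite lee_fin.
  by apply: leeD; apply: leeD; apply: fK; lia.
- by apply: fK; lia.
- by move=> a b c; exact: family_hoelder1.
- move=> a b c; rewrite distrC; rewrite -sqrrN opprB.
  by apply: (@family_hoelder1 K (fun i j => swp (u j i)) j i b c a (family_swp fu)); rewrite addnC.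
- move=> h; apply: (le_trans (plane_diff1 h (f1 i j) (cont1_der1 (f1 _ _)) (fm _ _) (fm _ _))).
  by rewrite [leRHS]EFinM; apply: lee_wpmul2l; [rewrite lee_fin sqr_ge0|apply: fK; lia].
- move=> h; have [g1 g2 gm gK] := family_swp fu.
  have := plane_diff1 h (g1 j i) (cont1_der1 (g1 _ _)) (gm _ _) (gm _ _).
  rewrite (_ : sqn _ = sqn (fun x => u i j (x.1, x.2 + h) - u i j x)); last first.
    by rewrite -[RHS]sqn_swp//; have := fm i j => ?; mfun.
  move=> /le_trans; apply.
  by rewrite [leRHS]EFinM; apply: lee_wpmul2l; [rewrite lee_fin sqr_ge0|apply: gK; lia].
Qed.

Lemma continuous_near_box (g : RR R -> R) (x : R * R) (e : R) :
  continuous (g : R * R -> R) -> 0 < e ->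
  exists2 d : R, 0 < d & forall z : R * R,
    x.1 <= z.1 <= x.1 + d -> x.2 <= z.2 <= x.2 + d -> `|g z - g x| <= e.
Proof.
move=> cg e0; have /cvgrPdist_le/(_ e e0) := cg x.
case=> -[A B] /= [[d1 /= d10 h1] [d2 /= d20 h2]] hAB.
exists (Num.min d1 d2 / 2).
  by rewrite divr_gt0// lt_min d10.
move=> [a b] /= /andP[a1 a2] /andP[b1 b2].
have m1 : Num.min d1 d2 <= d1 by rewrite ge_min lexx.
have m2 : Num.min d1 d2 <= d2 by rewrite ge_min lexx orbT.
have m0 : 0 < Num.min d1 d2 by rewrite lt_min d10.
rewrite distrC; apply: (hAB (a, b)); split => /=.
- by apply: h1 => /=; rewrite ltr_distlC; lra.
- by apply: h2 => /=; rewrite ltr_distlC; lra.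
Qed.

(** Mollification carries weak derivatives to classical ones, so the smoothed functions satisfy the
    bound [K] up to order 3. Their values converge because [g] is continuous, their gradients by
    [limit_C1], and the bounds pass to the limit. *)
Theorem sobolev_regular (g : R * R -> R) (h : nat -> nat -> R * R -> R) K : 0 <= K ->
  continuous g -> L2 g ->
  (forall i j, (i + j <= 3)%N ->
     [/\ L2 (h i j), is_weak_partial (i, j) g (h i j) & (sqn (h i j) <= K%:E)%E]) ->
  exists g1 g2, [/\ nice K g, nice K g1, nice K g2, der1 g g1 & der2 g g2].
Proof.
move=> K0 cg g2 hh; have /L2P[mg _] := g2.
have d0 n : 0 < n.+1%:R^-1 :> R by rewrite invr_gt0 ltr0n.
pose m n := sval (cid (mollifier_exists (d0 n))).
pose u n i j x := (-1) ^+ (i + j) * mol (m n) g i j x.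
have uw n i j x : (i + j <= 3)%N -> u n i j x = mol (m n) (h i j) 0 0 x.
  move=> ij; have [_ w _] := hh _ _ ij.
  by rewrite /u (mol_weak (m n) x w) mulrA -exprMn mulrNN mulr1 expr1n mul1r.
have fu n : family K (u n).
  split.
  - move=> i j x; apply: (der_eq (der_mul (der_cst _ _) (mol_der1 (m n) i j x g2))).
    by rewrite mul0r add0r /u addSn exprS mulN1r mulrN mulNr.
  - move=> i j x; apply: (der_eq (der_mul (der_cst _ _) (mol_der2 (m n) i j x g2))).
    by rewrite mul0r add0r /u addnS exprS mulN1r mulrN mulNr.
  - by move=> i j; rewrite /u; have := measurable_mol (m n) i j mg => ?; mfun.
  - move=> i j ij; have [h2 _ hK] := hh _ _ ij; apply: le_trans hK.
    have -> : u n i j = mol (m n) (h i j) 0 0 by apply/funext => x; exact: uw.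
    exact: mol_sqn.
have cu x : u n 0 0 x @[n --> \oo] --> g x.
  apply/cvgrPdist_le => e e0; have [d dp hd] := continuous_near_box x cg e0.
  near=> n; rewrite /u mul1r distrC; apply: mol_near => //; first exact: ltW.
  have nd : n.+1%:R^-1 <= d.
    near: n; exists (Num.Def.archi_bound d^-1) => // k /= hk.
    rewrite -[leRHS]invrK lef_pV2 ?posrE ?invr_gt0 ?ltr0n//.
    have dp' : 0 <= d^-1 by rewrite invr_ge0 ltW.
    apply: (le_trans (ltW (archi_boundP dp'))); rewrite ler_nat; exact: leq_trans hk (leqnSn _).
  move=> z /andP[a1 a2] /andP[b1 b2]; apply: hd; apply/andP; split => //.
    by apply: (le_trans a2); rewrite lerD2l.
  by apply: (le_trans b2); rewrite lerD2l.
have K4 : 0 <= 4 * K by rewrite mulr_ge0.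
have [g1 [dg1 cg1]] := limit_C1 K4 (fun n => fam_1 (fu n) 0 0)
  (fun n a b c => nice_h1 (family_nice (fu n) (leqnn 1 : (1 + 0 <= 1)%N)) a b c) cu.
(* The second partial derivative is obtained as the first one of the functions with swapped
   coordinates. *)
have cus x : swp (u n 0%N 0%N) x @[n --> \oo] --> swp g x by exact: cu.
have [g2' [dg2 cg2]] := limit_C1 K4 (fun n => der2_swp (fam_2 (fu n) 0 0))
  (fun n a b c => nice_h2 (family_nice (fu n) (leqnn 1 : (0 + 1 <= 1)%N)) c b a) cus.
exists g1, (swp g2'); split.
- by apply: (nice_lim (W := fun n => u n 0%N 0%N)) => // n; exact: family_nice.
- by apply: (nice_lim (W := fun n => u n 1%N 0%N)) => // n; exact: family_nice.
- apply: (nice_lim (W := fun n => u n 0%N 1%N)) => [n|x]; first exact: family_nice.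
  by have := cg2 (x.2, x.1); rewrite /swp /=; case: x.
- exact: dg1.
- by move=> x; exact: (dg2 (x.2, x.1)).
Unshelve. all: end_near. Qed.

End regularity.

(** * The contour integrand *)

Section nice_facts.
Context {R : realType}.
Implicit Types (u v w : RR R -> R) (K : R).

Lemma sqn_le u v : measurable_fun setT u -> measurable_fun setT v ->
  (forall x, u x ^+ 2 <= v x ^+ 2) -> (sqn u <= sqn v)%E.
Proof.
move=> mu mv h; apply: ge0_le_integral => //.
- by move=> x _; rewrite lee_fin sqr_ge0.
- by mfun.
- by mfun.
- by move=> x _; rewrite lee_fin.
Qed.

Lemma sqn_add u v : measurable_fun setT u -> measurable_fun setT v ->
  (sqn (fun x => u x + v x)%R <= 2%:E * sqn u + 2%:E * sqn v)%E.
Proof.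
move=> mu mv; have pos (w : RR R -> R) : forall x, setT x -> (0 <= (w x ^+ 2)%:E)%E.
  by move=> x _; rewrite lee_fin sqr_ge0.
have mu2 : measurable_fun setT (fun x => (u x ^+ 2)%:E) by mfun.
have mv2 : measurable_fun setT (fun x => (v x ^+ 2)%:E) by mfun.
rewrite /sqn -(ge0_integralZl (leb2 R) measurableT mu2 (pos u))// -(ge0_integralZl (leb2 R) measurableT mv2 (pos v))//.
rewrite -ge0_integralD//; last 4 first.
- by move=> x _; rewrite -EFinM lee_fin mulr_ge0 ?sqr_ge0.
- by apply: measurable_funeM; mfun.
- by move=> x _; rewrite -EFinM lee_fin mulr_ge0 ?sqr_ge0.
- by apply: measurable_funeM; mfun.
apply: ge0_le_integral => //.
- by move=> x _; rewrite lee_fin sqr_ge0.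
- by mfun.
- by apply: emeasurable_funD; apply: measurable_funeM; mfun.
- move=> x _; rewrite -!EFinM -EFinD lee_fin.
  by have := sqr_ge0 (u x - v x); nra.
Qed.

Lemma sqn_mul u v : measurable_fun setT u -> measurable_fun setT v ->
  (\int[leb2 R]_x `|u x * v x|%:E <= sqn u + sqn v)%E.
Proof.
move=> mu mv; rewrite /sqn -ge0_integralD//; last 4 first.
- by move=> x _; rewrite lee_fin sqr_ge0.
- by mfun.
- by move=> x _; rewrite lee_fin sqr_ge0.
- by mfun.
apply: ge0_le_integral => //.
- by mfun.
- by apply: emeasurable_funD; mfun.
- move=> x _; rewrite -EFinD lee_fin normrM -(real_normK (num_real (u x))) -(real_normK (num_real (v x))).
  by have := sqr_ge0 (`|u x| - `|v x|); have := normr_ge0 (u x); have := normr_ge0 (v x); nra.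
Qed.

Lemma sqn_mul_integrable u v : measurable_fun setT u -> measurable_fun setT v ->
  (sqn u < +oo)%E -> (sqn v < +oo)%E ->
  (leb2 R).-integrable setT (EFin \o (fun x => u x * v x)).
Proof.
move=> mu mv iu iv; apply/integrableP; split; first by mfun.
by apply: le_lt_trans (sqn_mul mu mv) _; apply: lte_add_pinfty.
Qed.

(** One crude constant for the sup bound and the Hoelder bound, by sqrt(16 K) <= 1 + 16 K. *)
Definition bnd K : R := 1 + 16 * K.

Lemma nice_K K w : nice K w -> 0 <= K.
Proof. by move=> [_ h _ _ _ _ _]; have := h 0; have := sqr_ge0 (w 0); lra. Qed.

Lemma bnd_ge1 K w : nice K w -> 1 <= bnd K.
Proof. by move=> /nice_K; rewrite /bnd; lra. Qed.

Lemma nice_abs K w x : nice K w -> `|w x| <= bnd K.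
Proof.
move=> nw; have := nice_sup nw x; rewrite -(real_normK (num_real (w x))) /bnd.
by have := sqr_ge0 (`|w x| - 1); nra.
Qed.

Lemma nice_half K w x y : nice K w ->
  `|w x - w (x - y)| <= bnd K * Num.sqrt (enorm y).
Proof.
move=> nw; have K0 := nice_K nw; case: x y => a b [c e]; rewrite pairB.
have h1 := nice_h1 nw (a - c) a b; have h2 := nice_h2 nw (a - c) b (b - e).
have c1 := enorm_fst (c, e); have c2 := enorm_snd (c, e); have r0 := enorm_ge0 (c, e).
rewrite /= (_ : a - (a - c) = c) in h1; last by ring.
rewrite /= (_ : b - (b - e) = e) in h2; last by ring.
rewrite /= in c1 c2.
have h3 : (w (a, b) - w (a - c, b - e)) ^+ 2 <= 16 * K * enorm (c, e).
  have q1 : `|c| * (4 * K) <= enorm (c, e) * (4 * K) by rewrite ler_wpM2r ?mulr_ge0.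
  have q2 : `|e| * (4 * K) <= enorm (c, e) * (4 * K) by rewrite ler_wpM2r ?mulr_ge0.
  set A := w (a, b) in h1 *; set B := w (a - c, b) in h1 h2 *; set C := w (a - c, b - e) in h2 *.
  by have := sqr_ge0 ((A - B) - (B - C)); nra.
rewrite -sqrtr_sqr -[leRHS]ger0_norm ?mulr_ge0 ?sqrtr_ge0//; last by rewrite /bnd; lra.
rewrite -(sqrtr_sqr (bnd K * _)) ler_sqrt ?sqr_ge0// exprMn sqr_sqrtr//.
apply: le_trans h3 _; rewrite ler_wpM2r// /bnd; nra.
Qed.

Lemma nice_shift K w y : nice K w ->
  (sqn (fun x => (w x - w (x - y))%R) <= (4 * K * enorm y ^+ 2)%:E)%E.
Proof.
move=> nw; have K0 := nice_K nw; have mw := nice_m nw.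
case: y => c e; have d1 := nice_d1 nw (- c); have d2 := nice_d2 nw (- e).
pose u x := w x - w (x.1 - c, x.2).
pose v x := w x - w (x.1, x.2 - e).
have mu : measurable_fun setT u by rewrite /u; mfun.
have mv : measurable_fun setT v by rewrite /v; mfun.
have su : (sqn u <= (c ^+ 2 * K)%:E)%E.
  rewrite -[c ^+ 2]sqrrN; apply: le_trans d1; apply: sqn_le => //; first by mfun.
  by move=> x; rewrite /u -sqrrN opprB.
have sv : (sqn (fun x => v (x - (c, 0)%R)%R) <= (e ^+ 2 * K)%:E)%E.
  rewrite sqn_shift// -[e ^+ 2]sqrrN; apply: le_trans d2; apply: sqn_le => //; first by mfun.
  by move=> x; rewrite /v -sqrrN opprB.
have -> : (fun x => w x - w (x - (c, e))) = (fun x => u x + v (x - (c, 0))).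
  by apply/funext => -[a b]; rewrite !pairB /u /v /= subr0; ring.
apply: (le_trans (sqn_add mu _)); first by mfun.
rewrite enorm_sqr /=; apply: (@le_trans _ _ (2%:E * (c ^+ 2 * K)%:E + 2%:E * (e ^+ 2 * K)%:E)%E).
  by apply: leeD; apply: lee_wpmul2l.
by rewrite -!EFinM -EFinD lee_fin; have := sqr_ge0 c; have := sqr_ge0 e; nra.
Qed.

(** The shift by [y] is a horizontal one followed by a vertical one. *)
Lemma nice_shift2 K w (y : RR R) : nice K w ->
  (sqn (fun x => (w x - w (x - y))%R) <= (4 * K)%:E)%E.
Proof.
move=> nw; have K0 := nice_K nw; have mw := nice_m nw.
have mN : measurable_fun setT (fun x : RR R => - w (x - y)) by mfun.
apply: (le_trans (sqn_add mw mN)).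
rewrite (_ : sqn (fun x : RR R => - w (x - y)) = sqn w); last first.
  by rewrite -[RHS](sqn_shift y mw); apply: eq_integral => x _; rewrite sqrrN.
rewrite (_ : 4 * K = 2 * K + 2 * K); last by ring.
by rewrite (EFinD (2 * K)) (EFinM 2 K); apply: leeD; apply: lee_wpmul2l => //; exact: nice_sqn nw.
Qed.

(** Combines [nice_shift] and [nice_shift2] through min(r^2, 1) <= 2 r^2 / (1 + r^2). The bound is
    written with r^3 so that division by r^3 leaves [kk]. *)
Lemma nice_shift_kk K w y : nice K w -> 0 < enorm y ->
  (sqn (fun x => (w x - w (x - y))%R) <= (8 * K * (enorm y ^+ 3 * kk y))%:E)%E.
Proof.
move=> nw r0; have K0 := nice_K nw.
have E : enorm y ^+ 3 * kk y = enorm y ^+ 2 / (1 + enorm y ^+ 2).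
  rewrite /kk invfM; have h : 0 < 1 + enorm y ^+ 2 by rewrite ltr_pwDl// sqr_ge0.
  by move/lt0r_neq0: h; move/lt0r_neq0: r0 => r0 h; field; apply/andP; split.
have s0 : 0 <= enorm y ^+ 2 by exact: sqr_ge0.
rewrite E; have [s1|s1] := leP (enorm y ^+ 2) 1.
  apply: (le_trans (nice_shift y nw)); rewrite lee_fin mulrA ler_pdivlMr; last lra.
  have h : 0 <= K * enorm y ^+ 2 * (1 - enorm y ^+ 2) by apply: mulr_ge0; [exact: mulr_ge0|rewrite subr_ge0].
  by nra.
apply: (le_trans (nice_shift2 y nw)); rewrite lee_fin mulrA ler_pdivlMr; last lra.
have h : 0 <= K * (enorm y ^+ 2 - 1) by rewrite mulr_ge0// subr_ge0 ltW.
by nra.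
Qed.

End nice_facts.

(** * Increments of g and the contour kernel *)

Section contour.
Context {R : realType}.
Variables (K : R) (g g1 g2 : RR R -> R).
Hypotheses (ng : nice K g) (n1 : nice K g1) (n2 : nice K g2).
Hypotheses (d1 : der1 g g1) (d2 : der2 g g2).

Definition dl (x y : RR R) := g x - g (x - y).
Definition SS (x y : RR R) := Num.sqrt (enorm y ^+ 2 + dl x y ^+ 2).
Definition ker (x y : RR R) : R :=
  ((g1 x - g1 (x - y)) * y.1 + (g2 x - g2 (x - y)) * y.2) / SS x y ^+ 3.

Let L := bnd K.
Let L1 : 1 <= L := bnd_ge1 ng.

Lemma SS_ge0 x y : 0 <= SS x y. Proof. exact: sqrtr_ge0. Qed.

Lemma SS_sqr x y : SS x y ^+ 2 = enorm y ^+ 2 + dl x y ^+ 2.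
Proof. by rewrite sqr_sqrtr// addr_ge0 ?sqr_ge0. Qed.

Lemma SS_enorm x y : enorm y <= SS x y.
Proof. by rewrite -[leLHS]ger0_norm ?enorm_ge0// -sqrtr_sqr ler_wsqrtr// lerDl sqr_ge0. Qed.

Lemma SS_dl x y : `|dl x y| <= SS x y.
Proof. by rewrite -sqrtr_sqr ler_wsqrtr// lerDr sqr_ge0. Qed.

Lemma SS_gt0 x y : 0 < enorm y -> 0 < SS x y.
Proof. by move=> h; apply: lt_le_trans h (SS_enorm x y). Qed.

Lemma enorm_eq0 (y : RR R) : enorm y = 0 -> y = (0, 0).
Proof.
move=> h; have := enorm_fst y; have := enorm_snd y; rewrite h !normr_le0.
by case: y {h} => a b /= /eqP -> /eqP ->.
Qed.

Lemma muskatE x y : muskat_integrand g x y = ker x y.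
Proof.
rewrite /muskat_integrand /ker !(partial1_der (d1 _)) !(partial2_der (d2 _)).
have [r0|] := ltP 0 (enorm y).
  congr (_ / _); rewrite -/(dl x y) -SS_sqr.
  have S0 := SS_gt0 x r0.
  rewrite -(powR_mulrn 2 (ltW S0)) -powRrM mulrC -mulrA mulVf ?pnatr_eq0// mulr1.
  by rewrite powR_mulrn// ltW.
(* At y = 0 both sides are 0, since the numerators vanish. *)
move=> r0; have /enorm_eq0 -> : enorm y = 0 by apply: le_anti; rewrite r0 enorm_ge0.
by rewrite /= !mulr0 addr0 !mul0r.
Qed.

Lemma dl_lip x y : `|dl x y| <= 2 * L * enorm y.
Proof.
have line (w w1 : R -> R) (a b : R) : (forall s : R, is_derive s 1 w (w1 s)) ->
    (forall s, `|w1 s| <= L) -> `|w b - w a| <= L * `|b - a|.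
  move=> dw bw; wlog ab : a b / a < b.
    move=> H; have [ab|ba|->] := ltgtP a b; first exact: H.
      by rewrite distrC [X in _ * X]distrC; exact: H.
    by rewrite !subrr normr0 mulr0.
  have cw : continuous w by move=> s; exact: der_continuous (dw s).
  have [c _ ->] := MVT ab (fun s _ => dw s) (continuous_subspaceT cw).
  by rewrite normrM ler_wpM2r.
case: x y => a b [c e]; rewrite /dl pairB.
have h1 := line (fun s => g (s, b)) (fun s => g1 (s, b)) (a - c) a (der1_line b d1) (fun s => nice_abs _ n1).
have h2 := line (fun s => g (a - c, s)) (fun s => g2 (a - c, s)) (b - e) b (fun s => d2 (a - c, s)) (fun s => nice_abs _ n2).
have e1 := enorm_fst (c, e); have e2 := enorm_snd (c, e); rewrite /= in e1 e2.
rewrite /= (_ : a - (a - c) = c) in h1; last by ring.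
rewrite /= (_ : b - (b - e) = e) in h2; last by ring.
rewrite (_ : g (a, b) - _ = (g (a, b) - g (a - c, b)) + (g (a - c, b) - g (a - c, b - e))); last by ring.
apply: le_trans (ler_normD _ _) _.
have L0 : 0 <= L by exact: le_trans ler01 L1.
have q1 : L * `|c| <= L * enorm (c, e) by rewrite ler_wpM2l.
have q2 : L * `|e| <= L * enorm (c, e) by rewrite ler_wpM2l.
lra.
Qed.

Lemma dl_bnd x y : `|dl x y| <= 2 * L.
Proof.
apply: le_trans (ler_normB _ _) _.
by have := nice_abs x ng; have := nice_abs (x - y) ng; rewrite -/L; lra.
Qed.

Let mg := nice_m ng.
Let mg1 := nice_m n1.
Let mg2 := nice_m n2.

Lemma measurable_dl : measurable_fun setT (fun z : RR R * RR R => dl z.1 z.2).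
Proof. by rewrite /dl; mfun. Qed.

Lemma measurable_SS : measurable_fun setT (fun z : RR R * RR R => SS z.1 z.2).
Proof. by have := measurable_dl => ?; rewrite /SS; mfun. Qed.

Lemma measurable_ker : measurable_fun setT (fun z : RR R * RR R => ker z.1 z.2).
Proof. by have := measurable_SS => ?; rewrite /ker; mfun. Qed.

Definition jump (x y : RR R) := `|g1 x - g1 (x - y)| + `|g2 x - g2 (x - y)|.
Definition slope (x : RR R) := `|g1 x| + `|g2 x|.

Lemma jump_ge0 x y : 0 <= jump x y. Proof. exact: addr_ge0. Qed.
Lemma slope_ge0 x : 0 <= slope x. Proof. exact: addr_ge0. Qed.

Lemma jump_half x y : jump x y <= 2 * L * Num.sqrt (enorm y).
Proof. by have := nice_half x y n1; have := nice_half x y n2; rewrite /jump -/L; lra. Qed.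

Lemma slope_bnd x : slope x <= 2 * L.
Proof. by have := nice_abs x n1; have := nice_abs x n2; rewrite /slope -/L; lra. Qed.

Lemma dot_le (a b : R) (y : RR R) : `|a * y.1 + b * y.2| <= (`|a| + `|b|) * enorm y.
Proof.
apply: le_trans (ler_normD _ _) _; rewrite !normrM mulrDl.
by apply: lerD; rewrite ler_wpM2l// ?enorm_fst ?enorm_snd.
Qed.

Lemma SS3_inv x y (k : nat) : 0 < enorm y -> (SS x y ^+ k)^-1 <= (enorm y ^+ k)^-1.
Proof.
move=> r0; rewrite lef_pV2 ?posrE ?exprn_gt0 ?SS_gt0// lerXn2r ?nnegrE ?enorm_ge0 ?SS_ge0//.
exact: SS_enorm.
Qed.

Lemma ker_le x y : 0 < enorm y -> `|ker x y| <= jump x y / enorm y ^+ 2.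
Proof.
move=> r0; rewrite /ker normrM [X in _ * X]ger0_norm ?invr_ge0 ?exprn_ge0 ?SS_ge0//.
apply: (@le_trans _ _ ((jump x y * enorm y) / enorm y ^+ 3)).
  by apply: ler_pM; rewrite ?invr_ge0 ?exprn_ge0 ?SS_ge0 ?dot_le// SS3_inv.
by rewrite le_eqVlt; apply/orP; left; apply/eqP; field; rewrite gt_eqF.
Qed.

Lemma SS_dist x y : SS x y - enorm y <= `|dl x y|.
Proof.
have := SS_sqr x y; have := SS_ge0 x y; have := enorm_ge0 y; have := normr_ge0 (dl x y).
by rewrite -(real_normK (num_real (dl x y))) => *; nra.
Qed.

(** S^2 - r^2 = d^2 and S + r >= 2 r. The bound is quadratic in d, which makes the dissipation
    integrable over pairs. *)
Lemma SS_dist2 x y : 0 < enorm y -> SS x y - enorm y <= dl x y ^+ 2 / (2 * enorm y).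
Proof.
move=> r0; rewrite ler_pdivlMr ?mulr_gt0//.
by have := SS_sqr x y; have := SS_enorm x y; have := SS_ge0 x y; nra.
Qed.

(** Difference of cubes: the factor S - r is at most |d|, and since r <= S each of the three
    remaining terms is at most 1/r^4. *)
Lemma inv3_dist x y : 0 < enorm y ->
  `|(enorm y ^+ 3)^-1 - (SS x y ^+ 3)^-1| <= 3 * `|dl x y| / enorm y ^+ 4.
Proof.
move=> r0; have S0 := SS_gt0 x r0; have rS := SS_enorm x y.
rewrite ger0_norm ?subr_ge0 ?SS3_inv//.
have -> : (enorm y ^+ 3)^-1 - (SS x y ^+ 3)^-1 =
    (SS x y - enorm y) * ((SS x y ^+ 2 + SS x y * enorm y + enorm y ^+ 2) / (enorm y ^+ 3 * SS x y ^+ 3)).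
  by field; rewrite !gt_eqF.
have -> : 3 * `|dl x y| / enorm y ^+ 4 = `|dl x y| * (3 / enorm y ^+ 4) by ring.
apply: ler_pM; rewrite ?subr_ge0//.
- by rewrite divr_ge0 ?mulr_ge0 ?exprn_ge0 ?addr_ge0 ?exprn_ge0 ?mulr_ge0// ltW.
- exact: SS_dist.
rewrite ler_pdivrMr ?mulr_gt0 ?exprn_gt0// mulrAC ler_pdivlMr ?exprn_gt0//.
move: (SS x y) (enorm y) S0 r0 rS => S r S0 r0 rS.
have h1 : 0 <= (S - r) * r * S * r ^+ 3 by rewrite !mulr_ge0 ?subr_ge0 ?exprn_ge0// ltW.
have -> : 3 * (r ^+ 3 * S ^+ 3) = r ^+ 3 * (3 * S ^+ 3) by ring.
have -> : (S ^+ 2 + S * r + r ^+ 2) * r ^+ 4 = r ^+ 3 * ((S ^+ 2 + S * r + r ^+ 2) * r) by ring.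
rewrite ler_wpM2l ?exprn_ge0 ?(ltW r0)//.
have h2 : r * S <= S * S by rewrite ler_wpM2r// ltW.
have h3 : r * r <= S * S by nra.
have h4 : (S * S) * r <= (S * S) * S by rewrite ler_wpM2l// mulr_ge0// ltW.
have h5 : (r * r) * r <= (S * S) * S by nra.
have h6 : (S * r) * r <= (S * S) * S by nra.
by rewrite !exprS expr0; nra.
Qed.

End contour.

(** * Integrals of divergences *)

Section off_origin.
Context {R : realType}.
Implicit Types (F G : RR R -> R).

(** The origin lies on the axes, which form a null set. *)
Lemma ae_enorm_gt0 (P : RR R -> Prop) : (forall y, 0 < enorm y -> P y) ->
  {ae leb2 R, forall y, P y}.
Proof.
move=> h; apply: (negligibleS _ (@axes_negligible R)) => y /= nP.
have [|r0] := ltP 0 (enorm y); first by move=> /h.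
by left; apply/eqP; rewrite -normr_le0; apply: le_trans (enorm_fst y) r0.
Qed.

Lemma le_integral_off0 F G : measurable_fun setT F -> measurable_fun setT G ->
  (forall y, 0 <= F y) -> (forall y, 0 <= G y) ->
  (forall y, 0 < enorm y -> F y <= G y) ->
  (\int[leb2 R]_y (F y)%:E <= \int[leb2 R]_y (G y)%:E)%E.
Proof.
move=> mF mG F0 G0 h; apply: ae_ge0_le_integral => //.
- by move=> y _; rewrite lee_fin.
- by mfun.
- by move=> y _; rewrite lee_fin.
- by mfun.
- by apply: ae_enorm_gt0 => y r0 _; rewrite lee_fin h.
Qed.

Lemma integrable_off0 F G : measurable_fun setT F ->
  (leb2 R).-integrable setT (EFin \o G) ->
  (forall y, 0 < enorm y -> `|F y| <= G y) ->
  (leb2 R).-integrable setT (EFin \o F).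
Proof.
move=> mF /integrableP[mG iG] h; have {}mG : measurable_fun setT G by apply/measurable_EFinP.
apply/integrableP; split; first by mfun.
apply: le_lt_trans iG; apply: (@le_integral_off0 (fun y => `|F y|) (fun y => `|G y|)) => //.
- by mfun.
- by mfun.
- by move=> y r0; apply: le_trans (h _ r0) (ler_norm _).
Qed.

Lemma eq_integral_off0 F G : measurable_fun setT F -> measurable_fun setT G ->
  (forall y, 0 < enorm y -> F y = G y) ->
  \int[leb2 R]_y F y = \int[leb2 R]_y G y.
Proof.
move=> mF mG h; congr fine; apply: ae_eq_integral => //.
- by mfun.
- by mfun.
- by apply: ae_enorm_gt0 => y r0 _ /=; rewrite h.
Qed.

Lemma integrable_kk : (leb2 R).-integrable setT (EFin \o @kk R).
Proof.
apply/integrableP; split; first by have := @measurable_kk R => ?; mfun.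
rewrite (eq_integral (fun y => (kk y)%:E)) ?kk_lty// => y _.
by rewrite /= ger0_norm ?kk_ge0.
Qed.

Lemma integrable_kh : (leb2 R).-integrable setT (EFin \o @kh R).
Proof.
apply/integrableP; split; first by have := @measurable_kh R => ?; mfun.
rewrite (eq_integral (fun y => (kh y)%:E)) ?kh_lty// => y _.
by rewrite /= ger0_norm ?kh_ge0.
Qed.

Lemma integrable_scale F (C : R) : (leb2 R).-integrable setT (EFin \o F) ->
  (leb2 R).-integrable setT (EFin \o (fun y => C * F y)).
Proof. by move=> iF; exact: (integrableZl measurableT C iF). Qed.

Lemma integrable_plus F G : (leb2 R).-integrable setT (EFin \o F) ->
  (leb2 R).-integrable setT (EFin \o G) ->
  (leb2 R).-integrable setT (EFin \o (fun y => F y + G y)).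
Proof. by move=> iF iG; exact: (integrableD measurableT iF iG). Qed.

Lemma integrable_minus F G : (leb2 R).-integrable setT (EFin \o F) ->
  (leb2 R).-integrable setT (EFin \o G) ->
  (leb2 R).-integrable setT (EFin \o (fun y => F y - G y)).
Proof. by move=> iF iG; exact: (integrableB measurableT iF iG). Qed.

Lemma norm_integral_le F G : measurable_fun setT F -> measurable_fun setT G ->
  (forall y, 0 <= G y) -> (forall y, 0 < enorm y -> `|F y| <= G y) ->
  (leb2 R).-integrable setT (EFin \o F) ->
  (`|\int[leb2 R]_y F y|%:E <= \int[leb2 R]_y (G y)%:E)%E.
Proof.
move=> mF mG G0 h iF; rewrite (EFin_normr_Rintegral measurableT iF).
apply: le_trans (le_abse_integral _ _ _) _ => //; first by mfun.
by apply: (@le_integral_off0 (fun y => `|F y|)) => //; mfun.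
Qed.

Lemma odd_integral F : (leb2 R).-integrable setT (EFin \o F) ->
  (forall y, F (- y) = - F y) -> \int[leb2 R]_y F y = 0.
Proof.
move=> iF odd; have mF : measurable_fun setT F.
  by apply/measurable_EFinP; exact: measurable_int iF.
have E : \int[leb2 R]_y F (- y) = \int[leb2 R]_y F y.
  by congr fine; apply: (@integral_leb2_opp _ (EFin \o F)); mfun.
have : \int[leb2 R]_y F (- y) = - \int[leb2 R]_y F y.
  rewrite -mulN1r -RintegralZl//; apply: eq_Rintegral => y _.
  by rewrite odd mulN1r.
by rewrite E; lra.
Qed.

End off_origin.

(** * Divergence theorem for a scalar field times the position vector *)

Section radial.
Context {R : realType}.
Variables (h h1 : R -> R) (U U1 U2 : RR R -> R) (C : R).
Hypothesis dh : forall p : R, 0 < p -> is_derive p 1 h (h1 p).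
Hypothesis ch : forall p : R, 0 < p -> {for p, continuous h1}.
Hypothesis dU1 : forall s b : R, b != 0 -> is_derive s 1 (fun s => U (s, b)) (U1 (s, b)).
Hypothesis dU2 : forall s a : R, a != 0 -> is_derive s 1 (fun s => U (a, s)) (U2 (a, s)).
Hypothesis cU1 : forall b : R, b != 0 -> continuous (fun s => U1 (s, b)).
Hypothesis cU2 : forall a : R, a != 0 -> continuous (fun s => U2 (a, s)).
Let p (y : RR R) := enorm y ^+ 2.
Hypothesis mh : measurable_fun setT (fun y : RR R => h (enorm y ^+ 2)).
Hypothesis mh1 : measurable_fun setT (fun y : RR R => h1 (enorm y ^+ 2)).
Hypotheses (mU : measurable_fun setT U) (mU1 : measurable_fun setT U1)
  (mU2 : measurable_fun setT U2).
Hypothesis b0 : forall y, 0 < enorm y -> `|enorm y * h (p y) * U y| <= C * kk y.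
Hypothesis b1 : forall y, 0 < enorm y -> `|h (p y) * U y| <= C * kk y.
Hypothesis b2 : forall y, 0 < enorm y -> `|p y * h1 (p y) * U y| <= C * kk y.
Hypothesis b3 : forall y, 0 < enorm y -> `|enorm y * h (p y) * U1 y| <= C * kk y.
Hypothesis b4 : forall y, 0 < enorm y -> `|enorm y * h (p y) * U2 y| <= C * kk y.

Let radial1 (c s : R) (V V1 : R -> R) : 0 < c -> is_derive s 1 V (V1 s) ->
  is_derive s 1 (fun s => s * h (s ^+ 2 + c) * V s)
    (h (s ^+ 2 + c) * V s + 2 * s ^+ 2 * h1 (s ^+ 2 + c) * V s + s * h (s ^+ 2 + c) * V1 s).
Proof.
move=> c0 dV; have q0 : 0 < s ^+ 2 + c by rewrite ltr_wpDl// sqr_ge0.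
have dq := der_add (der_exp 2 (der_id s)) (der_cst s c).
have d := der_mul (der_mul (der_id s) (@der_comp _ s (fun s => s ^+ 2 + c) h _ _ (dh q0) dq)) dV.
by apply: (der_eq d); rewrite /= expr1; ring.
Qed.

Let radial1_cont (c : R) (V V1 : R -> R) : 0 < c ->
  (forall s : R, is_derive s 1 V (V1 s)) -> continuous V1 ->
  continuous (fun s : R => h (s ^+ 2 + c) * V s + 2 * s ^+ 2 * h1 (s ^+ 2 + c) * V s
    + s * h (s ^+ 2 + c) * V1 s).
Proof.
move=> c0 dV cV1 s; have q0 : 0 < s ^+ 2 + c by rewrite ltr_wpDl// sqr_ge0.
have dq := der_add (der_exp 2 (der_id s)) (der_cst s c).
have cq := der_continuous dq.
have c1 : {for s, continuous (fun s : R => h (s ^+ 2 + c))} := der_continuous (@der_comp _ s (fun s => s ^+ 2 + c) h _ _ (dh q0) dq).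
have c2 : {for s, continuous (fun s : R => h1 (s ^+ 2 + c))}.
  exact: (@continuous_comp _ _ _ (fun s : R => s ^+ 2 + c) h1 s cq (ch q0)).
have cV := der_continuous (dV s).
have c3 : {for s, continuous (fun s : R => 2 * s ^+ 2)}.
  by apply: cvgM; [exact: cvg_cst|exact: exprn_continuous].
have c4 : {for s, continuous (fun s : R => s)} by exact: cvg_id.
apply: cvgD; last by apply: cvgM (cV1 s); exact: cvgM c4 c1.
by apply: cvgD; [exact: cvgM c1 cV|apply: cvgM cV; exact: cvgM c3 c2].
Qed.

Let D1 y := h (p y) * U y + 2 * y.1 ^+ 2 * h1 (p y) * U y + y.1 * h (p y) * U1 y.
Let D2 y := h (p y) * U y + 2 * y.2 ^+ 2 * h1 (p y) * U y + y.2 * h (p y) * U2 y.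

Let iC (k : R) : (leb2 R).-integrable setT (EFin \o (fun y => k * (C * kk y))).
Proof. by do 2 apply: integrable_scale; exact: integrable_kk. Qed.

Let dom (c V : R) y : 0 < enorm y -> `|c| <= enorm y ->
  `|enorm y * h (p y) * V| <= C * kk y -> `|c * h (p y) * V| <= C * kk y.
Proof.
move=> r0 cr; apply: le_trans; rewrite !normrM ![_ * _ * `|V|]mulrAC.
by do 2 apply: ler_wpM2r => //; exact: le_trans cr (ler_norm _).
Qed.

Let dom2 c y : 0 < enorm y -> `|c| <= enorm y -> `|2 * c ^+ 2 * h1 (p y) * U y| <= 2 * (C * kk y).
Proof.
move=> r0 cr; have := b2 r0; rewrite !normrM normr_nat -!mulrA => b.
rewrite ler_pM2l//; apply: le_trans b; rewrite [leLHS]mulrA [leRHS]mulrA ler_wpM2r ?mulr_ge0//.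
by rewrite (ger0_norm (enorm_ge0 y)) ler_pM.
Qed.

Let iD1 : (leb2 R).-integrable setT (EFin \o D1).
Proof.
apply: (@integrable_off0 _ D1 _ _ (iC 4)); first by rewrite /D1 /p; mfun.
move=> y r0; rewrite /D1; apply: le_trans (ler_normD _ _) _.
have := ler_normD (h (p y) * U y) (2 * y.1 ^+ 2 * h1 (p y) * U y).
have := dom r0 (enorm_fst y) (b3 r0); have := dom2 r0 (enorm_fst y); have := b1 r0.
lra.
Qed.

Let iD2 : (leb2 R).-integrable setT (EFin \o D2).
Proof.
apply: (@integrable_off0 _ D2 _ _ (iC 4)); first by rewrite /D2 /p; mfun.
move=> y r0; rewrite /D2; apply: le_trans (ler_normD _ _) _.
have := ler_normD (h (p y) * U y) (2 * y.2 ^+ 2 * h1 (p y) * U y).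
have := dom r0 (enorm_snd y) (b4 r0); have := dom2 r0 (enorm_snd y); have := b1 r0.
lra.
Qed.

Let N0 : (@lebesgue_measure R).-negligible [set 0 : R].
Proof. exists [set 0]; split => //; exact: lebesgue_measure_set1. Qed.

Let int1 : (\int[leb2 R]_y (D1 y)%:E = 0)%E.
Proof.
apply: (@leb2_derive0 _ (fun y => y.1 * h (p y) * U y) D1 [set 0]) => //.
- move=> s b nb; have b0' : b != 0 by apply/eqP => e; exact: nb.
  rewrite /D1 /=.
  have bb : 0 < b ^+ 2 by rewrite exprn_even_gt0.
  have E (t : R) : p (t, b) = t ^+ 2 + b ^+ 2 by rewrite /p enorm_sqr.
  under eq_fun do rewrite E; rewrite E.
  exact: (@radial1 _ s (fun x => U (x, b)) (fun x => U1 (x, b)) bb (dU1 s b0')).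
- move=> b nb; have b0' : b != 0 by apply/eqP => e; exact: nb.
  have bb : 0 < b ^+ 2 by rewrite exprn_even_gt0.
  have E (t : R) : p (t, b) = t ^+ 2 + b ^+ 2 by rewrite /p enorm_sqr.
  rewrite /D1 /=; under eq_fun do rewrite E.
  exact: (radial1_cont bb (fun s => dU1 s b0') (cU1 b0')).
- apply: (integrable_off0 _ (iC 1)); first by rewrite /p; mfun.
  by move=> y r0; rewrite mul1r; apply: dom (b0 r0) => //; exact: enorm_fst.
Qed.

Let int2 : (\int[leb2 R]_y (D2 y)%:E = 0)%E.
Proof.
apply: (@leb2_derive0_snd _ (fun y => y.2 * h (p y) * U y) D2 [set 0]) => //.
- move=> s b nb; have b0' : b != 0 by apply/eqP => e; exact: nb.
  rewrite /D2 /=.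
  have bb : 0 < b ^+ 2 by rewrite exprn_even_gt0.
  have E (t : R) : p (b, t) = t ^+ 2 + b ^+ 2 by rewrite /p enorm_sqr addrC.
  under eq_fun do rewrite E; rewrite E.
  exact: (@radial1 _ s (fun x => U (b, x)) (fun x => U2 (b, x)) bb (dU2 s b0')).
- move=> b nb; have b0' : b != 0 by apply/eqP => e; exact: nb.
  have bb : 0 < b ^+ 2 by rewrite exprn_even_gt0.
  have E (t : R) : p (b, t) = t ^+ 2 + b ^+ 2 by rewrite /p enorm_sqr addrC.
  rewrite /D2 /=; under eq_fun do rewrite E.
  exact: (radial1_cont bb (fun s => dU2 s b0') (cU2 b0')).
- apply: (integrable_off0 _ (iC 1)); first by rewrite /p; mfun.
  by move=> y r0; rewrite mul1r; apply: dom (b0 r0) => //; exact: enorm_snd.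
Qed.

(* The divergence of [y |-> h(|y|^2) U(y) y]. *)
Definition radial_div (y : RR R) : R :=
  (2 * h (enorm y ^+ 2) + 2 * (enorm y ^+ 2 * h1 (enorm y ^+ 2))) * U y
  + h (enorm y ^+ 2) * (y.1 * U1 y + y.2 * U2 y).

Let divE y : radial_div y = D1 y + D2 y.
Proof. by rewrite /radial_div /D1 /D2 /p !enorm_sqr; ring. Qed.

Lemma radial_div_integrable : (leb2 R).-integrable setT (EFin \o radial_div).
Proof. by rewrite (funext divE); apply: integrable_plus. Qed.

(** Each coordinate is treated by [leb2_derive0]: along a line that misses the origin the field is
    C^1. The bounds by [kk] make the field and its derivatives integrable over the whole plane, so
    no boundary term arises at the origin or at infinity. *)
Lemma radial_div_integral : \int[leb2 R]_y radial_div y = 0.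
Proof.
rewrite (eq_Rintegral (leb2 R) (g := fun y => D1 y + D2 y)); last by move=> y _; rewrite divE.
by rewrite RintegralD// /Rintegral int1 int2 addr0.
Qed.

End radial.
Section continuity_at.
Context {R : realType}.
Implicit Types (f g : R -> R) (s : R).

Lemma ct_add s f g : {for s, continuous f} -> {for s, continuous g} ->
  {for s, continuous (fun x : R => f x + g x)}.
Proof. by move=> cf cg; apply: cvgD. Qed.

Lemma ct_opp s f : {for s, continuous f} -> {for s, continuous (fun x : R => - f x)}.
Proof. by move=> cf; apply: cvgN. Qed.

Lemma ct_mul s f g : {for s, continuous f} -> {for s, continuous g} ->
  {for s, continuous (fun x : R => f x * g x)}.
Proof. by move=> cf cg; apply: cvgM. Qed.

Lemma ct_inv s f : f s != 0 -> {for s, continuous f} ->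
  {for s, continuous (fun x : R => (f x)^-1)}.
Proof. by move=> f0 cf; apply: cvgV. Qed.

Lemma ct_exp s f n : {for s, continuous f} -> {for s, continuous (fun x : R => f x ^+ n)}.
Proof. by move=> cf; exact: (@continuous_comp _ _ _ f (fun x => x ^+ n) s cf (@exprn_continuous R n _)). Qed.

Lemma ct_cst s (c : R) : {for s, continuous (fun _ : R => c)}.
Proof. exact: cvg_cst. Qed.

Lemma ct_id s : {for s, continuous (fun x : R => x)}.
Proof. exact: cvg_id. Qed.

End continuity_at.

Ltac ct := repeat first [assumption | apply: ct_add | apply: ct_opp | apply: ct_mul
  | apply: ct_exp | apply: ct_cst | apply: ct_id].

(** * Derivatives in y along a coordinate line *)

Section root_derivatives.
Context {R : realType}.
Variables (D D1 : R -> R) (c : R).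
Hypotheses (c0 : 0 < c) (dD : forall s : R, is_derive s 1 D (D1 s)) (cD1 : continuous D1).
Let q s := s ^+ 2 + c + D s ^+ 2.
Let S s := Num.sqrt (q s).
Let r s := Num.sqrt (s ^+ 2 + c).

Let p0 s : 0 < s ^+ 2 + c. Proof. by rewrite ltr_wpDl// sqr_ge0. Qed.
Let q0 s : 0 < q s. Proof. by rewrite ltr_wpDr// sqr_ge0. Qed.
Let S0 s : 0 < S s. Proof. by rewrite sqrtr_gt0. Qed.
Let r0 s : 0 < r s. Proof. by rewrite sqrtr_gt0. Qed.
Let SN s : S s != 0. Proof. by rewrite gt_eqF. Qed.
Let rN s : r s != 0. Proof. by rewrite gt_eqF. Qed.

Let dp (s : R) : is_derive s 1 (fun s : R => s ^+ 2 + c) (2 * s).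
Proof.
have d := der_add (der_exp 2 (der_id s)) (der_cst s c).
by apply: (der_eq d); rewrite /= expr1; ring.
Qed.

Let dS (s : R) : is_derive s 1 S ((s + D s * D1 s) / S s).
Proof.
have d : is_derive s 1 q (2 * s + 2 * D s * D1 s).
  by have d := der_add (dp s) (der_exp 2 (dD s)); apply: (der_eq d); rewrite /= expr1; ring.
by have d' := der_sqrt d (q0 s); apply: (der_eq d'); rewrite -/(S s); have := SN s => ?; field.
Qed.

Let dr (s : R) : is_derive s 1 r (s / r s).
Proof.
by have d' := der_sqrt (dp s) (p0 s); apply: (der_eq d'); rewrite -/(r s); have := rN s => ?; field.
Qed.

(** Here [c] is the square of the coordinate held fixed; off the axis it is positive and keeps the
    roots away from 0. *)
Lemma der_slope_ratio (s : R) : is_derive s 1 (fun s : R => D s / Num.sqrt (s ^+ 2 + c + D s ^+ 2))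
  ((D1 s * (s ^+ 2 + c) - D s * s) / Num.sqrt (s ^+ 2 + c + D s ^+ 2) ^+ 3).
Proof.
have d := der_mul (dD s) (der_inv (dS s) (SN s)).
apply: (der_eq d); rewrite -/(S s).
have E : S s ^+ 2 = s ^+ 2 + c + D s ^+ 2 by rewrite sqr_sqrtr// ltW.
have -> : D1 s * (s ^+ 2 + c) - D s * s = D1 s * (S s ^+ 2 - D s ^+ 2) - D s * s by rewrite E; ring.
by have := SN s => ?; field.
Qed.

Lemma der_root_gap (s : R) : is_derive s 1
  (fun s : R => Num.sqrt (s ^+ 2 + c + D s ^+ 2) - Num.sqrt (s ^+ 2 + c))
  ((s + D s * D1 s) / Num.sqrt (s ^+ 2 + c + D s ^+ 2) - s / Num.sqrt (s ^+ 2 + c)).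
Proof. exact: (der_add (dS s) (der_opp (dr s))). Qed.

Let cS s : {for s, continuous S}. Proof. exact: der_continuous (dS s). Qed.
Let cr s : {for s, continuous r}. Proof. exact: der_continuous (dr s). Qed.
Let cD s : {for s, continuous D}. Proof. exact: der_continuous (dD s). Qed.

Lemma continuous_slope_ratio1 (s : R) : {for s, continuous (fun s : R =>
  (D1 s * (s ^+ 2 + c) - D s * s) / Num.sqrt (s ^+ 2 + c + D s ^+ 2) ^+ 3)}.
Proof.
have h1 := @cD1 s; have h2 := @cD s; have h3 := @cS s.
apply: ct_mul; first by ct.
by apply: ct_inv; [rewrite expf_neq0// SN|apply: ct_exp].
Qed.

Lemma continuous_root_gap1 (s : R) : {for s, continuous (fun s : R =>
  (s + D s * D1 s) / Num.sqrt (s ^+ 2 + c + D s ^+ 2) - s / Num.sqrt (s ^+ 2 + c))}.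
Proof.
have h1 := @cD1 s; have h2 := @cD s; have h3 := @cS s; have h4 := @cr s.
apply: ct_add; first apply: ct_mul; first by ct.
- by apply: ct_inv => //; exact: SN.
- by apply: ct_opp; apply: ct_mul; [ct|apply: ct_inv => //; exact: rN].
Qed.

End root_derivatives.

(** * Damping weights *)

Section weights.
Context {R : realType}.
Variables (N e : R).
Hypotheses (N1 : 1 <= N) (e0 : 0 <= e).

(* At [p = |y|^2] this is [chi N y] divided by [e + |y|^2]; only [e = 0] and
   [e = 1] occur. *)
Definition wgt (p : R) : R := N / ((e + p) * (N + p)).
Definition wgt1 (p : R) : R := - (N * (N + e + 2 * p)) / ((e + p) * (N + p)) ^+ 2.

Let den_gt0 p : 0 < p -> 0 < (e + p) * (N + p).
Proof. by move=> p0; rewrite mulr_gt0//; have := e0; have := N1; lra. Qed.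

Lemma der_wgt (p : R) : 0 < p -> is_derive p 1 wgt (wgt1 p).
Proof.
move=> p0; have dd := gt_eqF (den_gt0 p0).
have d1 := der_mul (der_add (der_cst p e) (der_id p)) (der_add (der_cst p N) (der_id p)).
have d2 := der_mul (der_cst p N) (der_inv d1 (negbT dd)).
by apply: (der_eq d2); rewrite /wgt1; move/negbT: dd; rewrite mulf_eq0 negb_or => /andP[? ?]; field; apply/andP.
Qed.

Lemma wgt1_continuous (p : R) : 0 < p -> {for p, continuous wgt1}.
Proof.
move=> p0; rewrite /wgt1; apply: ct_mul; first by ct.
by apply: ct_inv; [rewrite expf_neq0// gt_eqF// den_gt0|ct].
Qed.

Lemma wgt_ge0 p : 0 < p -> 0 <= wgt p.
Proof. by move=> p0; rewrite divr_ge0// ?(ltW (den_gt0 p0))//; have := N1; lra. Qed.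

(** The logarithmic derivative of [wgt], multiplied by -p, is p/(e + p) + p/(N + p), and both
    fractions are at most 1. *)
Lemma wgt1_le p : 0 < p -> `|p * wgt1 p| <= 2 * wgt p.
Proof.
move=> p0; have d0 := den_gt0 p0; have h0 := wgt_ge0 p0.
rewrite /wgt1 !mulNr mulrN normrN ger0_norm; last first.
  by rewrite mulr_ge0 ?(ltW p0)// divr_ge0 ?exprn_ge0 ?(ltW d0)// mulr_ge0//; have := N1; have := e0; lra.
have -> : p * (N * (N + e + 2 * p) / ((e + p) * (N + p)) ^+ 2) =
   wgt p * ((p * (N + e + 2 * p)) / ((e + p) * (N + p))).
  rewrite /wgt; move: (gt_eqF d0); move/negbT; rewrite mulf_eq0 negb_or => /andP[? ?].
  by field; apply/andP.
rewrite mulrC ler_wpM2r// ler_pdivrMr//.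
have := N1; have := e0 => h1 h2; have : 0 <= p * e by rewrite mulr_ge0// ltW.
have : 0 <= e * N by rewrite mulr_ge0//; lra.
have : 0 <= p * N by rewrite mulr_ge0 ?(ltW p0)//; lra.
nra.
Qed.

Lemma measurable_wgt : measurable_fun setT (fun y : RR R => wgt (enorm y ^+ 2)).
Proof. by rewrite /wgt; mfun. Qed.

Lemma measurable_wgt1 : measurable_fun setT (fun y : RR R => wgt1 (enorm y ^+ 2)).
Proof. by rewrite /wgt1; mfun. Qed.

End weights.

Section weight_bounds.
Context {R : realType}.
Variables (N : R) (y : RR R).
Hypotheses (N1 : 1 <= N) (r0 : 0 < enorm y).
Let r := enorm y.

Let N0 : 0 < N. Proof. exact: lt_le_trans ltr01 N1. Qed.
Let s0 : 0 < r ^+ 2. Proof. by rewrite exprn_gt0. Qed.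
Let Ns : 0 < N + r ^+ 2. Proof. exact: addr_gt0. Qed.
Let s1 : 0 < 1 + r ^+ 2. Proof. exact: addr_gt0. Qed.

Let inv_kk (a d : R) : 0 < d -> a * (r * (1 + r ^+ 2)) <= d -> N * a / d <= N * kk y.
Proof.
move=> d0 h; rewrite -mulrA ler_pM2l// /kk -/r ler_pdivrMr// mulrC ler_pdivlMr//.
by rewrite mulr_gt0.
Qed.

Let Ns1 : 1 + r ^+ 2 <= N + r ^+ 2. Proof. by rewrite lerD2r. Qed.

Lemma wgt0_kk : wgt N 0 (r ^+ 2) * r <= N * kk y.
Proof.
have -> : wgt N 0 (r ^+ 2) * r = N * r / ((0 + r ^+ 2) * (N + r ^+ 2)) by rewrite /wgt; ring.
by apply: inv_kk; rewrite add0r ?mulr_gt0// mulrA -expr2 ler_wpM2l// ltW.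
Qed.

Lemma wgt1_kk : wgt N 1 (r ^+ 2) <= N * kk y.
Proof.
have -> : wgt N 1 (r ^+ 2) = N * 1 / ((1 + r ^+ 2) * (N + r ^+ 2)) by rewrite /wgt; ring.
apply: inv_kk; rewrite ?mulr_gt0// mul1r mulrC ler_wpM2l ?(ltW s1)//.
by apply: le_trans Ns1; have := sqr_ge0 (r - 1); have : 0 < r by []; nra.
Qed.

Lemma wgt1_kkr : wgt N 1 (r ^+ 2) * r <= N * kk y.
Proof.
have -> : wgt N 1 (r ^+ 2) * r = N * r / ((1 + r ^+ 2) * (N + r ^+ 2)) by rewrite /wgt; ring.
apply: inv_kk; rewrite ?mulr_gt0// mulrA mulrC ler_wpM2l ?(ltW s1)//.
by apply: le_trans Ns1; lra.
Qed.

(** Unlike the three bounds before it, this one is free of [N]; the estimate of the velocity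
    survives the limit because of it. *)
Lemma wgt1_kk_unif : wgt N 1 (r ^+ 2) <= kk y * r.
Proof.
have -> : kk y * r = 1 / (1 + r ^+ 2).
  by rewrite /kk -/r invfM mulrAC mulVf// gt_eqF.
rewrite /wgt ler_pdivrMr ?mulr_gt0// mulrA mul1r mulVf ?gt_eqF// mul1r.
by rewrite lerDl ltW.
Qed.

End weight_bounds.
Section lines.
Context {R : realType}.
Implicit Types (K : R) (w : RR R -> R).

Lemma hoelder_continuous (u : R -> R) (C : R) : 0 <= C ->
  (forall s t, (u s - u t) ^+ 2 <= `|s - t| * C) -> continuous u.
Proof.
move=> C0 h s; apply/cvgrPdist_lt => e e0; near=> t.
rewrite -ltr_sqr ?nnegrE ?(ltW e0)// real_normK ?num_real//.
apply: le_lt_trans (h _ _) _; apply: le_lt_trans (_ : `|s - t| * (C + 1) < _).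
  by rewrite ler_wpM2l// lerDl.
rewrite -ltr_pdivlMr ?ltr_wpDl//.
near: t; exists (e ^+ 2 / (C + 1)) => //=.
by rewrite divr_gt0 ?exprn_gt0// ltr_wpDl.
Unshelve. all: by end_near. Qed.

Lemma nice_cont1 K w : nice K w -> cont1 w.
Proof.
move=> nw b; apply: (@hoelder_continuous _ (4 * K)) => [|s t].
  by rewrite mulr_ge0// (nice_K nw).
exact: nice_h1 nw _ _ _.
Qed.

Lemma nice_cont2 K w : nice K w -> cont2 w.
Proof.
move=> nw b; apply: (@hoelder_continuous _ (4 * K)) => [|s t].
  by rewrite mulr_ge0// (nice_K nw).
exact: nice_h2 nw _ _ _.
Qed.

Lemma der1_sub w (w1 : RR R -> R) (x : RR R) (b : R) : der1 w w1 ->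
  forall s : R, is_derive s 1 (fun s => w x - w (x - (s, b))) (w1 (x - (s, b))).
Proof.
move=> d s; case: x => a c; under eq_fun do rewrite pairB; rewrite pairB.
have d1 := der1_line (c - b) d (a - s).
have d2 := der_add (der_cst s (w (a, c))) (der_opp (@der_comp _ s (fun s => a - s) _ _ _ d1
  (der_add (der_cst s a) (der_opp (der_id s))))).
by apply: (der_eq d2); ring.
Qed.

Lemma der2_sub w (w2 : RR R -> R) (x : RR R) (b : R) : der2 w w2 ->
  forall s : R, is_derive s 1 (fun s => w x - w (x - (b, s))) (w2 (x - (b, s))).
Proof.
move=> d s; case: x => a c; under eq_fun do rewrite pairB; rewrite pairB.
have d1 := d (a - b, c - s).
have d2 := der_add (der_cst s (w (a, c))) (der_opp (@der_comp _ s (fun s => c - s) _ _ _ d1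
  (der_add (der_cst s c) (der_opp (der_id s))))).
by apply: (der_eq d2); ring.
Qed.

Lemma cont1_sub w (x : RR R) (b : R) : cont1 w -> continuous (fun s : R => w (x - (s, b))).
Proof.
move=> h s; case: x => a c; under eq_fun do rewrite pairB.
have cs : {for s, continuous (fun s : R => a - s)} by apply: ct_add; [exact: ct_cst|apply: ct_opp; exact: ct_id].
exact: (@continuous_comp _ _ _ (fun s : R => a - s) (fun s => w (s, c - b)) s cs (h _ _)).
Qed.

Lemma cont2_sub w (x : RR R) (b : R) : cont2 w -> continuous (fun s : R => w (x - (b, s))).
Proof.
move=> h s; case: x => a c; under eq_fun do rewrite pairB.
have cs : {for s, continuous (fun s : R => c - s)} by apply: ct_add; [exact: ct_cst|apply: ct_opp; exact: ct_id].
exact: (@continuous_comp _ _ _ (fun s : R => c - s) (fun s => w (a - b, s)) s cs (h _ _)).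
Qed.

End lines.

(** * Two divergences in y at a fixed point x *)

Section at_point.
Context {R : realType}.
Variables (K : R) (g g1 g2 : RR R -> R).
Hypotheses (ng : nice K g) (n1 : nice K g1) (n2 : nice K g2).
Hypotheses (d1 : der1 g g1) (d2 : der2 g g2).
Variables (N : R) (N1 : 1 <= N).
Variable x : RR R.
Let L := bnd K.
Let L1 : 1 <= L := bnd_ge1 ng.
Let L0 : 0 <= L. Proof. exact: le_trans ler01 L1. Qed.
Let N0 : 0 <= N. Proof. exact: le_trans ler01 N1. Qed.

Definition ratio y := dl g x y / SS g x y.
(* [ratio_ c d] and [gap_ c d] are partial derivatives of [ratio] and [gap]: [d] is
   the coordinate of [y] and [c] the partial derivative of [dl g x]. *)
Definition ratio_ (c d : R) y := (c * enorm y ^+ 2 - dl g x y * d) / SS g x y ^+ 3.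
Definition gap y := SS g x y - enorm y.
Definition gap_ (c d : R) y := (d + dl g x y * c) / SS g x y - d / enorm y.

Let mg : measurable_fun setT g := nice_m ng.
Let mg1 : measurable_fun setT g1 := nice_m n1.
Let mg2 : measurable_fun setT g2 := nice_m n2.

Let mdl : measurable_fun setT (dl g x).
Proof. by rewrite /dl; mfun. Qed.
Let mSS : measurable_fun setT (SS g x).
Proof. by rewrite /SS; mfun. Qed.
Let mr : measurable_fun setT ratio. Proof. by rewrite /ratio; mfun. Qed.
Let mr1 : measurable_fun setT (fun y : RR R => ratio_ (g1 (x - y)) y.1 y). Proof. by rewrite /ratio_; mfun. Qed.
Let mr2 : measurable_fun setT (fun y : RR R => ratio_ (g2 (x - y)) y.2 y). Proof. by rewrite /ratio_; mfun. Qed.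
Let mp : measurable_fun setT gap. Proof. by rewrite /gap; mfun. Qed.
Let mp1 : measurable_fun setT (fun y : RR R => gap_ (g1 (x - y)) y.1 y). Proof. by rewrite /gap_; mfun. Qed.
Let mp2 : measurable_fun setT (fun y : RR R => gap_ (g2 (x - y)) y.2 y). Proof. by rewrite /gap_; mfun. Qed.

Lemma ratio_le1 y : `|ratio y| <= 1.
Proof.
rewrite /ratio normrM normfV (ger0_norm (SS_ge0 _ _ _)).
have [->|S0] := eqVneq (SS g x y) 0; first by rewrite invr0 mulr0.
by rewrite ler_pdivrMr ?lt_neqAle ?SS_ge0 ?andbT 1?eq_sym// mul1r SS_dl.
Qed.

Lemma ratio_le y : 0 < enorm y -> `|ratio y| <= `|dl g x y| / enorm y.
Proof.
move=> r0; rewrite /ratio normrM normfV (ger0_norm (SS_ge0 _ _ _)) ler_wpM2l//.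
by rewrite lef_pV2 ?posrE ?SS_gt0// SS_enorm.
Qed.

Lemma ratio1_le c d y : 0 < enorm y -> `|c| <= L -> `|d| <= enorm y ->
  `|ratio_ c d y| <= 3 * L / enorm y.
Proof.
move=> r0 cL dr; rewrite /ratio_ normrM normfV.
rewrite [X in _ / X]ger0_norm ?exprn_ge0 ?SS_ge0//.
apply: (@le_trans _ _ (3 * L * enorm y ^+ 2 / enorm y ^+ 3)); last first.
  by rewrite le_eqVlt; apply/orP; left; apply/eqP; field; rewrite gt_eqF.
apply: ler_pM => //; rewrite ?invr_ge0 ?exprn_ge0 ?SS_ge0 ?SS3_inv//.
apply: le_trans (ler_normB _ _) _; rewrite (normrM c) (normrM (dl g x y)) (ger0_norm (sqr_ge0 _)).
have h1 : `|c| * enorm y ^+ 2 <= L * enorm y ^+ 2 by rewrite ler_wpM2r ?sqr_ge0.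
have h2 : `|dl g x y| * `|d| <= (2 * L * enorm y) * enorm y.
  by apply: ler_pM => //; exact: dl_lip ng n1 n2 d1 d2 x y.
by rewrite expr2 in h1 *; lra.
Qed.

Lemma gap_ge0 y : 0 <= gap y. Proof. by rewrite subr_ge0 SS_enorm. Qed.

Lemma gap1_le c d y : 0 < enorm y -> `|c| <= L -> `|d| <= enorm y ->
  `|gap_ c d y| <= 2 * L * `|dl g x y| / enorm y.
Proof.
move=> r0 cL dr; have S0 := SS_gt0 g x r0.
(* The two terms of [gap_] are only bounded separately; combined they exhibit a factor that is small
   with [dl]. *)
have -> : gap_ c d y = (dl g x y * c - d / enorm y * gap y) / SS g x y.
  by rewrite /gap_ /gap; field; rewrite !gt_eqF.
rewrite normrM normfV (ger0_norm (SS_ge0 _ _ _)).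
apply: ler_pM => //; rewrite ?invr_ge0 ?SS_ge0//; last by rewrite lef_pV2 ?posrE// SS_enorm.
apply: le_trans (ler_normB _ _) _; rewrite !normrM normfV (ger0_norm (gap_ge0 y)).
have h1 : `|dl g x y| * `|c| <= `|dl g x y| * L by rewrite ler_wpM2l.
have h2 : `|d| / `|enorm y| * gap y <= 1 * `|dl g x y|.
  apply: ler_pM; rewrite ?mulr_ge0 ?invr_ge0 ?gap_ge0 ?SS_dist//.
  by rewrite (ger0_norm (enorm_ge0 y)) ler_pdivrMr// mul1r.
have := normr_ge0 (dl g x y); have : `|dl g x y| * 1 <= `|dl g x y| * L by rewrite ler_wpM2l.
by lra.
Qed.

Let SSE1 (s b : R) : SS g x (s, b) = Num.sqrt (s ^+ 2 + b ^+ 2 + dl g x (s, b) ^+ 2).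
Proof. by rewrite /SS enorm_sqr. Qed.
Let SSE2 (s b : R) : SS g x (b, s) = Num.sqrt (s ^+ 2 + b ^+ 2 + dl g x (b, s) ^+ 2).
Proof. by rewrite /SS enorm_sqr addrC [b ^+ 2 + _]addrC addrC. Qed.
Let nE1 (s b : R) : enorm (s, b) = Num.sqrt (s ^+ 2 + b ^+ 2). Proof. by []. Qed.
Let nE2 (s b : R) : enorm (b, s) = Num.sqrt (s ^+ 2 + b ^+ 2). Proof. by rewrite /enorm addrC. Qed.
Let sqE1 (s b : R) : enorm (s, b) ^+ 2 = s ^+ 2 + b ^+ 2. Proof. by rewrite enorm_sqr. Qed.
Let sqE2 (s b : R) : enorm (b, s) ^+ 2 = s ^+ 2 + b ^+ 2. Proof. by rewrite enorm_sqr addrC. Qed.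
Let bb (b : R) : b != 0 -> 0 < b ^+ 2. Proof. by move=> b0; rewrite exprn_even_gt0. Qed.

Let dD1 b (s : R) : is_derive s 1 (fun s => dl g x (s, b)) (g1 (x - (s, b))).
Proof. exact: der1_sub. Qed.
Let dD2 b (s : R) : is_derive s 1 (fun s => dl g x (b, s)) (g2 (x - (b, s))).
Proof. exact: der2_sub. Qed.
Let cD1 b : continuous (fun s : R => g1 (x - (s, b))).
Proof. by apply: cont1_sub; exact: nice_cont1 n1. Qed.
Let cD2 b : continuous (fun s : R => g2 (x - (b, s))).
Proof. by apply: cont2_sub; exact: nice_cont2 n2. Qed.

Let der_ratio1 (s b : R) : b != 0 ->
  is_derive s 1 (fun s => ratio (s, b)) (ratio_ (g1 (x - (s, b))) s (s, b)).
Proof.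
move=> b0; rewrite /ratio /ratio_ sqE1; under eq_fun do rewrite SSE1; rewrite SSE1.
exact: (der_slope_ratio (bb b0) (dD1 b)).
Qed.

Let der_ratio2 (s b : R) : b != 0 ->
  is_derive s 1 (fun s => ratio (b, s)) (ratio_ (g2 (x - (b, s))) s (b, s)).
Proof.
move=> b0; rewrite /ratio /ratio_ sqE2; under eq_fun do rewrite SSE2; rewrite SSE2.
exact: (der_slope_ratio (bb b0) (dD2 b)).
Qed.

Let cont_ratio1 (b : R) : b != 0 -> continuous (fun s : R => ratio_ (g1 (x - (s, b))) s (s, b)).
Proof.
move=> b0; rewrite /ratio_; under eq_fun do rewrite sqE1 SSE1.
move=> s; exact: (@continuous_slope_ratio1 _ (fun s => dl g x (s, b)) (fun s => g1 (x - (s, b))) _ (bb b0) (dD1 b) (cD1 (b := b)) s).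
Qed.

Let cont_ratio2 (b : R) : b != 0 -> continuous (fun s : R => ratio_ (g2 (x - (b, s))) s (b, s)).
Proof.
move=> b0; rewrite /ratio_; under eq_fun do rewrite sqE2 SSE2.
move=> s; exact: (@continuous_slope_ratio1 _ (fun s => dl g x (b, s)) (fun s => g2 (x - (b, s))) _ (bb b0) (dD2 b) (cD2 (b := b)) s).
Qed.

Let der_gap1 (s b : R) : b != 0 ->
  is_derive s 1 (fun s => gap (s, b)) (gap_ (g1 (x - (s, b))) s (s, b)).
Proof.
move=> b0; rewrite /gap /gap_; under eq_fun do rewrite SSE1 nE1; rewrite SSE1 nE1.
exact: (der_root_gap (bb b0) (dD1 b)).
Qed.

Let der_gap2 (s b : R) : b != 0 ->
  is_derive s 1 (fun s => gap (b, s)) (gap_ (g2 (x - (b, s))) s (b, s)).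
Proof.
move=> b0; rewrite /gap /gap_; under eq_fun do rewrite SSE2 nE2; rewrite SSE2 nE2.
exact: (der_root_gap (bb b0) (dD2 b)).
Qed.

Let cont_gap1 (b : R) : b != 0 -> continuous (fun s : R => gap_ (g1 (x - (s, b))) s (s, b)).
Proof.
move=> b0; rewrite /gap_; under eq_fun do rewrite SSE1 nE1.
move=> s; exact: (@continuous_root_gap1 _ (fun s => dl g x (s, b)) (fun s => g1 (x - (s, b))) _ (bb b0) (dD1 b) (cD1 (b := b)) s).
Qed.

Let cont_gap2 (b : R) : b != 0 -> continuous (fun s : R => gap_ (g2 (x - (b, s))) s (b, s)).
Proof.
move=> b0; rewrite /gap_; under eq_fun do rewrite SSE2 nE2.
move=> s; exact: (@continuous_root_gap1 _ (fun s => dl g x (b, s)) (fun s => g2 (x - (b, s))) _ (bb b0) (dD2 b) (cD2 (b := b)) s).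
Qed.

Definition conv_slope y := g1 (x - y) * y.1 + g2 (x - y) * y.2.

(** The divergence in y of the field [wgt N 1 (r^2) * ratio y] times y, using y.grad(d/S) = r^2
    (y.grad g(x-y) - d) / S^3. *)
Definition far_flux y :=
  (2 * wgt N 1 (enorm y ^+ 2) + 2 * (enorm y ^+ 2 * wgt1 N 1 (enorm y ^+ 2))) * ratio y
  + wgt N 1 (enorm y ^+ 2) * (enorm y ^+ 2 * (conv_slope y - dl g x y) / SS g x y ^+ 3).

(** Off the origin, the divergence in y of the field [wgt N 0 (r^2) * gap y] times y. With e = 0 the
    weight times r^2 is the damping factor itself, so the radial derivative reduces to the first
    term, which vanishes as N grows. *)
Definition gap_flux y :=
  - (2 * N / (N + enorm y ^+ 2) ^+ 2 * gap y)
  - N / (N + enorm y ^+ 2) * ((enorm y)^-1 - (SS g x y)^-1)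
  + wgt N 0 (enorm y ^+ 2) * (conv_slope y * ratio y).

Let e1 : 0 <= 1 :> R. Proof. exact: ler01. Qed.

(** Bounds that grow with [N] are enough here: they only ensure integrability for each fixed [N]. *)
Let far_b y : 0 < enorm y ->
  [/\ `|enorm y * wgt N 1 (enorm y ^+ 2) * ratio y| <= 3 * L * N * kk y,
      `|wgt N 1 (enorm y ^+ 2) * ratio y| <= 3 * L * N * kk y,
      `|enorm y ^+ 2 * wgt1 N 1 (enorm y ^+ 2) * ratio y| <= 3 * L * N * kk y,
      `|enorm y * wgt N 1 (enorm y ^+ 2) * ratio_ (g1 (x - y)) y.1 y| <= 3 * L * N * kk y &
      `|enorm y * wgt N 1 (enorm y ^+ 2) * ratio_ (g2 (x - y)) y.2 y| <= 3 * L * N * kk y].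
Proof.
move=> r0; have p0 : 0 < enorm y ^+ 2 by rewrite exprn_gt0.
have w0 := wgt_ge0 N1 e1 p0; have w1 := wgt1_kk N1 r0; have w2 := wgt1_kkr N1 r0.
have w3 := wgt1_le N1 e1 p0; have q1 := ratio_le1 y; have q0 := normr_ge0 (ratio y).
have k0 : 0 <= N * kk y by rewrite mulr_ge0 ?kk_ge0.
have kL : N * kk y <= L * (N * kk y) by rewrite ler_peMl.
have big c d : `|c| <= L -> `|d| <= enorm y ->
    `|enorm y * wgt N 1 (enorm y ^+ 2) * ratio_ c d y| <= 3 * L * N * kk y.
  move=> cL dr; rewrite normrM normrM (ger0_norm (enorm_ge0 y)) (ger0_norm w0).
  apply: (@le_trans _ _ (enorm y * wgt N 1 (enorm y ^+ 2) * (3 * L / enorm y))).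
    by apply: ler_wpM2l; [rewrite mulr_ge0 ?enorm_ge0|exact: ratio1_le].
  have -> : enorm y * wgt N 1 (enorm y ^+ 2) * (3 * L / enorm y) = 3 * L * wgt N 1 (enorm y ^+ 2).
    by field; rewrite gt_eqF.
  by rewrite -[leRHS]mulrA ler_wpM2l// mulr_ge0.
have small a b : `|a| <= b -> `|a * ratio y| <= b.
  by move=> ab; rewrite normrM; apply: le_trans (_ : b * 1 <= b); [apply: ler_pM|rewrite mulr1].
split.
- apply: small; rewrite normrM (ger0_norm (enorm_ge0 y)) (ger0_norm w0); lra.
- apply: small; rewrite (ger0_norm w0); lra.
- apply: small; apply: le_trans w3 _; lra.
- by apply: big (enorm_fst y); exact: nice_abs n1.
- by apply: big (enorm_snd y); exact: nice_abs n2.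
Qed.

Let mw e : measurable_fun setT (fun y : RR R => wgt N e (enorm y ^+ 2)) := measurable_wgt N e.
Let mw1 e : measurable_fun setT (fun y : RR R => wgt1 N e (enorm y ^+ 2)) := measurable_wgt1 N e.

Let far_divE y : radial_div (wgt N 1) (wgt1 N 1) ratio (fun y => ratio_ (g1 (x - y)) y.1 y)
   (fun y => ratio_ (g2 (x - y)) y.2 y) y = far_flux y.
Proof.
rewrite /radial_div /far_flux; congr (_ + _ * _); rewrite /ratio_ /conv_slope.
rewrite !enorm_sqr; ring.
Qed.

Lemma far_flux_integrable : (leb2 R).-integrable setT (EFin \o far_flux).
Proof.
rewrite -(funext far_divE); apply: (@radial_div_integrable _ _ _ _ _ _ (3 * L * N)) => //;
  by move=> y r0; have [] := far_b r0.
Qed.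

Lemma far_flux_integral : \int[leb2 R]_y far_flux y = 0.
Proof.
rewrite -(funext far_divE); apply: (@radial_div_integral _ _ _ _ _ _ (3 * L * N)) => //.
- exact: der_wgt.
- exact: wgt1_continuous.
- by move=> y r0; have [] := far_b r0.
- by move=> y r0; have [] := far_b r0.
- by move=> y r0; have [] := far_b r0.
- by move=> y r0; have [] := far_b r0.
- by move=> y r0; have [] := far_b r0.
Qed.

Let gap_b y : 0 < enorm y ->
  [/\ `|enorm y * wgt N 0 (enorm y ^+ 2) * gap y| <= 8 * L ^+ 2 * N * kk y,
      `|wgt N 0 (enorm y ^+ 2) * gap y| <= 8 * L ^+ 2 * N * kk y,
      `|enorm y ^+ 2 * wgt1 N 0 (enorm y ^+ 2) * gap y| <= 8 * L ^+ 2 * N * kk y,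
      `|enorm y * wgt N 0 (enorm y ^+ 2) * gap_ (g1 (x - y)) y.1 y| <= 8 * L ^+ 2 * N * kk y &
      `|enorm y * wgt N 0 (enorm y ^+ 2) * gap_ (g2 (x - y)) y.2 y| <= 8 * L ^+ 2 * N * kk y].
Proof.
move=> r0; have p0 : 0 < enorm y ^+ 2 by rewrite exprn_gt0.
have e0 : 0 <= 0 :> R by [].
have w0 := wgt_ge0 N1 e0 p0; have w1 := wgt0_kk N1 r0.
have w3 := wgt1_le N1 e0 p0.
have k0 : 0 <= N * kk y by rewrite mulr_ge0 ?kk_ge0.
have L2 : L <= L ^+ 2 by rewrite expr2 ler_peMl.
have L20 : 0 <= L ^+ 2 by rewrite sqr_ge0.
have dlr := dl_lip ng n1 n2 d1 d2 x y; have dlb := dl_bnd ng x y.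
rewrite -/L in dlr dlb.
have g0 := gap_ge0 y.
have g1' : gap y <= 2 * L * enorm y by apply: le_trans (SS_dist _ _ _) dlr.
have A a b : a <= b * enorm y -> wgt N 0 (enorm y ^+ 2) * a <= wgt N 0 (enorm y ^+ 2) * enorm y * b.
  by move=> h; rewrite -mulrA ler_wpM2l// mulrC.
have kl (c : R) : 0 <= c -> c <= 8 * L ^+ 2 ->
    wgt N 0 (enorm y ^+ 2) * enorm y * c <= 8 * L ^+ 2 * N * kk y.
  move=> c0 cL; apply: (@le_trans _ _ (N * kk y * (8 * L ^+ 2))); last by rewrite le_eqVlt; apply/orP; left; apply/eqP; ring.
  by apply: ler_pM => //; rewrite mulr_ge0// enorm_ge0.
have big c d : `|c| <= L -> `|d| <= enorm y ->
    `|enorm y * wgt N 0 (enorm y ^+ 2) * gap_ c d y| <= 8 * L ^+ 2 * N * kk y.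
  move=> cL dr; rewrite normrM normrM (ger0_norm (enorm_ge0 y)) (ger0_norm w0).
  apply: (@le_trans _ _ (enorm y * wgt N 0 (enorm y ^+ 2) * (2 * L * `|dl g x y| / enorm y))).
    by apply: ler_wpM2l; [rewrite mulr_ge0 ?enorm_ge0|exact: gap1_le].
  have -> : enorm y * wgt N 0 (enorm y ^+ 2) * (2 * L * `|dl g x y| / enorm y) =
    wgt N 0 (enorm y ^+ 2) * (2 * L * `|dl g x y|) by field; rewrite gt_eqF.
  apply: le_trans (kl (2 * L * (2 * L)) _ _); rewrite ?mulr_ge0//; last by rewrite expr2 in L20 *; lra.
  by apply: A; rewrite -[leRHS]mulrA ler_wpM2l// mulr_ge0.
split.
- rewrite ger0_norm; last by apply: mulr_ge0 => //; apply: mulr_ge0 => //; exact: enorm_ge0.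
  rewrite [X in X * gap y]mulrC -[leLHS]mulrA.
  apply: le_trans (kl (2 * L ^+ 2) _ _); rewrite ?mulr_ge0//; last lra.
  apply: A; rewrite mulrC; apply: le_trans (_ : dl g x y ^+ 2 / (2 * enorm y) * enorm y <= _).
    by rewrite ler_wpM2r ?enorm_ge0// SS_dist2.
  have -> : dl g x y ^+ 2 / (2 * enorm y) * enorm y = dl g x y ^+ 2 / 2 by field; rewrite gt_eqF.
  rewrite -(real_normK (num_real (dl g x y))) ler_pdivrMr//.
  have h : `|dl g x y| * `|dl g x y| <= (2 * L) * (2 * L * enorm y) by apply: ler_pM.
  by rewrite !expr2; lra.
- rewrite ger0_norm; last exact: mulr_ge0.
  apply: le_trans (kl (2 * L) _ _); rewrite ?mulr_ge0//; [exact: A|lra].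
- rewrite normrM (ger0_norm g0); apply: (@le_trans _ _ (2 * wgt N 0 (enorm y ^+ 2) * gap y)).
    by rewrite ler_wpM2r.
  have -> : 2 * wgt N 0 (enorm y ^+ 2) * gap y = wgt N 0 (enorm y ^+ 2) * (2 * gap y) by ring.
  by apply: le_trans (kl (4 * L) _ _); rewrite ?mulr_ge0//; [apply: A; lra|lra].
- by apply: big (enorm_fst y); exact: nice_abs n1.
- by apply: big (enorm_snd y); exact: nice_abs n2.
Qed.

Let gap_divE y : 0 < enorm y ->
  radial_div (wgt N 0) (wgt1 N 0) gap (fun y => gap_ (g1 (x - y)) y.1 y)
   (fun y => gap_ (g2 (x - y)) y.2 y) y = gap_flux y.
Proof.
move=> r0; have S0 := SS_gt0 g x r0.
have Ns : N + enorm y ^+ 2 != 0 by rewrite gt_eqF// ltr_wpDl// exprn_gt0.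
rewrite /radial_div /gap_flux.
have -> : y.1 * gap_ (g1 (x - y)) y.1 y + y.2 * gap_ (g2 (x - y)) y.2 y =
   conv_slope y * ratio y - enorm y ^+ 2 * ((enorm y)^-1 - (SS g x y)^-1).
  by rewrite /gap_ /conv_slope /ratio enorm_sqr; ring.
rewrite /wgt /wgt1; field; rewrite Ns !gt_eqF//.
Qed.

Let mgd : measurable_fun setT (radial_div (wgt N 0) (wgt1 N 0) gap (fun y => gap_ (g1 (x - y)) y.1 y)
   (fun y => gap_ (g2 (x - y)) y.2 y)).
Proof. by have := mw 0 => ?; have := mw1 0 => ?; rewrite /radial_div; mfun. Qed.

Lemma measurable_conv_slope : measurable_fun setT conv_slope.
Proof. by rewrite /conv_slope; mfun. Qed.

Lemma measurable_gap_flux : measurable_fun setT gap_flux.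
Proof. by have := mw 0 => ?; have := measurable_conv_slope => ?; rewrite /gap_flux; mfun. Qed.

Let e0 : 0 <= 0 :> R. Proof. by []. Qed.

Lemma gap_flux_integrable : (leb2 R).-integrable setT (EFin \o gap_flux).
Proof.
have i : (leb2 R).-integrable setT (EFin \o radial_div (wgt N 0) (wgt1 N 0) gap (fun y => gap_ (g1 (x - y)) y.1 y)
   (fun y => gap_ (g2 (x - y)) y.2 y)).
  apply: (@radial_div_integrable _ _ _ _ _ _ (8 * L ^+ 2 * N)) => //;
  by move=> y r0; have [] := gap_b r0.
have i' := integrable_abse i.
apply: (@integrable_off0 _ _ (fun y => `|radial_div (wgt N 0) (wgt1 N 0) gap (fun y => gap_ (g1 (x - y)) y.1 y)
   (fun y => gap_ (g2 (x - y)) y.2 y) y|)) => //; first exact: measurable_gap_flux.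
by move=> y r0; rewrite gap_divE.
Qed.

Lemma gap_flux_integral : \int[leb2 R]_y gap_flux y = 0.
Proof.
rewrite -(eq_integral_off0 mgd measurable_gap_flux gap_divE).
apply: (@radial_div_integral _ _ _ _ _ _ (8 * L ^+ 2 * N)) => //.
- exact: der_wgt.
- exact: wgt1_continuous.
- by move=> y r0; have [] := gap_b r0.
- by move=> y r0; have [] := gap_b r0.
- by move=> y r0; have [] := gap_b r0.
- by move=> y r0; have [] := gap_b r0.
- by move=> y r0; have [] := gap_b r0.
Qed.

End at_point.

(** * The velocity *)

Lemma cvg_le_ecst {R : realType} (u : nat -> R) (l : R) (c : \bar R) :
  u @ \oo --> l -> (forall n, ((u n)%:E <= c)%E) -> (l%:E <= c)%E.
Proof.
case: c => [c| |] ul uc; last by have := uc 0%N.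
  by rewrite lee_fin; apply: (cvg_le_cst ul) => n; rewrite -lee_fin.
exact: leey.
Qed.

Section regular_kernel.
Context {R : realType}.
Variables (K : R) (g g1 g2 : RR R -> R).
Hypotheses (ng : nice K g) (n1 : nice K g1) (n2 : nice K g2).
Hypotheses (d1 : der1 g g1) (d2 : der2 g g2).
Let L := bnd K.
Let L1 : 1 <= L := bnd_ge1 ng.
Let L0 : 0 <= L. Proof. exact: le_trans ler01 L1. Qed.
Let mg : measurable_fun setT g := nice_m ng.
Let mg1 : measurable_fun setT g1 := nice_m n1.
Let mg2 : measurable_fun setT g2 := nice_m n2.

Definition tangent (x y : RR R) := g1 x * y.1 + g2 x * y.2.

(** The kernel linearised at infinity, where it is of order 1/r^2 and so not integrable. The factor
    r^2/(1 + r^2) keeps it bounded near the origin, where [ker] is already integrable. *)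
Definition odd_part (x y : RR R) :=
  enorm y ^+ 2 / (1 + enorm y ^+ 2) * (tangent x y / enorm y ^+ 3).

Definition reg (x y : RR R) := ker g g1 g2 x y - odd_part x y.

(* The principal value only sees the part of the kernel left after an odd
   function of [y] is removed; that part is absolutely integrable. *)
Definition velocity (x : RR R) := \int[leb2 R]_y reg x y.

Let mker : measurable_fun setT (fun z : RR R * RR R => ker g g1 g2 z.1 z.2).
Proof. exact: measurable_ker ng n1 n2. Qed.

Lemma measurable_reg : measurable_fun setT (fun z : RR R * RR R => reg z.1 z.2).
Proof. by rewrite /reg /odd_part /tangent; mfun. Qed.

Lemma measurable_velocity : measurable_fun setT velocity.
Proof. exact: (measurable_param measurable_reg). Qed.

Lemma integral_reflect (x : RR R) (f : RR R -> \bar R) : measurable_fun setT f ->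
  (\int[leb2 R]_y f (x - y)%R = \int[leb2 R]_y f y)%E.
Proof.
move=> mf; rewrite -(integral_leb2_shift (- x) mf).
have mh : measurable_fun setT (fun y : RR R => f (y - - x)) by mfun.
by rewrite -(integral_leb2_opp mh); apply: eq_integral => y _; rewrite opprK addrC.
Qed.

Lemma integrable_reflect_sqr (x : RR R) (w : RR R -> R) : nice K w ->
  (leb2 R).-integrable setT (EFin \o (fun y => w (x - y) ^+ 2)).
Proof.
move=> nw; have mw := nice_m nw.
apply/integrableP; split; first by mfun.
have mf : measurable_fun setT (fun y : RR R => (w y ^+ 2)%:E) by mfun.
rewrite (eq_integral (fun y : RR R => (w (x - y) ^+ 2)%:E)); last first.
  by move=> y _; rewrite /= ger0_norm ?sqr_ge0.
rewrite (integral_reflect x mf); apply: le_lt_trans (nice_sqn nw) _; exact: ltry.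
Qed.

Section at_x.
Variable x : RR R.

Let mkx : measurable_fun setT (ker g g1 g2 x).
Proof.
have h : measurable_fun setT (fun y : RR R => (x, y)) by mfun.
exact: (mfun_comp mker h).
Qed.

Let mox : measurable_fun setT (odd_part x). Proof. by rewrite /odd_part /tangent; mfun. Qed.
Let mrx : measurable_fun setT (reg x). Proof. by rewrite /reg; mfun. Qed.

Lemma tangent_le y : `|tangent x y| <= slope g1 g2 x * enorm y.
Proof. exact: dot_le. Qed.

Lemma conv_slope_le y : `|conv_slope g1 g2 x y| <= slope g1 g2 (x - y) * enorm y.
Proof. exact: dot_le. Qed.

Lemma kerE y : ker g g1 g2 x y = (tangent x y - conv_slope g1 g2 x y) / SS g x y ^+ 3.
Proof. by rewrite /ker /tangent /conv_slope; congr (_ / _); ring. Qed.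

Let th (y : RR R) := enorm y ^+ 2 / (1 + enorm y ^+ 2).

Let s1 (y : RR R) : 0 < 1 + enorm y ^+ 2. Proof. by rewrite ltr_pwDl// sqr_ge0. Qed.

Lemma kkE (y : RR R) : 0 < enorm y -> kk y * enorm y = (1 + enorm y ^+ 2)^-1.
Proof. by move=> r0; rewrite /kk invfM mulrAC mulVf ?mul1r// gt_eqF. Qed.

Lemma sqrt_inv (r : R) : 0 < r -> Num.sqrt r / r = (Num.sqrt r)^-1.
Proof.
move=> r0; have q0 : Num.sqrt r != 0 by rewrite gt_eqF// sqrtr_gt0.
by rewrite -{2}(sqr_sqrtr (ltW r0)); field.
Qed.

Lemma khE (y : RR R) : kh y = kk y + kk y * (Num.sqrt (enorm y))^-1.
Proof. by rewrite /kh mulrDr mulr1. Qed.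

Lemma kk_jump y : 0 < enorm y -> kk y * (jump g1 g2 x y / enorm y) <= 2 * L * kh y.
Proof.
move=> r0; rewrite khE.
have h : jump g1 g2 x y / enorm y <= 2 * L * (Num.sqrt (enorm y))^-1.
  rewrite -sqrt_inv// mulrA ler_wpM2r ?invr_ge0 ?enorm_ge0//.
  exact: jump_half n1 n2 x y.
apply: (@le_trans _ _ (kk y * (2 * L * (Num.sqrt (enorm y))^-1))).
  by rewrite ler_wpM2l ?kk_ge0.
have : 0 <= 2 * L * kk y by rewrite !mulr_ge0 ?kk_ge0.
by rewrite mulrDr; lra.
Qed.

Let reg_le y : 0 < enorm y -> `|reg x y| <=
  (2 * L + 12 * L ^+ 2) * kh y + kk y + 2 * (g1 (x - y) ^+ 2 + g2 (x - y) ^+ 2).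
Proof.
move=> r0; have S0 := SS_gt0 g x r0; have k0 := kk_ge0 y; have kE := kkE r0.
(* With theta = r^2/(1 + r^2): the kernel weighted by 1 - theta, the error of replacing S by r in
   the tangent term, and the term with the gradient at x - y. *)
have E : reg x y = (1 + enorm y ^+ 2)^-1 * ker g g1 g2 x y
    - th y * (tangent x y * ((enorm y ^+ 3)^-1 - (SS g x y ^+ 3)^-1))
    - th y * (conv_slope g1 g2 x y / SS g x y ^+ 3).
  by rewrite /reg /odd_part /th kerE; field; rewrite !gt_eqF.
have t0 : 0 <= th y by rewrite divr_ge0 ?sqr_ge0// ltW.
have tE : th y = kk y * enorm y * enorm y ^+ 2 by rewrite kE mulrC.
have b1 : `|(1 + enorm y ^+ 2)^-1 * ker g g1 g2 x y| <= 2 * L * kh y.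
  apply: le_trans (kk_jump r0); rewrite normrM ger0_norm ?invr_ge0 ?(ltW (s1 y))// -kE.
  apply: le_trans (ler_wpM2l _ (ker_le g g1 g2 x r0)) _; first by rewrite mulr_ge0// ltW.
  by rewrite le_eqVlt; apply/orP; left; apply/eqP; field; rewrite gt_eqF.
have b2 : `|th y * (tangent x y * ((enorm y ^+ 3)^-1 - (SS g x y ^+ 3)^-1))| <= 12 * L ^+ 2 * kh y.
  rewrite normrM ger0_norm// normrM.
  apply: (@le_trans _ _ (th y * ((2 * L * enorm y) * (3 * (2 * L) / enorm y ^+ 4)))).
    apply: ler_wpM2l => //; apply: ler_pM => //.
      apply: le_trans (tangent_le y) _; rewrite ler_wpM2r ?enorm_ge0//; exact: slope_bnd n1 n2 x.
    apply: le_trans (inv3_dist g x r0) _; rewrite ler_wpM2r ?invr_ge0 ?exprn_ge0 ?enorm_ge0//.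
    by rewrite ler_wpM2l//; exact: dl_bnd ng x y.
  rewrite tE; have -> : kk y * enorm y * enorm y ^+ 2 * (2 * L * enorm y * (3 * (2 * L) / enorm y ^+ 4)) = 12 * L ^+ 2 * kk y.
    by field; rewrite gt_eqF.
  by rewrite ler_wpM2l ?mulr_ge0 ?sqr_ge0 ?kk_le_kh.
(* This term is a product of two square-integrable functions of y, the gradient at x - y and (1 +
   r^2)^(-1), and is split by the inequality between the means. *)
have b3 : `|th y * (conv_slope g1 g2 x y / SS g x y ^+ 3)| <= kk y + 2 * (g1 (x - y) ^+ 2 + g2 (x - y) ^+ 2).
  rewrite normrM ger0_norm// normrM normfV (ger0_norm (exprn_ge0 _ (SS_ge0 _ _ _))).
  apply: (@le_trans _ _ (th y * (slope g1 g2 (x - y) * enorm y / enorm y ^+ 3))).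
    apply: ler_wpM2l => //; apply: ler_pM; rewrite ?invr_ge0 ?exprn_ge0 ?SS_ge0 ?conv_slope_le//.
    exact: SS3_inv.
  rewrite tE; have -> : kk y * enorm y * enorm y ^+ 2 * (slope g1 g2 (x - y) * enorm y / enorm y ^+ 3) =
     slope g1 g2 (x - y) * (kk y * enorm y) by field; rewrite gt_eqF.
  rewrite kE; set q := (1 + enorm y ^+ 2)^-1.
  have q2 : q ^+ 2 <= kk y.
    have -> : q ^+ 2 = ((1 + enorm y ^+ 2) ^+ 2)^-1 by rewrite /q exprVn.
    rewrite /kk lef_pV2 ?posrE ?exprn_gt0 ?mulr_gt0// expr2 ler_wpM2r ?(ltW (s1 y))//.
    by have := sqr_ge0 (enorm y - 1); have := sqr_ge0 (enorm y); nra.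
  rewrite /slope -(real_normK (num_real (g1 _))) -(real_normK (num_real (g2 _))).
  set a := `|_|; set b := `|_|.
  by have := sqr_ge0 (a + b - q); have := sqr_ge0 (a - b); have := sqr_ge0 (a + b); nra.
rewrite E; apply: le_trans (ler_normB _ _) _.
have := ler_normB ((1 + enorm y ^+ 2)^-1 * ker g g1 g2 x y)
  (th y * (tangent x y * ((enorm y ^+ 3)^-1 - (SS g x y ^+ 3)^-1))).
by lra.
Qed.

Lemma reg_integrable : (leb2 R).-integrable setT (EFin \o reg x).
Proof.
have i1 := integrable_plus (integrable_reflect_sqr x n1) (integrable_reflect_sqr x n2).
have i2 := integrable_scale (2 * L + 12 * L ^+ 2) (@integrable_kh R).
have i3 := integrable_plus (integrable_plus i2 (@integrable_kk R)) (integrable_scale 2 i1).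
exact: (integrable_off0 mrx i3 reg_le).
Qed.

(** An even weight keeps [odd_part] odd, and its weighted integral exists as a difference of two
    integrable functions, so it vanishes. This applies both to the damping and to indicators of
    annuli. *)
Lemma weighted_ker (w : RR R -> R) : measurable_fun setT w ->
  (forall y, w (- y) = w y) -> (forall y, 0 <= w y <= 1) ->
  (leb2 R).-integrable setT (EFin \o (fun y => w y * ker g g1 g2 x y)) ->
  \int[leb2 R]_y (w y * ker g g1 g2 x y) = \int[leb2 R]_y (w y * reg x y).
Proof.
move=> mw ew w01 iw.
have ir : (leb2 R).-integrable setT (EFin \o (fun y => w y * reg x y)).
  apply: (@integrable_le _ _ _ _ _ (fun y => `|reg x y|)) => //; first by mfun.
    exact: (integrable_abse reg_integrable).
  move=> y _; have /andP[w0 w1] := w01 y; rewrite normrM (ger0_norm w0).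
  by rewrite -[leRHS]mul1r ler_wpM2r.
apply/eqP; rewrite -subr_eq0 -RintegralB//; apply/eqP.
apply: odd_integral; first exact: (integrable_minus iw ir).
move=> y; have ro : odd_part x (- y) = - odd_part x y.
  by rewrite /odd_part /tangent enormN /=; ring.
by rewrite ew /reg ro; ring.
Qed.

Definition chi (N : R) (y : RR R) := N / (N + enorm y ^+ 2).

Section weight.
Variables (N : R) (N1 : 1 <= N).
Let N0 : 0 < N. Proof. exact: lt_le_trans ltr01 N1. Qed.
Let Ns (y : RR R) : 0 < N + enorm y ^+ 2. Proof. by rewrite ltr_pwDl// sqr_ge0. Qed.

Lemma chi01 y : 0 <= chi N y <= 1.
Proof. by rewrite divr_ge0 ?(ltW N0) ?(ltW (Ns y))//= ler_pdivrMr// mul1r lerDl sqr_ge0. Qed.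

Lemma measurable_chi : measurable_fun setT (chi N).
Proof. by rewrite /chi; mfun. Qed.

Lemma chi_kk y : 0 < enorm y -> chi N y <= N * (kk y * enorm y).
Proof.
by move=> r0; rewrite kkE// /chi ler_pM2l// lef_pV2 ?posrE// lerD2r.
Qed.

Lemma chi_ker_le y : 0 < enorm y -> `|chi N y * ker g g1 g2 x y| <= N * (2 * L) * kh y.
Proof.
move=> r0; have /andP[c0 c1] := chi01 y; rewrite normrM (ger0_norm c0).
apply: (@le_trans _ _ (N * (kk y * enorm y) * (jump g1 g2 x y / enorm y ^+ 2))).
  by apply: ler_pM; rewrite ?chi_kk ?ker_le.
have -> : N * (kk y * enorm y) * (jump g1 g2 x y / enorm y ^+ 2) = N * (kk y * (jump g1 g2 x y / enorm y)).
  by field; rewrite gt_eqF.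
by rewrite -[leRHS]mulrA ler_wpM2l ?(ltW N0)// kk_jump.
Qed.

Lemma chi_ker_integrable : (leb2 R).-integrable setT (EFin \o (fun y => chi N y * ker g g1 g2 x y)).
Proof.
have mc := measurable_chi; apply: (integrable_off0 _ _ chi_ker_le); first by mfun.
by apply: integrable_scale; exact: integrable_kh.
Qed.

Lemma chi_ker_integral : \int[leb2 R]_y (chi N y * ker g g1 g2 x y) = \int[leb2 R]_y (chi N y * reg x y).
Proof.
apply: weighted_ker chi_ker_integrable; first exact: measurable_chi.
- by move=> y; rewrite /chi enormN.
- exact: chi01.
Qed.

(** Each summand is, for fixed y, bounded in L^2 in x independently of y; the weight [kk] then
    allows integration over y. *)
Definition majorant y := jump g1 g2 x y / enorm y + 6 * L * slope g1 g2 x + 3 * `|dl g x y|.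

Lemma majorant_ge0 y : 0 <= majorant y.
Proof. by rewrite !addr_ge0 ?mulr_ge0 ?invr_ge0 ?enorm_ge0 ?jump_ge0 ?slope_ge0. Qed.

Lemma measurable_majorant : measurable_fun setT majorant.
Proof. by rewrite /majorant /jump /dl; mfun. Qed.

(** Subtracting an odd function and adding a divergence leaves the integral unchanged. The
    divergence cancels the term with the gradient at x - y, for which [reg_le] gives no bound in L^2
    in x. *)
Let rest y := chi N y * ker g g1 g2 x y
  - wgt N 1 (enorm y ^+ 2) * (tangent x y / enorm y) + far_flux g g1 g2 N x y.

Let mw : measurable_fun setT (fun y : RR R => wgt N 1 (enorm y ^+ 2)) := measurable_wgt N 1.

Let side_integrable :
  (leb2 R).-integrable setT (EFin \o (fun y => wgt N 1 (enorm y ^+ 2) * (tangent x y / enorm y))).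
Proof.
apply: (@integrable_off0 _ _ (fun y => slope g1 g2 x * (N * kk y))).
- by rewrite /tangent; mfun.
- by apply: integrable_scale; apply: integrable_scale; exact: integrable_kk.
- move=> y r0; have p0 : 0 < enorm y ^+ 2 by rewrite exprn_gt0.
  have w0 := wgt_ge0 N1 ler01 p0; rewrite normrM (ger0_norm w0) mulrC.
  apply: ler_pM => //; last exact: wgt1_kk.
  rewrite normrM normfV (ger0_norm (enorm_ge0 y)) ler_pdivrMr//; exact: tangent_le.
Qed.

Let rest_le y : 0 < enorm y -> `|rest y| <= kk y * majorant y.
Proof.
move=> r0; have S0 := SS_gt0 g x r0; have p0 : 0 < enorm y ^+ 2 by rewrite exprn_gt0.
have k0 := kk_ge0 y; have w0 := wgt_ge0 N1 ler01 p0; have wk := wgt1_kk_unif N1 r0.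
have q0 := enorm_ge0 y.
have E : rest y = wgt N 1 (enorm y ^+ 2) * ker g g1 g2 x y
   - wgt N 1 (enorm y ^+ 2) * (enorm y ^+ 2 * (tangent x y * ((enorm y ^+ 3)^-1 - (SS g x y ^+ 3)^-1)))
   - wgt N 1 (enorm y ^+ 2) * (enorm y ^+ 2 * (dl g x y / SS g x y ^+ 3))
   + (2 * wgt N 1 (enorm y ^+ 2) + 2 * (enorm y ^+ 2 * wgt1 N 1 (enorm y ^+ 2))) * ratio g x y.
  rewrite /rest /far_flux kerE.
  have -> : chi N y = wgt N 1 (enorm y ^+ 2) * (1 + enorm y ^+ 2).
    by rewrite /chi /wgt; field; rewrite !gt_eqF.
  by move: (wgt N 1 _) (wgt1 N 1 _) (ratio _ _ _) => a b c; field; rewrite !gt_eqF.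
have wr (c : R) : 0 <= c -> wgt N 1 (enorm y ^+ 2) * (c / enorm y) <= kk y * c.
  move=> c0; apply: le_trans (ler_wpM2r _ wk) _; first by rewrite divr_ge0.
  by rewrite le_eqVlt; apply/orP; left; apply/eqP; field; rewrite gt_eqF.
have b1 : `|wgt N 1 (enorm y ^+ 2) * ker g g1 g2 x y| <= kk y * (jump g1 g2 x y / enorm y).
  rewrite normrM (ger0_norm w0); apply: le_trans (wr _ _); last by rewrite divr_ge0 ?jump_ge0.
  rewrite ler_wpM2l//; apply: le_trans (ker_le g g1 g2 x r0) _.
  by rewrite le_eqVlt; apply/orP; left; apply/eqP; field; rewrite gt_eqF.
have b2 : `|wgt N 1 (enorm y ^+ 2) * (enorm y ^+ 2 * (tangent x y * ((enorm y ^+ 3)^-1 - (SS g x y ^+ 3)^-1)))|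
    <= kk y * (6 * L * slope g1 g2 x).
  rewrite normrM (ger0_norm w0).
  apply: le_trans (wr _ _); last by rewrite !mulr_ge0 ?slope_ge0.
  rewrite ler_wpM2l// normrM (ger0_norm (ltW p0)) normrM.
  apply: (@le_trans _ _ (enorm y ^+ 2 * ((slope g1 g2 x * enorm y) * (3 * (2 * L) / enorm y ^+ 4)))).
    apply: ler_wpM2l; first exact: ltW.
    apply: ler_pM => //; first exact: tangent_le.
    apply: le_trans (inv3_dist g x r0) _; rewrite ler_wpM2r ?invr_ge0 ?exprn_ge0//.
    by rewrite ler_wpM2l//; exact: dl_bnd ng x y.
  by rewrite le_eqVlt; apply/orP; left; apply/eqP; field; rewrite gt_eqF.
have b3 : `|wgt N 1 (enorm y ^+ 2) * (enorm y ^+ 2 * (dl g x y / SS g x y ^+ 3))| <= kk y * `|dl g x y|.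
  rewrite normrM (ger0_norm w0); apply: le_trans (wr _ _) => //.
  rewrite ler_wpM2l// normrM (ger0_norm (ltW p0)) normrM normfV (ger0_norm (exprn_ge0 _ (SS_ge0 _ _ _))).
  apply: (@le_trans _ _ (enorm y ^+ 2 * (`|dl g x y| / enorm y ^+ 3))).
    by apply: ler_wpM2l; [exact: ltW|apply: ler_wpM2l => //; exact: SS3_inv].
  by rewrite le_eqVlt; apply/orP; left; apply/eqP; field; rewrite gt_eqF.
have b4 : `|(2 * wgt N 1 (enorm y ^+ 2) + 2 * (enorm y ^+ 2 * wgt1 N 1 (enorm y ^+ 2))) * ratio g x y|
   <= kk y * (2 * `|dl g x y|).
  have c1 := wgt1_le N1 ler01 p0.
  have c2 : enorm y ^+ 2 * wgt1 N 1 (enorm y ^+ 2) <= 0.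
    rewrite pmulr_rle0// /wgt1 mulNr oppr_le0 divr_ge0 ?exprn_even_ge0// mulr_ge0 ?(ltW N0)//.
    by have := N1; lra.
  have c3 : `|2 * wgt N 1 (enorm y ^+ 2) + 2 * (enorm y ^+ 2 * wgt1 N 1 (enorm y ^+ 2))| <= 2 * wgt N 1 (enorm y ^+ 2).
    by move: c1; rewrite ler0_norm// ler_norml => ?; apply/andP; split; lra.
  rewrite normrM; apply: le_trans (ler_pM _ _ c3 (ratio_le g x r0)) _ => //.
  rewrite -mulrA.
  have := wr _ (normr_ge0 (dl g x y)); lra.
rewrite E; apply: le_trans (ler_normD _ _) _.
rewrite /majorant 2!(mulrDr (kk y)) (mulrCA (kk y) 3).
set A := wgt _ _ _ * ker _ _ _ _ _ in b1 *.
set B := wgt _ _ _ * (enorm y ^+ 2 * (tangent _ _ * _)) in b2 *.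
set C := wgt _ _ _ * (enorm y ^+ 2 * (dl _ _ _ / _)) in b3 *.
have := ler_normB (A - B) C; have := ler_normB A B.
by move: b4; rewrite (mulrCA (kk y) 2); lra.
Qed.

Lemma chi_ker_majorant :
  (`|\int[leb2 R]_y (chi N y * ker g g1 g2 x y)|%:E <= \int[leb2 R]_y (kk y * majorant y)%:E)%E.
Proof.
have i1 := chi_ker_integrable; have i2 := side_integrable.
have i3 := far_flux_integrable ng n1 n2 d1 d2 N1 x.
have i4 : (leb2 R).-integrable setT (EFin \o rest).
  by apply: integrable_plus => //; exact: integrable_minus.
have -> : \int[leb2 R]_y (chi N y * ker g g1 g2 x y) = \int[leb2 R]_y rest y.
  rewrite /rest RintegralD//; last exact: integrable_minus.
  rewrite RintegralB// (far_flux_integral ng n1 n2 d1 d2 N1 x).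
  rewrite [X in _ = _ - X + _](odd_integral i2) ?subr0 ?addr0// => y.
  by rewrite /tangent enormN /=; ring.
have mk := @measurable_kk R; have mM := measurable_majorant.
apply: norm_integral_le => //.
- by apply/measurable_EFinP; exact: measurable_int i4.
- by mfun.
- by move=> y; rewrite mulr_ge0 ?kk_ge0 ?majorant_ge0.
Qed.

End weight.

Let natS1 n : 1 <= n.+1%:R :> R. Proof. by rewrite ler1n. Qed.

(** Stated for general weights tending to 1, so that the damping and the annuli of the principal
    value are seen to have the same limit. *)
Lemma dominated_reg (w : nat -> RR R -> R) : (forall n, measurable_fun setT (w n)) ->
  (forall n y, 0 <= w n y <= 1) -> (forall y, 0 < enorm y -> w n y @[n --> \oo] --> (1 : R)) ->
  \int[leb2 R]_y (w n y * reg x y) @[n --> \oo] --> velocity x.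
Proof.
move=> mw w01 w1; have ir := reg_integrable.
have [|||||_ _ H] := @dominated_convergence _ _ _ (leb2 R) setT measurableT
  (fun n => EFin \o (fun y => w n y * reg x y)) (EFin \o reg x) (EFin \o (fun y => `|reg x y|)).
- by move=> n; have := mw n => ?; mfun.
- by mfun.
- apply: ae_enorm_gt0 => y r0 _; apply: cvg_EFin; first by near=> n.
  have h : w n y * reg x y @[n --> \oo] --> (1 * reg x y : R).
    by apply: cvgM; [exact: w1|exact: cvg_cst].
  by rewrite mul1r in h.
- exact: (integrable_abse ir).
- apply/aeW => y n _ /=; rewrite lee_fin; have /andP[w0 w1'] := w01 n y.
  by rewrite normrM (ger0_norm w0) -[leRHS]mul1r ler_wpM2r.
apply: fine_cvg; rewrite fineK//; exact: integrable_fin_num.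
Unshelve. all: by end_near. Qed.

Lemma chi_cvg y : chi n.+1%:R y @[n --> \oo] --> (1 : R).
Proof.
have E n : chi n.+1%:R y = 1 - enorm y ^+ 2 / (n.+1%:R + enorm y ^+ 2).
  by rewrite /chi; field; rewrite gt_eqF// ltr_pwDl// sqr_ge0.
under eq_fun do rewrite E.
suff h0 : enorm y ^+ 2 / (n.+1%:R + enorm y ^+ 2) @[n --> \oo] --> (0 : R).
  have h1 : 1 - enorm y ^+ 2 / (n.+1%:R + enorm y ^+ 2) @[n --> \oo] --> (1 - 0 : R).
    by apply: cvgB => //; exact: cvg_cst.
  by rewrite subr0 in h1.
have h : enorm y ^+ 2 * n.+1%:R^-1 @[n --> \oo] --> (0 : R).
  by rewrite -(mulr0 (enorm y ^+ 2)); apply: cvgM; [exact: cvg_cst|exact: cvg_harmonic].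
apply: (@squeeze_cvgr _ _ _ _ (fun=> 0) (fun n => enorm y ^+ 2 * n.+1%:R^-1)) => //; last exact: cvg_cst.
near=> n; rewrite divr_ge0 ?addr_ge0 ?sqr_ge0//= ler_wpM2l ?sqr_ge0// lef_pV2 ?posrE//.
  by rewrite lerDl sqr_ge0.
by rewrite ltr_pwDl// sqr_ge0.
Unshelve. all: by end_near. Qed.

Lemma chi_ker_cvg : \int[leb2 R]_y (chi n.+1%:R y * ker g g1 g2 x y) @[n --> \oo] --> velocity x.
Proof.
under eq_fun do rewrite (chi_ker_integral (natS1 _)).
apply: dominated_reg => [n|n y|y _]; [exact: measurable_chi|exact: chi01|exact: chi_cvg].
Qed.

Lemma velocity_majorant : (`|velocity x|%:E <= \int[leb2 R]_y (kk y * majorant y)%:E)%E.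
Proof.
by apply: (cvg_le_ecst (cvg_norm chi_ker_cvg)) => n; exact: (chi_ker_majorant (natS1 n)).
Qed.

(** The constant collects 2 L from the jump, 6 L * 2 L from the slope and 3 * 2 L from [dl]. *)
Lemma velocity_bound : (`|velocity x|%:E <= (12 * L ^+ 2 + 8 * L)%:E * \int[leb2 R]_y (kh y)%:E)%E.
Proof.
have mk := @measurable_kk R; have mh := @measurable_kh R; have mM := measurable_majorant.
apply: le_trans velocity_majorant _; rewrite -ge0_integralZl//; last 3 first.
- by mfun.
- by move=> y _; rewrite lee_fin kh_ge0.
- by rewrite lee_fin addr_ge0// ?mulr_ge0// sqr_ge0.
apply: (@le_integral_off0 _ (fun y => kk y * majorant y) (fun y => (12 * L ^+ 2 + 8 * L) * kh y)).
- by mfun.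
- by mfun.
- by move=> y; rewrite mulr_ge0 ?kk_ge0 ?majorant_ge0.
- by move=> y; rewrite mulr_ge0 ?kh_ge0// addr_ge0 ?mulr_ge0 ?sqr_ge0.
move=> y r0; rewrite /majorant 2!(mulrDr (kk y)).
have h1 := kk_jump r0; have k0 := kk_ge0 y; have kh1 := kk_le_kh y.
have h2 : kk y * (6 * L * slope g1 g2 x) <= kh y * (6 * L * (2 * L)).
  by apply: ler_pM => //; [rewrite !mulr_ge0 ?slope_ge0|rewrite ler_wpM2l ?mulr_ge0//; exact: slope_bnd n1 n2 x].
have h3 : kk y * (3 * `|dl g x y|) <= kh y * (3 * (2 * L)).
  by apply: ler_pM => //; rewrite ler_wpM2l//; exact: dl_bnd ng x y.
by rewrite expr2; lra.
Qed.

End at_x.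
End regular_kernel.
Section sqn_calculus.
Context {R : realType}.
Implicit Types (u v w : RR R -> R) (a b c K : R).

Lemma sqn_add_le u v a b : measurable_fun setT u -> measurable_fun setT v ->
  (sqn u <= a%:E)%E -> (sqn v <= b%:E)%E ->
  (sqn (fun x => (u x + v x)%R) <= (2 * a + 2 * b)%:E)%E.
Proof.
move=> mu mv ua vb; apply: le_trans (sqn_add mu mv) _.
by rewrite (EFinD (2 * a)) (EFinM 2 a) (EFinM 2 b); apply: leeD; apply: lee_wpmul2l.
Qed.

Lemma sqn_scale u c a : measurable_fun setT u -> (sqn u <= a%:E)%E ->
  (sqn (fun x => (c * u x)%R) <= (c ^+ 2 * a)%:E)%E.
Proof.
move=> mu ua; rewrite /sqn; under eq_integral do rewrite exprMn EFinM.
rewrite ge0_integralZl//; last 3 first.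
- by mfun.
- by move=> x _; rewrite lee_fin sqr_ge0.
- by rewrite lee_fin sqr_ge0.
by rewrite (EFinM (c ^+ 2)); apply: lee_wpmul2l => //; rewrite lee_fin sqr_ge0.
Qed.

Lemma sqn_norm u : sqn (fun x => `|u x|) = sqn u.
Proof. by apply: eq_integral => x _; rewrite real_normK ?num_real. Qed.

Lemma sqn_dom u v a : measurable_fun setT u -> measurable_fun setT v ->
  (forall x, `|u x| <= v x) -> (sqn v <= a%:E)%E -> (sqn u <= a%:E)%E.
Proof.
move=> mu mv uv; apply: le_trans; apply: sqn_le => // x.
by rewrite -(real_normK (num_real (u x))) lerXn2r ?nnegrE//; apply: le_trans (uv x).
Qed.

End sqn_calculus.

(** * The principal value and its bound in L^2 *)

Section velocity.
Context {R : realType}.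
Variables (K : R) (g g1 g2 : RR R -> R).
Hypotheses (ng : nice K g) (n1 : nice K g1) (n2 : nice K g2).
Hypotheses (d1 : der1 g g1) (d2 : der2 g g2).
Let L := bnd K.
Let L1 : 1 <= L := bnd_ge1 ng.
Let L0 : 0 <= L. Proof. exact: le_trans ler01 L1. Qed.
Let K0 : 0 <= K := nice_K ng.
Let mg : measurable_fun setT g := nice_m ng.
Let mg1 : measurable_fun setT g1 := nice_m n1.
Let mg2 : measurable_fun setT g2 := nice_m n2.

(** The principal value is evaluated along the annuli 1/(m+2) < r < m+2. Their indicators are even
    and tend to 1 off the origin, so [weighted_ker] and [dominated_reg] apply. *)
Lemma velocity_pv (x : RR R) (v : R) : has_pv (muskat_integrand g x) v ->
  v = velocity g g1 g2 x.
Proof.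
move=> [iA cA]; pose lo (m : nat) : R := m.+2%:R^-1; pose hi (m : nat) : R := m.+2%:R.
pose A m := [set y : R * R | lo m < enorm y < hi m].
have lo0 m : 0 < lo m by rewrite invr_gt0 ltr0n.
have lohi m : lo m < hi m.
  apply: (@le_lt_trans _ _ 1); first by rewrite invf_le1 ?ltr0n// ler1n.
  by rewrite ltr1n.
have men : measurable_fun setT (@enorm R : RR R -> R) by exact: mfun_enorm (@mfun_id _ _).
have mA m : measurable (A m : set (RR R)).
  have -> : A m = (@enorm R) @^-1` `]lo m, hi m[%classic by apply/seteqP; split => y /=; rewrite in_itv.
  by rewrite -[X in measurable X]setTI; exact: men.
have mk : measurable_fun setT (ker g g1 g2 x).
  have h : measurable_fun setT (fun y : RR R => (x, y)) by mfun.
  exact: (mfun_comp (measurable_ker ng n1 n2) h).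
have E m : \int[leb2 R]_(y in A m) muskat_integrand g x y = \int[leb2 R]_y (\1_(A m) y * reg g g1 g2 x y).
  have i := iA _ _ (lo0 m) (lohi m).
  rewrite -(weighted_ker ng n1 n2).
  - rewrite Rintegral_mkcond; apply: eq_Rintegral => y _; rewrite patchE indicE.
    by case: ifP => yA; rewrite ?mul1r ?mul0r// (muskatE d1 d2).
  - exact: measurable_indic.
  - move=> y; have e : A m (- y) = A m y by rewrite /A /= enormN.
    by rewrite !indicE; have [h|h] := pselect (A m y); [rewrite !mem_set ?e|rewrite !memNset ?e].
  - by move=> y; rewrite indicE; case: (_ \in _); rewrite /= ?lexx ler01.
  - move: i; rewrite (integrable_mkcond _ (mA m)); apply: eq_integrable => // y _ /=.
    by rewrite patchE indicE; case: ifP => yA; rewrite ?mul1r ?mul0r//= (muskatE d1 d2).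
have c1 : \int[leb2 R]_(y in A m) muskat_integrand g x y @[m --> \oo] --> velocity g g1 g2 x.
  under eq_fun do rewrite E.
  apply: (dominated_reg ng n1 n2).
  - by move=> n; exact: measurable_indic.
  - by move=> n y; rewrite indicE; case: (_ \in _); rewrite /= ?lexx ler01.
  - move=> y r0; apply: cvg_near_cst; near=> m.
    rewrite indicE mem_set//; rewrite /A /=; apply/andP; split.
      rewrite /lo invf_plt ?posrE ?ltr0n//; near: m.
      exists (Num.truncn (enorm y)^-1) => // m /= hm.
      apply: lt_le_trans (truncnS_gt _) _; rewrite ler_nat; exact: (leq_trans hm (leqnSn m)).
    near: m; exists (Num.truncn (enorm y)) => // m /= hm.
    by apply: lt_le_trans (truncnS_gt _) _; rewrite ler_nat; exact: (leq_trans hm (leqnSn m)).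
have c2 : \int[leb2 R]_(y in A m) muskat_integrand g x y @[m --> \oo] --> v.
  have h1 : lo m @[m --> \oo] --> (0 : R)^'+.
    move=> P [e /= e0 he]; suff h : \forall m \near \oo, P (lo m) by exact: h.
    near=> m; apply: he; last exact: lo0.
    rewrite /= sub0r normrN gtr0_norm// /lo invf_plt ?posrE ?ltr0n//; near: m.
    exists (Num.truncn e^-1) => // m /= hm.
    apply: lt_le_trans (truncnS_gt _) _; rewrite ler_nat; exact: (leq_trans hm (leqnSn m)).
  have h2 : hi m @[m --> \oo] --> +oo.
    move=> P [M [_ hM]]; suff h : \forall m \near \oo, P (hi m) by exact: h.
    near=> m; apply: hM; near: m.
    exists (Num.truncn M) => // m /= hm.
    apply: lt_le_trans (truncnS_gt _) _; rewrite ler_nat; exact: (leq_trans hm (leqnSn m)).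
  exact: (cvg_comp _ _ (cvg_pair h1 h2) cA).
exact: (cvg_unique _ c2 c1).
Unshelve. all: by end_near. Qed.

Let Z := majorant K g g1 g2.

Let mZ : measurable_fun setT (fun z : RR R * RR R => Z z.1 z.2).
Proof. by rewrite /Z /majorant /jump /slope /dl; mfun. Qed.

(** The jump divided by r is bounded in L^2 since a translation by y costs a factor r. The constants
    600 and 864 come from four nested uses of (a + b)^2 <= 2 a^2 + 2 b^2. *)
Lemma majorant_sqn (y : RR R) : 0 < enorm y ->
  (sqn (fun x => Z x y) <= (600 * K + 864 * L ^+ 2 * K)%:E)%E.
Proof.
move=> r0.
have r1 : (enorm y)^-1 ^+ 2 * (4 * K * enorm y ^+ 2) = 4 * K by field; rewrite gt_eqF.
pose u1 (x : RR R) := (enorm y)^-1 * `|g1 x - g1 (x - y)|.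
pose u2 (x : RR R) := (enorm y)^-1 * `|g2 x - g2 (x - y)|.
pose u3 (x : RR R) := (6 * L) * `|g1 x|.
pose u4 (x : RR R) := (6 * L) * `|g2 x|.
pose u5 (x : RR R) := 3 * `|g x - g (x - y)|.
have m1 : measurable_fun setT u1 by rewrite /u1; mfun.
have m2 : measurable_fun setT u2 by rewrite /u2; mfun.
have m3 : measurable_fun setT u3 by rewrite /u3; mfun.
have m4 : measurable_fun setT u4 by rewrite /u4; mfun.
have m5 : measurable_fun setT u5 by rewrite /u5; mfun.
have s1 : (sqn u1 <= (4 * K)%:E)%E.
  rewrite -r1; apply: sqn_scale; first by mfun.
  by rewrite sqn_norm; exact: nice_shift.
have s2 : (sqn u2 <= (4 * K)%:E)%E.
  rewrite -r1; apply: sqn_scale; first by mfun.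
  by rewrite sqn_norm; exact: nice_shift.
have s3 : (sqn u3 <= ((6 * L) ^+ 2 * K)%:E)%E.
  by apply: sqn_scale; [mfun|rewrite sqn_norm; exact: nice_sqn n1].
have s4 : (sqn u4 <= ((6 * L) ^+ 2 * K)%:E)%E.
  by apply: sqn_scale; [mfun|rewrite sqn_norm; exact: nice_sqn n2].
have s5 : (sqn u5 <= (3 ^+ 2 * (4 * K))%:E)%E.
  by apply: sqn_scale; [mfun|rewrite sqn_norm; exact: nice_shift2].
have m45 : measurable_fun setT (fun x => u4 x + u5 x) by mfun.
have m345 : measurable_fun setT (fun x => u3 x + (u4 x + u5 x)) by mfun.
have m2345 : measurable_fun setT (fun x => u2 x + (u3 x + (u4 x + u5 x))) by mfun.
have := sqn_add_le m1 m2345 s1 (sqn_add_le m2 m345 s2 (sqn_add_le m3 m45 s3 (sqn_add_le m4 m5 s4 s5))).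
have -> : (fun x => Z x y) = (fun x => u1 x + (u2 x + (u3 x + (u4 x + u5 x)))).
  by apply/funext => x; rewrite /Z /majorant /u1 /u2 /u3 /u4 /u5 /jump /slope /dl /L; ring.
move=> h; apply: le_trans h _; rewrite lee_fin le_eqVlt; apply/orP; left; apply/eqP; ring.
Qed.

(** A single function in L^2 that dominates the velocity and, for every N >= 1, the damped
    integrals; it is the majorant in x when N tends to infinity. *)
Definition envelope (x : RR R) := \int[leb2 R]_y (kk y * Z x y).

Let mkk := @measurable_kk R.

Let mkZ : measurable_fun setT (fun z : RR R * RR R => kk z.2 * Z z.1 z.2).
Proof. by mfun. Qed.

Lemma measurable_envelope : measurable_fun setT envelope.
Proof. exact: (measurable_param mkZ). Qed.

Let mZx x : measurable_fun setT (Z x). Proof. exact: measurable_majorant. Qed.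

Let kZ_integrable x : (leb2 R).-integrable setT (EFin \o (fun y => kk y * Z x y)).
Proof.
apply: (@integrable_off0 _ _ (fun y => 2 * L * kh y + (12 * L ^+ 2 + 6 * L) * kk y)).
- by have := mZx x => ?; mfun.
- by apply: integrable_plus; apply: integrable_scale; [exact: integrable_kh|exact: integrable_kk].
move=> y r0; rewrite ger0_norm ?mulr_ge0 ?kk_ge0 ?majorant_ge0//.
rewrite /Z /majorant 2!(mulrDr (kk y)).
have h1 := kk_jump ng n1 n2 x r0; have k0 := kk_ge0 y.
have h2 : kk y * (6 * L * slope g1 g2 x) <= kk y * (6 * L * (2 * L)).
  by rewrite ler_wpM2l// ler_wpM2l ?mulr_ge0//; exact: slope_bnd n1 n2 x.
have h3 : kk y * (3 * `|dl g x y|) <= kk y * (3 * (2 * L)).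
  by rewrite ler_wpM2l// ler_wpM2l//; exact: dl_bnd ng x y.
by rewrite -/L in h1 *; rewrite expr2; lra.
Qed.

Lemma envelopeE x : ((envelope x)%:E = \int[leb2 R]_y (kk y * Z x y)%:E)%E.
Proof. by rewrite /envelope /Rintegral fineK//; exact: integrable_fin_num (kZ_integrable x). Qed.

Lemma envelope_ge0 x : 0 <= envelope x.
Proof. by apply: Rintegral_ge0 => y _; rewrite mulr_ge0 ?kk_ge0 ?majorant_ge0. Qed.

Lemma chi_ker_envelope (N : R) x : 1 <= N ->
  `|\int[leb2 R]_y (chi N y * ker g g1 g2 x y)| <= envelope x.
Proof. by move=> N1; rewrite -lee_fin envelopeE; exact: chi_ker_majorant. Qed.

Lemma velocity_envelope x : `|velocity g g1 g2 x| <= envelope x.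
Proof. by rewrite -lee_fin envelopeE; exact: velocity_majorant. Qed.

Let Ik : \bar R := (\int[leb2 R]_y (kk y)%:E)%E.
Let Ik0 : (0 <= Ik)%E. Proof. by apply: integral_ge0 => y _; rewrite lee_fin kk_ge0. Qed.

(** Cauchy-Schwarz for the measure with density [kk], then Tonelli; each step contributes one factor
    [Ik]. *)
Lemma envelope_sqn : (sqn envelope <= Ik * (Ik * (600 * K + 864 * L ^+ 2 * K)%:E))%E.
Proof.
set C := (600 * K + 864 * L ^+ 2 * K).
have mF : measurable_fun setT (fun z : RR R * RR R => (kk z.2 * Z z.1 z.2 ^+ 2)%:E) by mfun.
have F0 (z : RR R * RR R) : (0 <= (kk z.2 * Z z.1 z.2 ^+ 2)%:E)%E.
  by rewrite lee_fin mulr_ge0 ?kk_ge0 ?sqr_ge0.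
have cs x : ((envelope x ^+ 2)%:E <= Ik * \int[leb2 R]_y (kk y * Z x y ^+ 2)%:E)%E.
  have mq : measurable_fun setT (fun y : RR R => Num.sqrt (kk y)) by mfun.
  have mqZ : measurable_fun setT (fun y : RR R => Num.sqrt (kk y) * Z x y) by have := mZx x => ?; mfun.
  have sq y : Num.sqrt (kk y) ^+ 2 = kk y by rewrite sqr_sqrtr ?kk_ge0.
  have := cauchy_schwarz (leb2 R) mq mqZ.
  have -> : (\int[leb2 R]_y `|Num.sqrt (kk y) * (Num.sqrt (kk y) * Z x y)|%:E = (envelope x)%:E)%E.
    rewrite envelopeE; apply: eq_integral => y _.
    by rewrite mulrA -expr2 sq ger0_norm ?mulr_ge0 ?kk_ge0 ?majorant_ge0.
  rewrite -EFin_expe; congr (_ <= _ * _)%E; apply: eq_integral => y _; first by rewrite sq.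
  by rewrite exprMn sq.
have mT := tonelli4_measurable mF F0.
apply: (@le_trans _ _ (\int[leb2 R]_x (Ik * \int[leb2 R]_y (kk y * Z x y ^+ 2)%:E))%E).
  apply: ge0_le_integral => //.
  - by move=> x _; rewrite lee_fin sqr_ge0.
  - by have := measurable_envelope => ?; mfun.
  - exact: measurable_funeM.
rewrite ge0_integralZl//; last first.
  by move=> x _; apply: integral_ge0 => y _; exact: (F0 (x, y)).
have mkE : measurable_fun setT (fun y : RR R => (kk y)%:E) by mfun.
have kk0 (y : RR R) : setT y -> (0 <= (kk y)%:E)%E by move=> _; rewrite lee_fin kk_ge0.
have C0 : (0 <= C%:E)%E.
  have h : 0 <= L ^+ 2 * K by apply: mulr_ge0 => //; exact: sqr_ge0.
  by rewrite lee_fin /C -mulrA; move: h K0; lra.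
apply: lee_wpmul2l => //; rewrite (tonelli4 mF F0) muleC /Ik.
rewrite -(ge0_integralZl (leb2 R) measurableT mkE kk0 C0).
apply: ge0_le_integral; first exact: measurableT.
- by move=> y _; apply: integral_ge0 => x _; exact: (F0 (x, y)).
- exact: (tonelli4_measurable2 mF F0).
- by apply: measurable_funeM; mfun.
move=> y _ /=; have mZy : measurable_fun setT (fun x : RR R => Z x y).
  have h : measurable_fun setT (fun x : RR R => (x, y)) by mfun.
  exact: (mfun_comp mZ h).
under eq_integral do rewrite EFinM.
have mZ2 : measurable_fun setT (fun x : RR R => (Z x y ^+ 2)%:E) by mfun.
have Z2 (x : RR R) : setT x -> (0 <= (Z x y ^+ 2)%:E)%E by move=> _; rewrite lee_fin sqr_ge0.
rewrite (ge0_integralZl (leb2 R) measurableT mZ2 Z2 (kk0 y I)).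
rewrite muleC; have [r0|] := ltP 0 (enorm y).
  by apply: lee_wpmul2r; [rewrite lee_fin kk_ge0|exact: majorant_sqn].
(* [majorant_sqn] is available only off the origin; at the origin [kk] has the default value 0. *)
move=> r0; have -> : kk y = 0.
  by rewrite /kk (_ : enorm y = 0) ?mul0r ?invr0//; apply: le_anti; rewrite r0 enorm_ge0.
by rewrite !mule0.
Qed.

Lemma velocity_sqn : (sqn (velocity g g1 g2) <= Ik * (Ik * (600 * K + 864 * L ^+ 2 * K)%:E))%E.
Proof.
apply: le_trans envelope_sqn; apply: sqn_le.
- exact: measurable_velocity ng n1 n2.
- exact: measurable_envelope.
move=> x; rewrite -(real_normK (num_real (velocity _ _ _ _))) lerXn2r ?nnegrE ?envelope_ge0//.
exact: velocity_envelope.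
Qed.

End velocity.

(** * The energy identity at a fixed time *)

Section dominated.
Context {R : realType}.
Variables (f : nat -> RR R -> R) (F G : RR R -> R).
Hypotheses (mf : forall n, measurable_fun setT (f n)) (mF : measurable_fun setT F).
Hypothesis cf : forall y, 0 < enorm y -> f n y @[n --> \oo] --> F y.
Hypothesis iG : (leb2 R).-integrable setT (EFin \o G).
Hypothesis fG : forall n y, 0 < enorm y -> `|f n y| <= G y.

Let dct : (leb2 R).-integrable setT (EFin \o F) /\
  (\int[leb2 R]_y (f n y)%:E)%E @[n --> \oo] --> (\int[leb2 R]_y (F y)%:E)%E.
Proof.
have [|||||? _ H] := @dominated_convergence _ _ _ (leb2 R) setT measurableT
  (fun n => EFin \o f n) (EFin \o F) (EFin \o G).
- by move=> n; have := mf n => ?; mfun.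
- by mfun.
- by apply: ae_enorm_gt0 => y r0 _; apply: cvg_EFin; [near=> n|exact: cf].
- exact: iG.
- by apply: ae_enorm_gt0 => y r0 n _ /=; rewrite lee_fin; exact: fG.
by split.
Unshelve. all: by end_near. Qed.

Lemma dct_integrable : (leb2 R).-integrable setT (EFin \o F).
Proof. exact: dct.1. Qed.

Lemma dct_cvg : (\int[leb2 R]_y (f n y)%:E)%E @[n --> \oo] --> (\int[leb2 R]_y (F y)%:E)%E.
Proof. exact: dct.2. Qed.

Lemma dct_Rcvg : \int[leb2 R]_y f n y @[n --> \oo] --> \int[leb2 R]_y F y.
Proof. have h := integrable_fin_num measurableT dct_integrable.
by apply: fine_cvg; rewrite fineK//; exact: dct_cvg. Qed.

End dominated.

Section ratio_line.
Context {R : realType}.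
Variables (D D1 : R -> R) (p : R).
Hypotheses (p0 : 0 < p) (dD : forall s : R, is_derive s 1 D (D1 s)) (cD1 : continuous D1).
Let S s := Num.sqrt (p + D s ^+ 2).
Let q0 s : 0 < p + D s ^+ 2. Proof. by rewrite ltr_wpDr// sqr_ge0. Qed.
Let SN s : S s != 0. Proof. by rewrite gt_eqF// sqrtr_gt0. Qed.

Let dS (s : R) : is_derive s 1 S (D s * D1 s / S s).
Proof.
have d := der_sqrt (der_add (der_cst s p) (der_exp 2 (dD s))) (q0 s).
by apply: (der_eq d); rewrite -/(S s) /= expr1 add0r; have := SN s => ?; field.
Qed.

(** Here y is fixed and the derivative is taken in x, so [p] stands for the constant r^2. *)
Lemma der_ratio_line (s : R) : is_derive s 1 (fun s : R => D s / Num.sqrt (p + D s ^+ 2))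
  (D1 s * p / Num.sqrt (p + D s ^+ 2) ^+ 3).
Proof.
have d := der_mul (dD s) (der_inv (dS s) (SN s)).
apply: (der_eq d); rewrite -/(S s).
have E : S s ^+ 2 = p + D s ^+ 2 by rewrite sqr_sqrtr// ltW.
have -> : p = S s ^+ 2 - D s ^+ 2 by rewrite E addrK.
by have := SN s => ?; field.
Qed.

Lemma continuous_ratio_line1 (s : R) :
  {for s, continuous (fun s : R => D1 s * p / Num.sqrt (p + D s ^+ 2) ^+ 3)}.
Proof.
have h1 := @cD1 s; have h2 : {for s, continuous S} := der_continuous (dS s).
apply: ct_mul; first by ct.
by apply: ct_inv; [rewrite expf_neq0// SN|apply: ct_exp].
Qed.

Lemma continuous_ratio_line (s : R) : {for s, continuous (fun s : R => D s / Num.sqrt (p + D s ^+ 2))}.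
Proof. exact: der_continuous (der_ratio_line s). Qed.

End ratio_line.

(** * Integration by parts in x at fixed y *)

Section energy.
Context {R : realType}.
Variables (K : R) (g g1 g2 : RR R -> R).
Hypotheses (ng : nice K g) (n1 : nice K g1) (n2 : nice K g2).
Hypotheses (d1 : der1 g g1) (d2 : der2 g g2).
Let L := bnd K.
Let L1 : 1 <= L := bnd_ge1 ng.
Let mg : measurable_fun setT g := nice_m ng.
Let mg1 : measurable_fun setT g1 := nice_m n1.
Let mg2 : measurable_fun setT g2 := nice_m n2.

Let sqn_fin (u : RR R -> R) a : (sqn u <= a%:E)%E -> (sqn u < +oo)%E.
Proof. by move=> h; apply: le_lt_trans h _; exact: ltry. Qed.

Section fixed_y.
Variables (y : RR R) (r0 : 0 < enorm y).
Let p0 : 0 < enorm y ^+ 2. Proof. by rewrite exprn_gt0. Qed.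

Let rt (x : RR R) := ratio g x y.
Let inc (w : RR R -> R) (x : RR R) := w x - w (x - y).

Let minc w : measurable_fun setT w -> measurable_fun setT (inc w).
Proof. by move=> mw; rewrite /inc; mfun. Qed.

Let mrt : measurable_fun setT rt.
Proof. by rewrite /rt /ratio /SS /dl; mfun. Qed.

Let mSS : measurable_fun setT (fun x : RR R => SS g x y).
Proof. by rewrite /SS /dl; mfun. Qed.

Lemma ratio_sqn : (sqn (fun x => ratio g x y) <= (4 * K)%:E)%E.
Proof.
have mi := minc mg.
have -> : 4 * K = (enorm y)^-1 ^+ 2 * (4 * K * enorm y ^+ 2) by field; rewrite gt_eqF.
apply: (sqn_dom (v := fun x => (enorm y)^-1 * `|inc g x|)) => //; first by mfun.
  by move=> x; rewrite mulrC; exact: ratio_le.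
by apply: sqn_scale; [mfun|rewrite sqn_norm; exact: nice_shift].
Qed.

Let slopeW (w : RR R -> R) (x : RR R) := inc w x * enorm y ^+ 2 / SS g x y ^+ 3.

Let slopeW_sqn w : nice K w -> (sqn (slopeW w) < +oo)%E.
Proof.
move=> nw; have mi := minc (nice_m nw).
apply: (@sqn_fin _ ((enorm y)^-1 ^+ 2 * (4 * K * enorm y ^+ 2))).
apply: (sqn_dom (v := fun x => (enorm y)^-1 * `|inc w x|)).
- by rewrite /slopeW; mfun.
- by mfun.
- move=> x; rewrite /slopeW -mulrA normrM mulrC ler_wpM2r//.
  rewrite ger0_norm ?divr_ge0 ?exprn_ge0 ?SS_ge0 ?enorm_ge0//.
  apply: le_trans (ler_wpM2l _ (SS3_inv g x 3 r0)) _; first exact: ltW.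
  by rewrite le_eqVlt; apply/orP; left; apply/eqP; field; rewrite gt_eqF.
by apply: sqn_scale; [mfun|rewrite sqn_norm; exact: nice_shift].
Qed.

Let niceL2 w : nice K w -> (sqn w < +oo)%E.
Proof. by move=> nw; exact: sqn_fin (nice_sqn nw). Qed.

Let mslopeW w : nice K w -> measurable_fun setT (slopeW w).
Proof. by move=> nw; have mi := minc (nice_m nw); rewrite /slopeW; mfun. Qed.

Let mul_integrable u v : measurable_fun setT u -> measurable_fun setT v ->
  (sqn u < +oo)%E -> (sqn v < +oo)%E -> (leb2 R).-integrable setT (EFin \o (fun x => u x * v x)).
Proof. exact: sqn_mul_integrable. Qed.

Let iW : (leb2 R).-integrable setT (EFin \o (fun x => g x * rt x)).
Proof. exact: mul_integrable (niceL2 ng) (sqn_fin ratio_sqn). Qed.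

Let iW1 w : nice K w -> (leb2 R).-integrable setT (EFin \o (fun x => w x * rt x + g x * slopeW w x)).
Proof.
move=> nw; apply: integrable_plus.
  exact: mul_integrable (nice_m nw) mrt (niceL2 nw) (sqn_fin ratio_sqn).
exact: mul_integrable (mslopeW nw) (niceL2 ng) (slopeW_sqn nw).
Qed.

Let N0 : (@lebesgue_measure R).-negligible (set0 : set R).
Proof. exact: negligible_set0. Qed.

Let dD1 b (s : R) : is_derive s 1 (fun s => dl g (s, b) y) (inc g1 (s, b)).
Proof.
rewrite /inc /dl; case: y => c e; under eq_fun do rewrite pairB; rewrite pairB.
apply: der_add; first exact: der1_line.
apply: der_opp; apply: (@der_shift _ s (fun s => g (s, b - e))).
exact: (der1_line _ d1).
Qed.

Let dD2 a (s : R) : is_derive s 1 (fun s => dl g (a, s) y) (inc g2 (a, s)).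
Proof.
rewrite /inc /dl; case: y => c e; under eq_fun do rewrite pairB; rewrite pairB.
apply: der_add; first exact: (d2 (a, s)).
apply: der_opp; apply: (@der_shift _ s (fun s => g (a - c, s))).
exact: (d2 (a - c, s - e)).
Qed.

Let cshift (u : R -> R) (c s : R) : continuous u -> {for s, continuous (fun s : R => u (s - c))}.
Proof.
move=> cu; have cs : {for s, continuous (fun s : R => s - c)} by apply: ct_add; [exact: ct_id|exact: ct_cst].
exact: (@continuous_comp _ _ _ (fun s : R => s - c) u s cs (cu _)).
Qed.

Let cD1 b : continuous (fun s : R => inc g1 (s, b)).
Proof.
have [c [e yE]] : exists c e : R, y = (c, e) by case: y => c e; exists c, e.
rewrite /inc yE; under eq_fun do rewrite pairB.
suff h (s : R) : {for s, continuous (fun s : R => g1 (s, b) - g1 (s - c, b - e))} by move=> s; exact: h.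
apply: ct_add; first exact: (nice_cont1 n1).
exact (ct_opp (@cshift (fun s => g1 (s, b - e)) c s (@nice_cont1 _ _ _ n1 (b - e)))).
Qed.

Let cD2 a : continuous (fun s : R => inc g2 (a, s)).
Proof.
have [c [e yE]] : exists c e : R, y = (c, e) by case: y => c e; exists c, e.
rewrite /inc yE; under eq_fun do rewrite pairB.
suff h (s : R) : {for s, continuous (fun s : R => g2 (a, s) - g2 (a - c, s - e))} by move=> s; exact: h.
apply: ct_add; first exact: (nice_cont2 n2).
exact (ct_opp (@cshift (fun s => g2 (a - c, s)) e s (@nice_cont2 _ _ _ n2 (a - c)))).
Qed.

Let int1 : (\int[leb2 R]_x (g1 x * rt x + g x * slopeW g1 x)%:E = 0)%E.
Proof.
apply: (leb2_derive0 N0 _ _ iW (iW1 n1)) => [s b _|b _].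
- by apply: der_mul; [exact: der1_line|exact: (der_ratio_line p0 (dD1 b))].
- suff h (s : R) : {for s, continuous (fun s : R => g1 (s, b) * rt (s, b) + g (s, b) * slopeW g1 (s, b))} by move=> s; exact: h.
  apply: ct_add; apply: ct_mul.
  + exact: (nice_cont1 n1).
  + exact: (@continuous_ratio_line _ (fun s => dl g (s, b) y) (fun s => inc g1 (s, b)) _ p0 (dD1 b) s).
  + exact: (nice_cont1 ng).
  + exact: (@continuous_ratio_line1 _ (fun s => dl g (s, b) y) (fun s => inc g1 (s, b)) _ p0 (dD1 b) (cD1 (b := b)) s).
Qed.

Let int2 : (\int[leb2 R]_x (g2 x * rt x + g x * slopeW g2 x)%:E = 0)%E.
Proof.
apply: (leb2_derive0_snd N0 _ _ iW (iW1 n2)) => [s b _|b _].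
- by apply: der_mul; [exact: (d2 (b, s))|exact: (der_ratio_line p0 (dD2 b))].
- suff h (s : R) : {for s, continuous (fun s : R => g2 (b, s) * rt (b, s) + g (b, s) * slopeW g2 (b, s))} by move=> s; exact: h.
  apply: ct_add; apply: ct_mul.
  + exact: (nice_cont2 n2).
  + exact: (@continuous_ratio_line _ (fun s => dl g (b, s) y) (fun s => inc g2 (b, s)) _ p0 (dD2 b) s).
  + exact: (nice_cont2 ng).
  + exact: (@continuous_ratio_line1 _ (fun s => dl g (b, s) y) (fun s => inc g2 (b, s)) _ p0 (dD2 b) (cD2 (a := b)) s).
Qed.

Let mtan : measurable_fun setT (fun x => tangent g1 g2 x y).
Proof. by rewrite /tangent; mfun. Qed.

Let tan_sqn : (sqn (fun x => tangent g1 g2 x y) < +oo)%E.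
Proof.
apply: (@sqn_fin _ (2 * (y.1 ^+ 2 * K) + 2 * (y.2 ^+ 2 * K))).
have -> : (fun x => tangent g1 g2 x y) = (fun x => y.1 * g1 x + y.2 * g2 x).
  by apply/funext => x; rewrite /tangent ![y.1 * _]mulrC ![y.2 * _]mulrC.
by apply: sqn_add_le; [mfun|mfun|apply: sqn_scale => //; exact: nice_sqn n1|apply: sqn_scale => //; exact: nice_sqn n2].
Qed.

Lemma tangent_ratio_integrable :
  (leb2 R).-integrable setT (EFin \o (fun x => tangent g1 g2 x y * ratio g x y)).
Proof. exact: mul_integrable tan_sqn (sqn_fin ratio_sqn). Qed.

Let gk x := g x * ker g g1 g2 x y.

Let gkE x : gk x = (enorm y ^+ 2)^-1 * (y.1 * (g1 x * rt x + g x * slopeW g1 x) + y.2 * (g2 x * rt x + g x * slopeW g2 x)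
   - tangent g1 g2 x y * ratio g x y).
Proof.
have S0 := SS_gt0 g x r0; rewrite /gk /ker /slopeW /rt /inc /tangent.
by field; rewrite !gt_eqF.
Qed.

Lemma ker_by_parts : \int[leb2 R]_x (g x * ker g g1 g2 x y) =
  - (enorm y ^+ 2)^-1 * \int[leb2 R]_x (tangent g1 g2 x y * ratio g x y).
Proof.
have i1 := integrable_scale y.1 (iW1 n1); have i2 := integrable_scale y.2 (iW1 n2).
have i3 := integrable_plus i1 i2; have i4 := tangent_ratio_integrable.
rewrite (eq_Rintegral (leb2 R) (g := fun x => (enorm y ^+ 2)^-1 * (y.1 * (g1 x * rt x + g x * slopeW g1 x) + y.2 * (g2 x * rt x + g x * slopeW g2 x)
   - tangent g1 g2 x y * ratio g x y))); last by move=> x _; exact: gkE.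
rewrite RintegralZl//; last exact: (integrable_minus i3 i4).
rewrite RintegralB// RintegralD// !RintegralZl//; [|exact: iW1|exact: iW1].
by rewrite /Rintegral int1 int2 !mulr0 addr0 sub0r mulrN mulNr.
Qed.

End fixed_y.

End energy.

(** * Energy production equals dissipation *)

Section energy_identity.
Context {R : realType}.
Variables (K : R) (g g1 g2 : RR R -> R).
Hypotheses (ng : nice K g) (n1 : nice K g1) (n2 : nice K g2).
Hypotheses (d1 : der1 g g1) (d2 : der2 g g2).
Let L := bnd K.
Let L1 : 1 <= L := bnd_ge1 ng.
Let L0 : 0 <= L. Proof. exact: le_trans ler01 L1. Qed.
Let K0 : 0 <= K := nice_K ng.
Let mg : measurable_fun setT g := nice_m ng.
Let mg1 : measurable_fun setT g1 := nice_m n1.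
Let mg2 : measurable_fun setT g2 := nice_m n2.
Let mker : measurable_fun setT (fun z : RR R * RR R => ker g g1 g2 z.1 z.2) := measurable_ker ng n1 n2.
Let mSS : measurable_fun setT (fun z : RR R * RR R => SS g z.1 z.2) := measurable_SS ng.
Let mdl : measurable_fun setT (fun z : RR R * RR R => dl g z.1 z.2) := measurable_dl ng.
Let mkk := @measurable_kk R.

Let sec_y (F : RR R * RR R -> R) (x : RR R) : measurable_fun setT F ->
  measurable_fun setT (fun y : RR R => F (x, y)).
Proof.
move=> mF; have h : measurable_fun setT (fun y : RR R => (x, y)) by mfun.
exact: (mfun_comp mF h).
Qed.

Let sec_x (F : RR R * RR R -> R) (y : RR R) : measurable_fun setT F ->
  measurable_fun setT (fun x : RR R => F (x, y)).
Proof.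
move=> mF; have h : measurable_fun setT (fun x : RR R => (x, y)) by mfun.
exact: (mfun_comp mF h).
Qed.

Lemma envelope_sqn_lty : (sqn (envelope K g g1 g2) < +oo)%E.
Proof.
apply: le_lt_trans (envelope_sqn ng n1 n2) _.
have f : (\int[leb2 R]_y (kk y)%:E)%E \is a fin_num.
  rewrite ge0_fin_numE ?kk_lty//; apply: integral_ge0 => y _; rewrite lee_fin; exact: kk_ge0.
by rewrite ltey_eq !fin_numM.
Qed.

Let menv : measurable_fun setT (envelope K g g1 g2) := measurable_envelope ng n1 n2.

Let g_env_integrable : (leb2 R).-integrable setT (EFin \o (fun x => g x * envelope K g g1 g2 x)).
Proof.
apply: sqn_mul_integrable => //; last exact: envelope_sqn_lty.
by apply: le_lt_trans (nice_sqn ng) _; exact: ltry.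
Qed.

Let abs_env_integrable : (leb2 R).-integrable setT (EFin \o (fun x => `|g x| * envelope K g g1 g2 x)).
Proof.
apply: (integrable_le _ _ (integrable_abse g_env_integrable)) => //; first by mfun.
by move=> x _ /=; rewrite !normrM normr_id.
Qed.

Definition gain (x y : RR R) := (enorm y)^-1 - (SS g x y)^-1.

Let mgain : measurable_fun setT (fun z : RR R * RR R => gain z.1 z.2).
Proof. by rewrite /gain; mfun. Qed.

Lemma gain_ge0 x y : 0 <= gain x y.
Proof.
rewrite /gain; have [r0|] := ltP 0 (enorm y).
  by rewrite subr_ge0 lef_pV2 ?posrE ?SS_gt0// SS_enorm.
(* At y = 0 both inverses are the inverse of 0, so the integrand is 0 there. *)
move=> r0; have e0 : enorm y = 0 by apply: le_anti; rewrite r0 enorm_ge0.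
have y0 : y = 0 by rewrite (enorm_eq0 e0).
have -> : SS g x y = 0 by rewrite /SS e0 y0 /dl subr0 subrr expr0n/= addr0 sqrtr0.
by rewrite e0 subrr.
Qed.

(** It dominates [gain] and, whatever N, also [loss]. It is integrable over pairs because [dl] is
    both O(r) and bounded, pointwise as well as in L^2 in x. *)
Definition gain_dom (x y : RR R) := dl g x y ^+ 2 / enorm y ^+ 3.

Lemma gain_dom_ge0 x y : 0 <= gain_dom x y.
Proof. by rewrite divr_ge0 ?sqr_ge0 ?exprn_ge0 ?enorm_ge0. Qed.

Let mdom : measurable_fun setT (fun z : RR R * RR R => gain_dom z.1 z.2).
Proof. by rewrite /gain_dom; mfun. Qed.

(** Adds d^2 <= 4 L^2 r^2 and d^2 r^2 <= 4 L^2 r^2, from the Lipschitz and the sup bound. *)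
Lemma gain_dom_kk x y : 0 < enorm y -> gain_dom x y <= 8 * L ^+ 2 * kk y.
Proof.
move=> r0; have s1 : 0 < 1 + enorm y ^+ 2 by rewrite addr_gt0 ?exprn_gt0.
rewrite /gain_dom ler_pdivrMr ?exprn_gt0// -[leRHS]mulrA.
have -> : kk y * enorm y ^+ 3 = enorm y ^+ 2 / (1 + enorm y ^+ 2).
  by rewrite /kk; field; rewrite !gt_eqF.
rewrite mulrA ler_pdivlMr// -(real_normK (num_real (dl g x y))).
have h1 : `|dl g x y| <= 2 * L by exact: dl_bnd ng x y.
have h2 : `|dl g x y| <= 2 * L * enorm y by exact: dl_lip ng n1 n2 d1 d2 x y.
have q1 : `|dl g x y| ^+ 2 <= (2 * L) ^+ 2 by rewrite lerXn2r ?nnegrE ?mulr_ge0.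
have q2 : `|dl g x y| ^+ 2 <= (2 * L * enorm y) ^+ 2 by rewrite lerXn2r ?nnegrE ?mulr_ge0 ?enorm_ge0.
have q3 : `|dl g x y| ^+ 2 * enorm y ^+ 2 <= (2 * L) ^+ 2 * enorm y ^+ 2 by rewrite ler_wpM2r ?sqr_ge0.
by rewrite !exprMn in q1 q2 q3; lra.
Qed.

Lemma gain_dom_int y : (\int[leb2 R]_x (gain_dom x y)%:E <= (8 * K * kk y)%:E)%E.
Proof.
have [r0|] := ltP 0 (enorm y); last first.
  move=> r0; have e0 : enorm y = 0 by apply: le_anti; rewrite r0 enorm_ge0.
  rewrite /gain_dom e0 expr0n/= invr0; under eq_integral do rewrite mulr0.
  by rewrite integral0 lee_fin !mulr_ge0 ?kk_ge0.
rewrite /gain_dom; under eq_integral do rewrite mulrC EFinM.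
have m2 : measurable_fun setT (fun x : RR R => (dl g x y ^+ 2)%:E).
  by have := sec_x y mdl => ?; mfun.
have p2 (x : RR R) : setT x -> (0 <= (dl g x y ^+ 2)%:E)%E by move=> _; rewrite lee_fin sqr_ge0.
have c0 : (0 <= ((enorm y ^+ 3)^-1)%:E)%E by rewrite lee_fin invr_ge0 exprn_ge0 ?enorm_ge0.
rewrite (ge0_integralZl (leb2 R) measurableT m2 p2 c0).
apply: le_trans (lee_wpmul2l c0 (nice_shift_kk ng r0)) _.
rewrite -EFinM lee_fin le_eqVlt; apply/orP; left; apply/eqP; field; rewrite gt_eqF//.
Qed.

Let kk_int_lty (c : R) : 0 <= c -> (\int[leb2 R]_y (c * kk y)%:E < +oo)%E.
Proof.
move=> c0; under eq_integral do rewrite EFinM; rewrite ge0_integralZl//; last 2 first.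
- by mfun.
- by move=> y _; rewrite lee_fin kk_ge0.
by rewrite lte_mul_pinfty// ?lee_fin// kk_lty.
Qed.

Let iterated_lty (F : RR R * RR R -> R) (c : R) : measurable_fun setT F ->
  (forall z, 0 <= F z) -> 0 <= c ->
  (forall y, \int[leb2 R]_x (F (x, y))%:E <= (c * kk y)%:E)%E ->
  (\int[leb2 R]_x \int[leb2 R]_y (F (x, y))%:E < +oo)%E.
Proof.
move=> mF F0 c0 hF; have mE : measurable_fun setT (EFin \o F) by mfun.
have E0 z : (0 <= (EFin \o F) z)%E by rewrite lee_fin.
rewrite (tonelli4 mE E0); apply: le_lt_trans (kk_int_lty c0).
apply: ge0_le_integral; first exact: measurableT.
- by move=> y _; apply: integral_ge0 => x _; exact: (E0 (x, y)).
- exact: (tonelli4_measurable2 mE E0).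
- by mfun.
- by move=> y _; exact: hF.
Qed.

Let dom_lty : (\int[leb2 R]_x \int[leb2 R]_y (gain_dom x y)%:E < +oo)%E.
Proof.
apply: (@iterated_lty (fun z => gain_dom z.1 z.2) (8 * K)) => //.
- by move=> z; exact: gain_dom_ge0.
- exact: mulr_ge0.
- exact: gain_dom_int.
Qed.

Let dom_x_integrable x : (leb2 R).-integrable setT (EFin \o gain_dom x).
Proof.
apply: (integrable_off0 (sec_y x mdom) (integrable_scale (8 * L ^+ 2) (@integrable_kk R))) => y r0.
by rewrite ger0_norm ?gain_dom_ge0// gain_dom_kk.
Qed.

Let dom_int_integrable : (leb2 R).-integrable setT (EFin \o (fun x => \int[leb2 R]_y gain_dom x y)).
Proof.
have mE : measurable_fun setT (fun z : RR R * RR R => (gain_dom z.1 z.2)%:E) by mfun.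
have h : (\int[leb2 R]_x \int[leb2 R]_y `|(gain_dom (x, y).1 (x, y).2)%:E| < +oo)%E.
  rewrite (_ : (\int[leb2 R]_x \int[leb2 R]_y `|(gain_dom (x, y).1 (x, y).2)%:E|)%E =
    (\int[leb2 R]_x \int[leb2 R]_y (gain_dom x y)%:E)%E) ?dom_lty//.
  by apply: eq_integral => x _; apply: eq_integral => y _ /=; rewrite ger0_norm ?gain_dom_ge0.
apply: eq_integrable (fubini4_integrable1 mE h) => // x _ /=.
by rewrite /Rintegral fineK//; exact: integrable_fin_num (dom_x_integrable x).
Qed.

Section weight.
Variables (N : R) (N1 : 1 <= N).
Let N0 : 0 < N. Proof. exact: lt_le_trans ltr01 N1. Qed.
Let Ns (y : RR R) : 0 < N + enorm y ^+ 2. Proof. by rewrite ltr_pwDl// sqr_ge0. Qed.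

(** What is left of -[gap_flux] once its term with the gradient at x - y is set aside: the damped
    gain and a term due to the derivative of the damping, which disappears in the limit. *)
Definition loss (x y : RR R) :=
  2 * N / (N + enorm y ^+ 2) ^+ 2 * gap g x y + chi N y * gain x y.

Lemma measurable_loss : measurable_fun setT (fun z : RR R * RR R => loss z.1 z.2).
Proof. by rewrite /loss /chi /gap; mfun. Qed.

Lemma loss_ge0 x y : 0 <= loss x y.
Proof.
have /andP[c0 _] := chi01 N1 y.
by rewrite addr_ge0 ?mulr_ge0 ?gain_ge0 ?gap_ge0 ?invr_ge0 ?exprn_ge0 ?(ltW (Ns y)) ?(ltW N0).
Qed.

Lemma gap_le x y : 0 < enorm y -> gap g x y <= dl g x y ^+ 2 / (2 * enorm y).
Proof. exact: SS_dist2. Qed.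

Lemma gain_le x y : 0 < enorm y -> gain x y <= gain_dom x y / 2.
Proof.
move=> r0; have S0 := SS_gt0 g x r0.
have -> : gain x y = gap g x y / (enorm y * SS g x y).
  by rewrite /gain /gap; field; rewrite !gt_eqF.
have -> : gain_dom x y / 2 = dl g x y ^+ 2 / (2 * enorm y) / (enorm y * enorm y).
  by rewrite /gain_dom; field; rewrite gt_eqF.
apply: ler_pM; rewrite ?gap_ge0 ?invr_ge0 ?mulr_ge0 ?enorm_ge0 ?SS_ge0 ?gap_le//.
by rewrite lef_pV2 ?posrE ?mulr_gt0// ler_wpM2l ?enorm_ge0// SS_enorm.
Qed.

Lemma loss_le x y : 0 < enorm y -> loss x y <= gain_dom x y.
Proof.
move=> r0; have /andP[c0 c1] := chi01 N1 y.
have p0 : 0 < enorm y ^+ 2 by rewrite exprn_gt0.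
have h1 : chi N y * gain x y <= gain_dom x y / 2.
  by apply: le_trans (gain_le x r0); rewrite ler_piMl ?gain_ge0.
(* This is 4 N r^2 <= (N + r^2)^2; it makes the bound independent of [N]. *)
have h2 : 2 * N / (N + enorm y ^+ 2) ^+ 2 <= (2 * enorm y ^+ 2)^-1.
  rewrite ler_pdivrMr ?exprn_gt0// -[leLHS]mul1r mulrC ler_pdivlMl ?mulr_gt0// mulr1.
  by have := sqr_ge0 (N - enorm y ^+ 2); rewrite !expr2; lra.
have h3 : 2 * N / (N + enorm y ^+ 2) ^+ 2 * gap g x y <= (2 * enorm y ^+ 2)^-1 * (dl g x y ^+ 2 / (2 * enorm y)).
  by apply: ler_pM; rewrite ?gap_ge0 ?gap_le// divr_ge0 ?exprn_ge0 ?(ltW (Ns y))// mulr_ge0// ltW.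
have h4 : (2 * enorm y ^+ 2)^-1 * (dl g x y ^+ 2 / (2 * enorm y)) = gain_dom x y / 4.
  by rewrite /gain_dom; field; rewrite gt_eqF.
rewrite h4 in h3; have := gain_dom_ge0 x y; rewrite /loss; lra.
Qed.

Lemma loss_integrable x : (leb2 R).-integrable setT (EFin \o loss x).
Proof.
apply: (integrable_off0 (sec_y x measurable_loss) (dom_x_integrable x)) => y r0.
by rewrite ger0_norm ?loss_ge0// loss_le.
Qed.

Let mchi : measurable_fun setT (chi N) := measurable_chi N.

Let F1 (z : RR R * RR R) := g z.1 * (chi N z.2 * ker g g1 g2 z.1 z.2).
Let F3 (z : RR R * RR R) := wgt N 0 (enorm z.2 ^+ 2) * (conv_slope g1 g2 z.1 z.2 * ratio g z.1 z.2).

Let mF1 : measurable_fun setT F1. Proof. by rewrite /F1; mfun. Qed.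
Let mF3 : measurable_fun setT F3.
Proof. by rewrite /F3 /wgt /conv_slope /ratio; mfun. Qed.

Let chi_ker_kk x y : 0 < enorm y -> `|chi N y * ker g g1 g2 x y| <= N * (kk y * majorant K g g1 g2 x y).
Proof.
move=> r0; have /andP[c0 c1] := chi01 N1 y; rewrite normrM (ger0_norm c0).
apply: (@le_trans _ _ (N * (kk y * enorm y) * (jump g1 g2 x y / enorm y ^+ 2))).
  by apply: ler_pM; rewrite ?chi_kk ?ker_le.
have -> : N * (kk y * enorm y) * (jump g1 g2 x y / enorm y ^+ 2) = N * (kk y * (jump g1 g2 x y / enorm y)).
  by field; rewrite gt_eqF.
apply: ler_wpM2l; first exact: ltW.
apply: ler_wpM2l; first exact: kk_ge0.
by rewrite /majorant -addrA lerDl addr_ge0 ?mulr_ge0 ?slope_ge0.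
Qed.

(** The damping is indispensable here: it brings the kernel below N [kk] times [majorant], so that
    the integral in y is at most N |g| times [envelope], a product of functions in L^2. *)
Let F1_lty : (\int[leb2 R]_x \int[leb2 R]_y `|(F1 (x, y))%:E| < +oo)%E.
Proof.
have i := integrable_scale N abs_env_integrable.
have [mi fi] := integrableP _ _ _ i.
apply: le_lt_trans fi; apply: ge0_le_integral; first exact: measurableT.
- by move=> x _; apply: integral_ge0 => y _; rewrite lee_fin.
- have h : measurable_fun setT (fun z => `|(F1 z)%:E|%E) by rewrite /=; mfun.
  by apply: (tonelli4_measurable h) => z; rewrite lee_fin.
- by mfun.
move=> x _; apply: (@le_trans _ _ (N * (`|g x| * envelope K g g1 g2 x))%:E); last by rewrite lee_fin ler_norm.
have mM := measurable_majorant ng n1 n2 x.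
have M0 y : 0 <= majorant K g g1 g2 x y by exact: majorant_ge0.
have mkM : measurable_fun setT (fun y : RR R => (kk y * majorant K g g1 g2 x y)%:E) by mfun.
have kM0 (y : RR R) : setT y -> (0 <= (kk y * majorant K g g1 g2 x y)%:E)%E.
  by move=> _; rewrite lee_fin mulr_ge0 ?kk_ge0 ?M0.
have c0 : (0 <= (N * `|g x|)%:E)%E by rewrite lee_fin mulr_ge0// ltW.
rewrite mulrA EFinM (envelopeE ng n1 n2) -(ge0_integralZl (leb2 R) measurableT mkM kM0 c0).
apply: (@le_integral_off0 _ (fun y => `|F1 (x, y)|) (fun y => N * `|g x| * (kk y * majorant K g g1 g2 x y))).
- by have := sec_y x mF1 => ?; mfun.
- by have := measurable_majorant ng n1 n2 x => ?; mfun.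
- by [].
- by move=> y; rewrite !mulr_ge0 ?kk_ge0 ?M0// ltW.
move=> y r0; rewrite /F1 /= normrM [N * _]mulrC -[leRHS]mulrA; apply: ler_wpM2l => //.
exact: chi_ker_kk.
Qed.

Let wgt_chi y : 0 < enorm y -> wgt N 0 (enorm y ^+ 2) = chi N y / enorm y ^+ 2.
Proof. by move=> r0; rewrite /wgt /chi add0r; field; rewrite !gt_eqF ?exprn_gt0. Qed.

Let slope_shift_sqn (y : RR R) : (sqn (fun x : RR R => slope g1 g2 (x - y)%R) <= (4 * K)%:E)%E.
Proof.
have ms : measurable_fun setT (slope g1 g2) by rewrite /slope; mfun.
rewrite (sqn_shift y ms).
have -> : 4 * K = 2 * K + 2 * K by ring.
by apply: sqn_add_le; [mfun|mfun|rewrite sqn_norm; exact: nice_sqn|rewrite sqn_norm; exact: nice_sqn].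
Qed.

Let F3_int y : (\int[leb2 R]_x `|(F3 (x, y))%:E| <= (8 * K * N * kk y)%:E)%E.
Proof.
have ms : measurable_fun setT (slope g1 g2) by rewrite /slope; mfun.
have mr : measurable_fun setT (fun x : RR R => ratio g x y).
  by have := sec_x y mdl => ?; have := sec_x y mSS => ?; rewrite /ratio; mfun.
have [r0|] := ltP 0 (enorm y); last first.
  move=> r0; have e0 : enorm y = 0 by apply: le_anti; rewrite r0 enorm_ge0.
  have E x : F3 (x, y) = 0.
    by rewrite /F3 /= /conv_slope (enorm_eq0 e0) /= !mulr0 addr0 mul0r mulr0.
  under eq_integral do rewrite E abse0.
  by rewrite integral0 lee_fin !mulr_ge0 ?kk_ge0// ltW.
have p0 : 0 < enorm y ^+ 2 by rewrite exprn_gt0.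
have w0 := wgt_ge0 N1 (lexx 0) p0.
have mv : measurable_fun setT (fun x : RR R => `|slope g1 g2 (x - y) * ratio g x y|%:E) by mfun.
have v0 (x : RR R) : setT x -> (0 <= `|slope g1 g2 (x - y) * ratio g x y|%:E)%E by [].
have Nk0 : (0 <= (N * kk y)%:E)%E by rewrite lee_fin mulr_ge0 ?kk_ge0// ltW.
apply: (@le_trans _ _ (\int[leb2 R]_x ((N * kk y)%:E * `|slope g1 g2 (x - y) * ratio g x y|%:E))%E).
  apply: ge0_le_integral; first exact: measurableT.
  - by [].
  - by have := sec_x y mF3 => ?; rewrite /=; mfun.
  - by apply: measurable_funeM.
  move=> x _; rewrite -EFinM lee_fin /F3 /= normrM (ger0_norm w0) normrM.
  apply: (@le_trans _ _ (wgt N 0 (enorm y ^+ 2) * (slope g1 g2 (x - y) * enorm y * `|ratio g x y|))).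
    by apply: ler_wpM2l => //; apply: ler_wpM2r => //; exact: conv_slope_le.
  have -> : wgt N 0 (enorm y ^+ 2) * (slope g1 g2 (x - y) * enorm y * `|ratio g x y|) =
    (wgt N 0 (enorm y ^+ 2) * enorm y) * (slope g1 g2 (x - y) * `|ratio g x y|) by ring.
  rewrite (normrM (slope g1 g2 (x - y))) (ger0_norm (slope_ge0 _ _ _)).
  by apply: ler_wpM2r; [rewrite mulr_ge0 ?slope_ge0|exact: wgt0_kk].
rewrite (ge0_integralZl (leb2 R) measurableT mv v0 Nk0).
apply: le_trans (lee_wpmul2l Nk0 (sqn_mul _ mr)) _; first by mfun.
apply: le_trans (lee_wpmul2l Nk0 (leeD (slope_shift_sqn y) (ratio_sqn ng r0))) _.
by rewrite -EFinD -EFinM lee_fin le_eqVlt; apply/orP; left; apply/eqP; ring.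
Qed.

Let F3_lty : (\int[leb2 R]_x \int[leb2 R]_y `|(F3 (x, y))%:E| < +oo)%E.
Proof.
apply: (@iterated_lty (fun z => `|F3 z|) (8 * K * N)) => //.
- by mfun.
- by rewrite !mulr_ge0// ltW.
Qed.

(** [ker_by_parts] at -y. Translating x by y moves the gradient to x - y and changes the sign of
    both the tangent term and the ratio, so their product keeps its sign. *)
Let reflect y : (\int[leb2 R]_x (F1 (x, - y))%:E = \int[leb2 R]_x (- F3 (x, y))%:E)%E.
Proof.
have [r0|] := ltP 0 (enorm y); last first.
  move=> r0; have e0 : enorm y = 0 by apply: le_anti; rewrite r0 enorm_ge0.
  apply: eq_integral => x _; rewrite /F1 /F3 /= /ker /conv_slope (enorm_eq0 e0) /=.
  by rewrite !oppr0 !mulr0 !addr0 !mul0r !mulr0 oppr0.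
have rN : 0 < enorm (- y) by rewrite enormN.
have ip : (leb2 R).-integrable setT (EFin \o (fun x => g x * ker g g1 g2 x (- y))).
  have m : measurable_fun setT (fun x : RR R => ker g g1 g2 x (- y)) by exact: (sec_x (- y) mker).
  apply: sqn_mul_integrable => //; first by apply: le_lt_trans (nice_sqn ng) _; exact: ltry.
  apply: le_lt_trans (ltry ((enorm y ^- 2) ^+ 2 * (2 * (4 * K) + 2 * (4 * K)))).
  apply: (sqn_dom (v := fun x => enorm y ^- 2 * jump g1 g2 x (- y))) => //.
  - by rewrite /jump; mfun.
  - by move=> x; rewrite mulrC -(enormN y); exact: ker_le.
  apply: sqn_scale; first by rewrite /jump; mfun.
  by apply: sqn_add_le; [mfun|mfun|rewrite sqn_norm; exact: nice_shift2|rewrite sqn_norm; exact: nice_shift2].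
have it := tangent_ratio_integrable ng n1 n2 rN.
have e1 : (\int[leb2 R]_x (F1 (x, - y))%:E = (chi N y * \int[leb2 R]_x (g x * ker g g1 g2 x (- y)))%:E)%E.
  rewrite -RintegralZl// /Rintegral fineK; last first.
    have h := integrable_fin_num measurableT (integrable_scale (chi N y) ip).
  exact: h.
  apply: eq_integral => x _; rewrite /F1 /= /chi enormN; congr EFin; ring.
rewrite e1 (ker_by_parts ng n1 n2 d1 d2 rN) enormN.
have -> : chi N y * (- (enorm y ^+ 2)^-1 * \int[leb2 R]_x (tangent g1 g2 x (- y) * ratio g x (- y))) =
  - wgt N 0 (enorm y ^+ 2) * \int[leb2 R]_x (tangent g1 g2 x (- y) * ratio g x (- y)).
  by rewrite wgt_chi//; ring.
rewrite -RintegralZl// /Rintegral fineK; last first.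
  have h := integrable_fin_num measurableT (integrable_scale _ it).
  exact: h.
have mf : measurable_fun setT (fun x : RR R => (- wgt N 0 (enorm y ^+ 2) * (tangent g1 g2 x (- y) * ratio g x (- y)))%:E).
  have /measurable_EFinP ? := measurable_int _ it; mfun.
rewrite -(integral_leb2_shift y mf); apply: eq_integral => x _; congr EFin.
rewrite /F3 /= /tangent /conv_slope /ratio /SS /dl !opprK subrK enormN.
rewrite -(sqrrN (g (x - y) - g x)) opprB /=.
by ring.
Qed.

(** Fubini is used twice: first to reach fixed y, where [reflect] integrates by parts in x, then to
    return to fixed x, where the integral of [gap_flux] vanishes. *)
Lemma energy_weight : (\int[leb2 R]_x (g x * \int[leb2 R]_y (chi N y * ker g g1 g2 x y))%:E =
  \int[leb2 R]_x (- \int[leb2 R]_y loss x y)%:E)%E.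
Proof.
have mE1 : measurable_fun setT (EFin \o F1) by mfun.
have mE3 : measurable_fun setT (fun z => (- F3 z)%:E) by mfun.
have lt3 : (\int[leb2 R]_x \int[leb2 R]_y `|(- F3 (x, y))%:E| < +oo)%E.
  rewrite (_ : (\int[leb2 R]_x \int[leb2 R]_y `|(- F3 (x, y))%:E|)%E =
    (\int[leb2 R]_x \int[leb2 R]_y `|(F3 (x, y))%:E|)%E) ?F3_lty//.
  by apply: eq_integral => x _; apply: eq_integral => y _; rewrite /= normrN.
transitivity (\int[leb2 R]_x \int[leb2 R]_y (EFin \o F1) (x, y))%E.
  apply: eq_integral => x _; have i := chi_ker_integrable ng n1 n2 x N1.
  rewrite -RintegralZl// /Rintegral fineK//.
  have h := integrable_fin_num measurableT (integrable_scale (g x) i).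
  exact: h.
rewrite (fubini4 mE1 F1_lty).
have mH : measurable_fun setT (fun y => \int[leb2 R]_x (EFin \o F1) (x, y))%E.
  exact: measurable_int (fubini4_integrable2 mE1 F1_lty).
(* The outer variable is reflected so that the inner integrals take the form treated by
   [reflect]. *)
rewrite -(integral_leb2_opp mH).
rewrite (eq_integral (fun y => \int[leb2 R]_x (- F3 (x, y))%:E)%E); last by move=> y _; exact: reflect.
rewrite -(fubini4 mE3 lt3); apply: eq_integral => x _.
have ig := gap_flux_integrable ng n1 n2 d1 d2 N1 x.
have il := loss_integrable x.
have E y : - F3 (x, y) = - (gap_flux g g1 g2 N x y + loss x y).
  by rewrite /F3 /gap_flux /loss /chi /gain /=; ring.
under eq_integral do rewrite E.
have iS := integrable_plus ig il.
transitivity ((- \int[leb2 R]_y (gap_flux g g1 g2 N x y + loss x y))%:E); last first.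
  by rewrite RintegralD// (gap_flux_integral ng n1 n2 d1 d2 N1) add0r.
rewrite -mulN1r -RintegralZl// /Rintegral fineK; last first.
  have h := integrable_fin_num measurableT (integrable_scale (- 1) iS).
  exact: h.
by apply: eq_integral => y _; rewrite mulN1r.
Qed.

End weight.

Let natS1 n : 1 <= n.+1%:R :> R. Proof. by rewrite ler1n. Qed.

Lemma gap_cvg x y : 2 * n.+1%:R / (n.+1%:R + enorm y ^+ 2) ^+ 2 * gap g x y @[n --> \oo] --> (0 : R).
Proof.
have h : 2 * gap g x y * n.+1%:R^-1 @[n --> \oo] --> (0 : R).
  by rewrite -(mulr0 (2 * gap g x y)); apply: cvgM; [exact: cvg_cst|exact: cvg_harmonic].
apply: (@squeeze_cvgr _ _ _ _ (fun=> 0) (fun n => 2 * gap g x y * n.+1%:R^-1)) => //; last exact: cvg_cst.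
near=> n; have n0 : 0 < n.+1%:R :> R by rewrite ltr0n.
have s0 : 0 < n.+1%:R + enorm y ^+ 2 by rewrite ltr_pwDl// sqr_ge0.
apply/andP; split; first by rewrite !mulr_ge0 ?invr_ge0 ?exprn_ge0 ?gap_ge0// ltW.
rewrite -!mulrA ler_wpM2l// mulrA mulrC ler_wpM2l ?gap_ge0//.
rewrite ler_pdivrMr ?exprn_gt0// mulrC ler_pdivlMr// -expr2 lerXn2r ?nnegrE ?(ltW n0) ?(ltW s0)//.
by rewrite lerDl sqr_ge0.
Unshelve. all: by end_near. Qed.

Lemma loss_cvg x y : loss n.+1%:R x y @[n --> \oo] --> gain x y.
Proof.
have -> : gain x y = 0 + 1 * gain x y by rewrite add0r mul1r.
apply: cvgD; first exact: gap_cvg.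
by apply: cvgM; [exact: chi_cvg|exact: cvg_cst].
Qed.

Let mgx x : measurable_fun setT (gain x) := sec_y x mgain.

Let loss_int_cvg x : \int[leb2 R]_y loss n.+1%:R x y @[n --> \oo] --> \int[leb2 R]_y gain x y.
Proof.
apply: (dct_Rcvg _ _ _ (dom_x_integrable x)).
- by move=> n; exact: (sec_y x (measurable_loss _)).
- exact: mgx.
- by move=> y _; exact: loss_cvg.
- by move=> n y r0; rewrite ger0_norm ?(loss_ge0 (natS1 n))// (loss_le (natS1 n)).
Qed.

Let gain_integrable x : (leb2 R).-integrable setT (EFin \o gain x).
Proof.
apply: (integrable_off0 (mgx x) (dom_x_integrable x)) => y r0.
rewrite ger0_norm ?gain_ge0//; apply: le_trans (gain_le x r0) _.
by have := gain_dom_ge0 x y; lra.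
Qed.

Lemma energy_velocity_integrable :
  (leb2 R).-integrable setT (EFin \o (fun x => g x * velocity g g1 g2 x)).
Proof.
have mv := measurable_velocity ng n1 n2.
apply: (integrable_le _ _ abs_env_integrable) => //; first by mfun.
by move=> x _; rewrite normrM ler_wpM2l// (velocity_envelope ng n1 n2 d1 d2).
Qed.

Definition dissipation : \bar R := (\int[leb2 R]_y \int[leb2 R]_x (gain x y)%:E)%E.

Let gainE : (dissipation = \int[leb2 R]_x (\int[leb2 R]_y gain x y)%:E)%E.
Proof.
have mE : measurable_fun setT (fun z : RR R * RR R => (gain z.1 z.2)%:E) by mfun.
have E0 (z : RR R * RR R) : (0 <= (gain z.1 z.2)%:E)%E by rewrite lee_fin gain_ge0.
rewrite /dissipation -(tonelli4 mE E0); apply: eq_integral => x _.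
by rewrite /Rintegral fineK//; exact: integrable_fin_num (gain_integrable x).
Qed.

(** Both sides of [energy_weight] pass to the limit, the left one under |g| times [envelope], the
    right one under the integral of [gain_dom] in y, which also gives finiteness. *)
Theorem energy_balance : (dissipation < +oo)%E /\
  (\int[leb2 R]_x (g x * velocity g g1 g2 x)%:E = - dissipation)%E.
Proof.
have mv := measurable_velocity ng n1 n2.
have mck n : measurable_fun setT (fun x : RR R => \int[leb2 R]_y (chi n.+1%:R y * ker g g1 g2 x y)).
  have mc := measurable_chi (n.+1%:R : R).
  have m : measurable_fun setT (fun z : RR R * RR R => chi n.+1%:R z.2 * ker g g1 g2 z.1 z.2) by mfun.
  exact: (measurable_param m).
have c1 : (\int[leb2 R]_x (g x * \int[leb2 R]_y (chi n.+1%:R y * ker g g1 g2 x y))%:E)%E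
   @[n --> \oo] --> (\int[leb2 R]_x (g x * velocity g g1 g2 x)%:E)%E.
  apply: (dct_cvg _ _ _ abs_env_integrable).
  - by move=> n; have := mck n => ?; mfun.
  - by mfun.
  - by move=> x _; apply: cvgM; [exact: cvg_cst|exact: (chi_ker_cvg ng n1 n2)].
  - move=> n x _; rewrite normrM ler_wpM2l//; exact: (chi_ker_envelope ng n1 n2 d1 d2 x (natS1 n)).
have ml n : measurable_fun setT (fun x => - \int[leb2 R]_y loss n.+1%:R x y).
  by have := measurable_param (measurable_loss n.+1%:R) => ?; mfun.
have mG : measurable_fun setT (fun x => - \int[leb2 R]_y gain x y).
  by have := measurable_param mgain => ?; mfun.
have cl x : 0 < enorm x -> (- \int[leb2 R]_y loss n.+1%:R x y) @[n --> \oo] --> (- \int[leb2 R]_y gain x y).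
  by move=> _; apply: cvgN; exact: loss_int_cvg.
have bl n x : 0 < enorm x -> `|- \int[leb2 R]_y loss n.+1%:R x y| <= \int[leb2 R]_y gain_dom x y.
  move=> _; have l0 y : 0 <= loss n.+1%:R x y := loss_ge0 (natS1 n) x y.
  have il := loss_integrable (natS1 n) x.
  have md := sec_y x mdom.
  rewrite normrN -lee_fin; apply: (le_trans (norm_integral_le _ md _ _ il)).
  - by exact: (sec_y x (measurable_loss _)).
  - by move=> y; exact: gain_dom_ge0.
  - by move=> y r0; rewrite ger0_norm// (loss_le (natS1 n)).
  by rewrite /Rintegral fineK//; exact: integrable_fin_num (dom_x_integrable x).
have c2 := dct_cvg ml mG cl dom_int_integrable bl.
have i2 := dct_integrable ml mG cl dom_int_integrable bl.
have i3 := integrable_scale (- 1) i2.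
have EN : (\int[leb2 R]_x (- \int[leb2 R]_y gain x y)%:E = - dissipation)%E.
  rewrite gainE -integral_ge0N//.
  by move=> x _; rewrite lee_fin; apply: Rintegral_ge0 => y _; exact: gain_ge0.
split.
  rewrite gainE; have [_] := integrableP _ _ _ i2; apply: le_lt_trans.
  rewrite le_eqVlt; apply/orP; left; apply/eqP; apply: eq_integral => x _ /=.
  by rewrite normrN ger0_norm//; apply: Rintegral_ge0 => y _; exact: gain_ge0.
have c3 : (\int[leb2 R]_x (g x * \int[leb2 R]_y (chi n.+1%:R y * ker g g1 g2 x y))%:E)%E
   @[n --> \oo] --> (\int[leb2 R]_x (- \int[leb2 R]_y gain x y)%:E)%E.
  by under eq_fun do rewrite (energy_weight (natS1 _)); exact: c2.
by rewrite -EN; exact: (cvg_unique _ c1 c3).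
Qed.

End energy_identity.

(** * Regularity of functions in H^l *)

Section plane_continuous.
Context {R : realType}.

(** Links the product topology to the product sigma-algebra: an open set is the union of the
    countably many rational squares it contains. *)
Lemma open_measurable_plane (U : set (R * R)) : open U -> measurable (U : set (RR R)).
Proof.
move=> oU; pose e (n : nat) : R := n.+1%:R^-1.
pose B (t : rat * rat * nat) : set (RR R) :=
  `]ratr t.1.1 - e t.2, ratr t.1.1 + e t.2[%classic `*` `]ratr t.1.2 - e t.2, ratr t.1.2 + e t.2[%classic.
pose F t := if `[< B t `<=` U >] then B t else set0.
have -> : U = \bigcup_t F t.
  apply/seteqP; split => [x Ux|x [t _]]; last first.
    by rewrite /F; case: asboolP => // h /h.
  have := oU x Ux; rewrite nbhsE /= => -[V [oV Vx] VU].
  have : nbhs x U by apply: open_nbhs_nbhs.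
  case=> -[A C] /= [[h1 /= h10 A1] [h2 /= h20 A2]] hAB.
  pose h := Num.min h1 h2; have h0 : 0 < h by rewrite lt_min h10.
  have m1 : h <= h1 by rewrite ge_min lexx.
  have m2 : h <= h2 by rewrite ge_min lexx orbT.
  (* A square of half-side 1/(n+1) whose centre is within 1/(n+1) of x in each coordinate stays
     within 2/(n+1) < h of x. *)
  pose n := Num.truncn (2 / h).
  have en : 2 * e n < h.
    have := truncnS_gt (2 / h); rewrite -/n ltr_pdivrMr// mulrC => H.
    by rewrite /e ltr_pdivrMr// mulrC.
  have e0 : 0 < e n by rewrite invr_gt0.
  have [q1 Q1] : exists q : rat, ratr q \in `]x.1 - e n, x.1 + e n[.
    by apply: rat_in_itvoo; lra.
  have [q2 Q2] : exists q : rat, ratr q \in `]x.2 - e n, x.2 + e n[.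
    by apply: rat_in_itvoo; lra.
  rewrite in_itv/= in Q1; rewrite in_itv/= in Q2.
  have [/andP[? ?] /andP[? ?]] := (Q1, Q2).
  exists (q1, q2, n) => //; rewrite /F asboolT.
    by rewrite /B /=; split; rewrite /= in_itv/=; apply/andP; split; lra.
  move=> [z1 z2] [] /=; rewrite !in_itv/= => /andP[? ?] /andP[? ?].
  apply: hAB; split => /=.
    by apply: A1; rewrite /= ltr_distlC; apply/andP; split; lra.
  by apply: A2; rewrite /= ltr_distlC; apply/andP; split; lra.
apply: countable_bigcupT_measurable; first exact: countableP.
move=> t; rewrite /F; case: ifP => _ //.
by apply: measurableX; exact: measurable_itv.
Qed.

Lemma continuous_measurable_plane (w : R * R -> R) : continuous w ->
  measurable_fun setT (w : RR R -> R).
Proof.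
move=> /continuousP cw; apply: (measurability _ (RGenOpens.measurableE R)).
move=> _ [_ [a [b ->] <-]]; rewrite setTI; apply: open_measurable_plane.
exact/cw/interval_open.
Qed.

Lemma partial_eq0 (K : set (R * R)) (w : R * R -> R) a : open (~` K) ->
  (forall x, ~ K x -> w x = 0) -> forall x, ~ K x -> partial a w x = 0.
Proof.
move=> oK.
have step (v : R * R) u : (forall x, ~ K x -> u x = 0) -> forall x, ~ K x -> 'D_v u x = 0.
  move=> h x nx; have E : \forall z \near x, u z = cst 0 z.
    have := oK _ nx; rewrite nbhsE /= => -[V [oV Vx] VK].
    apply: filterS (open_nbhs_nbhs (conj oV Vx)) => z Vz; apply: h; exact: VK.
  by rewrite (near_eq_derive v E) derive_cst.
rewrite /partial => w0; elim: a.1 => [|n IH] /=; last exact: step.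
by elim: a.2 => [|n IH] //=; exact: step.
Qed.

(** Makes the products in [is_weak_partial] integrable, so that the integrals there are additive and
    weak derivatives can be subtracted. *)
Lemma test_L2 (phi : R * R -> R) a : test_function phi -> L2 (partial a phi).
Proof.
move=> [dphi cK]; set K := closure _ in cK.
have cp b : continuous (partial b phi) by move=> x; exact: differentiable_continuous (dphi b x).
have mp : measurable_fun setT (partial a phi : RR R -> R) by exact: continuous_measurable_plane.
have K0 x : ~ K x -> phi x = 0.
  move=> nx; apply/eqP/negPn/negP => px; apply: nx; exact: subset_closure.
have p0 : forall x, ~ K x -> partial a phi x = 0.
  by apply: partial_eq0 => //; apply: closed_openC; exact: closed_closure.
have bd (u : R * R -> R) : continuous u -> exists M, forall x, K x -> `|u x| <= M.
  move=> cu; have [[x0 Kx0]|nK] := pselect (exists x, K x); last first.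
    by exists 0 => x Kx; case: nK; exists x.
  have ca : {within K, continuous (fun x => `|u x|)}.
    by apply: continuous_subspaceT => x; apply: cvg_norm; exact: cu.
  have [c _ hc] := compact_EVT_max (ex_intro _ x0 Kx0) cK ca.
  by exists `|u c| => x Kx; apply: hc; rewrite inE.
have [M hM] := bd _ (cp a).
have [M1 hM1] := bd fst (fun x => @cvg_fst _ _ _ _ _).
have [M2 hM2] := bd snd (fun x => @cvg_snd _ _ _ _ _).
apply/L2P; split => //.
have ib := integrable_scale (M ^+ 2) (box_integrable (- M1) M1 (- M2) M2).
have i : (leb2 R).-integrable setT (EFin \o (fun x => partial a phi x ^+ 2)).
  apply: (integrable_le _ _ ib) => //; first by mfun.
  move=> x _; rewrite ger0_norm ?sqr_ge0// boxE.
  have [Kx|nx] := pselect (K x); last by rewrite p0// expr0n/= mulr_ge0 ?sqr_ge0.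
  have := hM1 x Kx; have := hM2 x Kx; rewrite !ler_norml => -> ->.
  have := hM x Kx; rewrite mulr1 -(real_normK (num_real (partial a phi x))) => h.
  by rewrite lerXn2r ?nnegrE//; exact: le_trans h.
have [_] := integrableP _ _ _ i; apply: le_lt_trans.
rewrite le_eqVlt; apply/orP; left; apply/eqP; apply: eq_integral => x _ /=.
by rewrite ger0_norm ?sqr_ge0.
Qed.

Lemma L2_mul_integrable (u v : R * R -> R) : L2 u -> L2 v ->
  (leb2 R).-integrable setT (EFin \o (fun x => u x * v x)).
Proof. by move=> /L2P[mu hu] /L2P[mv hv]; exact: sqn_mul_integrable. Qed.

Lemma L2_sub (u v : R * R -> R) : L2 u -> L2 v -> L2 (u \- v).
Proof.
move=> /L2P[mu hu] /L2P[mv hv].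
have mN : measurable_fun setT (fun x : RR R => - v x) by mfun.
apply/L2P; split; first exact: (mfun_add mu mN).
apply: le_lt_trans (sqn_add mu mN) _.
have -> : sqn (fun x : RR R => - v x) = sqn v by apply: eq_integral => x _; rewrite sqrrN.
by apply: lte_add_pinfty; apply: lte_mul_pinfty.
Qed.

Lemma weak_partial_sub a (u v hu hv : R * R -> R) : L2 u -> L2 v -> L2 hu -> L2 hv ->
  is_weak_partial a u hu -> is_weak_partial a v hv -> is_weak_partial a (u \- v) (hu \- hv).
Proof.
move=> u2 v2 hu2 hv2 wu wv phi tp.
have p2 := test_L2 a tp; have q2 := test_L2 (0%N, 0%N) tp.
have E1 : \int[leb2 R]_x ((u \- v) x * partial a phi x) =
  \int[leb2 R]_x (u x * partial a phi x) - \int[leb2 R]_x (v x * partial a phi x).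
  rewrite -RintegralB//; [|exact: L2_mul_integrable|exact: L2_mul_integrable].
  by apply: eq_Rintegral => x _ /=; rewrite mulrBl.
have E2 : \int[leb2 R]_x ((hu \- hv) x * phi x) =
  \int[leb2 R]_x (hu x * phi x) - \int[leb2 R]_x (hv x * phi x).
  rewrite -RintegralB//; [|exact: (L2_mul_integrable hu2 q2)|exact: (L2_mul_integrable hv2 q2)].
  by apply: eq_Rintegral => x _ /=; rewrite mulrBl.
by rewrite E1 E2 wu// wv// mulrBr.
Qed.

Definition regular (K : R) (g : R * R -> R) := exists g1 g2,
  [/\ nice K g, nice K g1, nice K g2, der1 g g1 & der2 g g2].

Lemma weak_partialP a (g : R * R -> R) : (exists h, L2 h /\ is_weak_partial a g h) ->
  L2 (weak_partial a g) /\ is_weak_partial a g (weak_partial a g).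
Proof. by move=> [h Hh]; rewrite /weak_partial; case: xgetP => [k -> //|/(_ h)]. Qed.

(** Since l >= 3, the term is one of the nonnegative summands; squaring removes the root in the
    definition of the norm. *)
Lemma sobolev_norm_ge (l : R) (g : R * R -> R) (i j : nat) : 3 <= l -> (i + j <= 3)%N ->
  (L2norm (weak_partial (i, j) g) ^+ 2 <= sobolev_norm l g ^+ 2)%E.
Proof.
move=> l3 ij; rewrite /sobolev_norm; set k := Num.truncn l.
have k3 : (3 <= k)%N by rewrite truncn_ge_nat//; apply: le_trans l3.
set S := (\sum_(a < k.+1) _)%E; set X := (if _ then _ else _)%E.
have sq0 (u : R * R -> R) : (0 <= L2norm u ^+ 2)%E by rewrite L2norm_sqr; exact: sqn_ge0.
have X0 : (0 <= X)%E.
  rewrite /X; case: ifP => // _; apply: sume_ge0 => a _.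
  apply: integral_ge0 => y _; apply: integral_ge0 => x _.
  by rewrite lee_fin divr_ge0 ?sqr_ge0 ?powR_ge0.
have S0 : (0 <= S)%E by apply: sume_ge0 => a _; apply: sume_ge0.
have -> : ((S + X) `^ 2^-1 ^+ 2 = S + X)%E.
  rewrite -poweR2 ?poweR_ge0// -poweRrM mulVf ?pnatr_eq0// poweRe1//; exact: adde_ge0.
apply: (@le_trans _ _ S); last by rewrite leeDl.
have ik : (i < k.+1)%N by lia.
have jk : (j < k.+1)%N by lia.
rewrite /S (bigD1 (Ordinal ik))//= (bigD1 (Ordinal jk)) /=; last by lia.
rewrite -addeA leeDl//; apply: adde_ge0.
  by apply: sume_ge0 => b _; exact: sq0.
by apply: sume_ge0 => a _; apply: sume_ge0 => b _; exact: sq0.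
Qed.

Lemma sobolev_nice (l e : R) (g : R * R -> R) : 3 <= l -> 0 <= e -> continuous g -> L2 g ->
  (forall a : nat * nat, (a.1 + a.2 <= 3)%N -> exists h, L2 h /\ is_weak_partial a g h) ->
  (sobolev_norm l g <= e%:E)%E -> regular (e ^+ 2) g.
Proof.
move=> l3 e0 cg g2 hw ge.
have s0 : (0 <= sobolev_norm l g)%E by rewrite /sobolev_norm poweR_ge0.
apply: (@sobolev_regular _ g (fun i j => weak_partial (i, j) g)) => // [|i j ij].
  exact: sqr_ge0.
have [h2 w] := weak_partialP (hw (i, j) ij); split => //.
rewrite -[sqn _]L2norm_sqr; apply: le_trans (sobolev_norm_ge g l3 ij) _.
by rewrite EFin_expe lee_sqr// lee_fin.
Qed.

Lemma nice_addition (K K' : R) (u v : RR R -> R) : nice K u -> nice K' v ->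
  nice (2 * (K + K')) (fun x => u x + v x).
Proof.
move=> nu nv; have mu := nice_m nu; have mv := nice_m nv.
have sq (a b A B : R) : a ^+ 2 <= A -> b ^+ 2 <= B -> (a + b) ^+ 2 <= 2 * (A + B).
  by move=> ha hb; have := sqr_ge0 (a - b); nra.
split.
- by mfun.
- move=> x; apply: le_trans (sq _ _ _ _ (nice_sup nu x) (nice_sup nv x)) _; lra.
- apply: le_trans (sqn_add_le mu mv (nice_sqn nu) (nice_sqn nv)) _; rewrite lee_fin; lra.
- move=> a b c; have := sq _ _ _ _ (nice_h1 nu a b c) (nice_h1 nv a b c).
  rewrite (_ : u (b, c) - u (a, c) + (v (b, c) - v (a, c)) = u (b, c) + v (b, c) - (u (a, c) + v (a, c))); last by ring.
  by move=> h; apply: le_trans h _; rewrite le_eqVlt; apply/orP; left; apply/eqP; ring.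
- move=> a b c; have := sq _ _ _ _ (nice_h2 nu a b c) (nice_h2 nv a b c).
  rewrite (_ : u (a, b) - u (a, c) + (v (a, b) - v (a, c)) = u (a, b) + v (a, b) - (u (a, c) + v (a, c))); last by ring.
  by move=> h; apply: le_trans h _; rewrite le_eqVlt; apply/orP; left; apply/eqP; ring.
- move=> h; have m1 : measurable_fun setT (fun x : RR R => u (x.1 + h, x.2) - u x) by mfun.
  have m2 : measurable_fun setT (fun x : RR R => v (x.1 + h, x.2) - v x) by mfun.
  have := sqn_add_le m1 m2 (nice_d1 nu h) (nice_d1 nv h).
  have -> : (fun x : RR R => u (x.1 + h, x.2) - u x + (v (x.1 + h, x.2) - v x)) =
    (fun x => u (x.1 + h, x.2) + v (x.1 + h, x.2) - (u x + v x)) by apply/funext => x; ring.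
  by move=> H; apply: le_trans H _; rewrite lee_fin le_eqVlt; apply/orP; left; apply/eqP; ring.
- move=> h; have m1 : measurable_fun setT (fun x : RR R => u (x.1, x.2 + h) - u x) by mfun.
  have m2 : measurable_fun setT (fun x : RR R => v (x.1, x.2 + h) - v x) by mfun.
  have := sqn_add_le m1 m2 (nice_d2 nu h) (nice_d2 nv h).
  have -> : (fun x : RR R => u (x.1, x.2 + h) - u x + (v (x.1, x.2 + h) - v x)) =
    (fun x => u (x.1, x.2 + h) + v (x.1, x.2 + h) - (u x + v x)) by apply/funext => x; ring.
  by move=> H; apply: le_trans H _; rewrite lee_fin le_eqVlt; apply/orP; left; apply/eqP; ring.
Qed.

Lemma regular_add (K K' : R) (u v : R * R -> R) : regular K u -> regular K' v ->
  regular (2 * (K + K')) (fun x => u x + v x).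
Proof.
move=> [u1 [u2 [nu nu1 nu2 du1 du2]]] [v1 [v2 [nv nv1 nv2 dv1 dv2]]].
exists (fun x => u1 x + v1 x), (fun x => u2 x + v2 x); split.
- exact: nice_addition.
- exact: nice_addition.
- exact: nice_addition.
- by move=> x; exact: (der_add (du1 x) (dv1 x)).
- by move=> x; exact: (der_add (du2 x) (dv2 x)).
Qed.

Lemma regular_opp (K : R) (u : R * R -> R) : regular K u -> regular K (fun x => - u x).
Proof.
move=> [u1 [u2 [nu nu1 nu2 du1 du2]]].
have nN w : nice K w -> nice K (fun x => - w x).
  move=> nw; have mw := nice_m nw; split.
  - by mfun.
  - by move=> x; rewrite sqrrN; exact: nice_sup.
  - rewrite (_ : sqn _ = sqn w); first exact: nice_sqn.
    by apply: eq_integral => x _; rewrite sqrrN.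
  - by move=> a b c; rewrite -opprD sqrrN; exact: nice_h1.
  - by move=> a b c; rewrite -opprD sqrrN; exact: nice_h2.
  - move=> h; apply: le_trans (nice_d1 nw h); rewrite le_eqVlt; apply/orP; left; apply/eqP.
    by apply: eq_integral => x _; rewrite -opprD sqrrN.
  - move=> h; apply: le_trans (nice_d2 nw h); rewrite le_eqVlt; apply/orP; left; apply/eqP.
    by apply: eq_integral => x _; rewrite -opprD sqrrN.
exists (fun x => - u1 x), (fun x => - u2 x); split; try exact: nN.
- by move=> x; exact: (der_opp (du1 x)).
- by move=> x; exact: (der_opp (du2 x)).
Qed.

End plane_continuous.

(** * Continuity of the dissipation *)

Section dissipation_continuity.
Context {R : realType}.

Definition kk_mass : R := fine (\int[leb2 R]_y (kk y)%:E)%E.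
Definition kh_mass : R := fine (\int[leb2 R]_y (kh y)%:E)%E.

Lemma kk_massE : (kk_mass%:E = \int[leb2 R]_y (kk y)%:E)%E.
Proof.
rewrite /kk_mass fineK// ge0_fin_numE ?kk_lty//.
by apply: integral_ge0 => y _; rewrite lee_fin kk_ge0.
Qed.

Lemma kh_massE : (kh_mass%:E = \int[leb2 R]_y (kh y)%:E)%E.
Proof.
rewrite /kh_mass fineK// ge0_fin_numE ?kh_lty//.
by apply: integral_ge0 => y _; rewrite lee_fin kh_ge0.
Qed.

Lemma kk_mass_ge0 : 0 <= kk_mass.
Proof. by rewrite -lee_fin kk_massE integral_ge0// => y _; rewrite lee_fin kk_ge0. Qed.

Section compare.
Variables (K d e : R) (u w : RR R -> R).
Hypotheses (nu : nice K u) (nw : nice K w) (nd : nice d (fun x => u x - w x)).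
Hypotheses (e0 : 0 < e).

(** Young's inequality with parameter [e]: a^2 - b^2 = (a - b)(a + b) <= (a - b)^2 / e + 2 e (a^2 +
    b^2). The first part is small with [u - w], the second with [e]. *)
Let dom (x y : RR R) : R := (e^-1) * gain_dom (fun x => u x - w x) x y
  + 2 * e * (gain_dom u x y + gain_dom w x y).

Let gain_off (g : RR R -> R) (x y : RR R) : enorm y = 0 -> gain g x y = 0.
Proof.
move=> r0; have y0 : y = 0 by rewrite (enorm_eq0 r0).
by rewrite /gain /SS r0 y0 /dl subr0 subrr expr0n/= addr0 sqrtr0 subrr.
Qed.

Let dom_ge0 x y : 0 <= dom x y.
Proof.
have h (g : RR R -> R) := gain_dom_ge0 g x y.
rewrite /dom; apply: addr_ge0; apply: mulr_ge0 => //.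
- by rewrite invr_ge0 ltW.
- by rewrite mulr_ge0// ltW.
- exact: addr_ge0.
Qed.

(** The gains differ by (S - S') / (S S'), where S and S' belong to [u] and [w]. If S > S', then 2 r
    (S - S') <= S^2 - S'^2 = a^2 - b^2, with a and b the increments, and S S' >= r^2. *)
Let gain_compare x y : gain u x y <= gain w x y + dom x y.
Proof.
have [r0|] := ltP 0 (enorm y); last first.
  move=> r0; have e0' : enorm y = 0 by apply: le_anti; rewrite r0 enorm_ge0.
  by rewrite !gain_off// add0r dom_ge0.
have Su := SS_gt0 u x r0; have Sw := SS_gt0 w x r0.
have Eu := SS_sqr u x y; have Ew := SS_sqr w x y.
have ru := SS_enorm u x y; have rw := SS_enorm w x y.
have -> : gain u x y = gain w x y + ((SS w x y)^-1 - (SS u x y)^-1) by rewrite /gain; ring.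
rewrite lerD2l.
have -> : dom x y = (e^-1 * (dl u x y - dl w x y) ^+ 2 + 2 * e * (dl u x y ^+ 2 + dl w x y ^+ 2)) / enorm y ^+ 3.
  rewrite /dom /gain_dom.
  have -> : dl (fun x => u x - w x) x y = dl u x y - dl w x y by rewrite /dl; ring.
  by move: (dl u x y) (dl w x y) => a b; field; rewrite !gt_eqF.
move: (dl u x y) (dl w x y) (SS u x y) (SS w x y) (enorm y) Su Sw Eu Ew ru rw r0.
move=> a b S S' r S0 S0' ES ES' rS rS' r0.
set X := (e^-1 * (a - b) ^+ 2 + _).
have X0 : 0 <= X.
  apply: addr_ge0; apply: mulr_ge0; rewrite ?sqr_ge0 ?invr_ge0 ?(ltW e0)//.
    by rewrite mulr_ge0// ltW.
  by rewrite addr_ge0 ?sqr_ge0.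
have r3 : 0 < r ^+ 3 by rewrite exprn_gt0.
have [SS'|SS'] := leP S S'.
  apply: (@le_trans _ _ 0); last by rewrite divr_ge0// ltW.
  by rewrite subr_le0 lef_pV2.
have key : (S - S') * r <= X.
  have h1 : (S - S') * (2 * r) <= (S - S') * (S + S') by rewrite ler_wpM2l ?subr_ge0 ?(ltW SS')//; lra.
  have h2 : (S - S') * (S + S') = a ^+ 2 - b ^+ 2.
    have -> : a ^+ 2 = S ^+ 2 - r ^+ 2 by rewrite ES; ring.
    have -> : b ^+ 2 = S' ^+ 2 - r ^+ 2 by rewrite ES'; ring.
    ring.
  have h3 : e * (a ^+ 2 - b ^+ 2) <= e * X.
    have -> : e * X = (a - b) ^+ 2 + 2 * e ^+ 2 * (a ^+ 2 + b ^+ 2) by rewrite /X; field; rewrite gt_eqF.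
    have := sqr_ge0 ((a - b) - e * (a + b)); have := sqr_ge0 (e * (a - b)).
    have := sqr_ge0 (a - b); have := sqr_ge0 (e * (a + b)); rewrite !exprMn; nra.
  rewrite ler_pM2l// in h3.
  have h4 : 0 <= (S - S') * r by rewrite mulr_ge0 ?subr_ge0 ?(ltW SS') ?(ltW r0).
  lra.
have -> : S'^-1 - S^-1 = (S - S') / (S * S') by field; rewrite !gt_eqF.
rewrite ler_pdivrMr ?mulr_gt0// mulrAC ler_pdivlMr//.
have h5 : r * r <= S * S' by apply: ler_pM => //; exact: ltW.
have -> : (S - S') * r ^+ 3 = ((S - S') * r) * (r * r) by ring.
by apply: ler_pM => //; rewrite mulr_ge0 ?subr_ge0 ?(ltW SS') ?(ltW r0).
Qed.

Let mgain (g : RR R -> R) : measurable_fun setT g ->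
  measurable_fun setT (fun z : RR R * RR R => (gain g z.1 z.2)%:E).
Proof. by move=> mg; rewrite /gain /SS /dl; mfun. Qed.

Let mdom1 (g : RR R -> R) y : measurable_fun setT g ->
  measurable_fun setT (fun x : RR R => (gain_dom g x y)%:E).
Proof. by move=> mg; rewrite /gain_dom /dl; mfun. Qed.

Let mgain1 (g : RR R -> R) y : measurable_fun setT g ->
  measurable_fun setT (fun x : RR R => (gain g x y)%:E).
Proof. by move=> mg; rewrite /gain /SS /dl; mfun. Qed.

Let mu := nice_m nu.
Let mw := nice_m nw.
Let md := nice_m nd.

Let dom_int y : (\int[leb2 R]_x (dom x y)%:E <= (8 * (d / e + 4 * e * K))%:E * (kk y)%:E)%E.
Proof.
have pos (g : RR R -> R) x : setT x -> (0 <= (gain_dom g x y)%:E)%E.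
  by move=> _; rewrite lee_fin gain_dom_ge0.
have ei : (0 <= (e^-1)%:E)%E by rewrite lee_fin invr_ge0 ltW.
have ee : (0 <= (2 * e)%:E)%E by rewrite lee_fin mulr_ge0// ltW.
have m1 := mdom1 y md; have m2 := mdom1 y mu; have m3 := mdom1 y mw.
rewrite /dom; under eq_integral do rewrite EFinD (EFinM e^-1) (EFinM (2 * e)) (EFinD (gain_dom u _ _)).
rewrite ge0_integralD//; last 4 first.
- by move=> x Tx; apply: mule_ge0 => //; exact: pos.
- exact: measurable_funeM.
- by move=> x Tx; apply: mule_ge0 => //; apply: adde_ge0; exact: pos.
- by apply: measurable_funeM; exact: emeasurable_funD.
rewrite (ge0_integralZl (leb2 R) measurableT m1 (pos _) ei).
have m23 : measurable_fun setT (fun x : RR R => ((gain_dom u x y)%:E + (gain_dom w x y)%:E)%E).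
  exact: emeasurable_funD.
have pos23 x : setT x -> (0 <= (gain_dom u x y)%:E + (gain_dom w x y)%:E)%E.
  by move=> Tx; apply: adde_ge0; exact: pos.
rewrite (ge0_integralZl (leb2 R) measurableT m23 pos23 ee).
rewrite (ge0_integralD (leb2 R) measurableT (pos u) m2 (pos w) m3).
apply: (@le_trans _ _ ((e^-1)%:E * (8 * d * kk y)%:E + (2 * e)%:E * ((8 * K * kk y)%:E + (8 * K * kk y)%:E))%E).
  apply: leeD; apply: lee_wpmul2l => //; first exact: gain_dom_int nd y.
  by apply: leeD; [exact: gain_dom_int nu y|exact: gain_dom_int nw y].
have -> : ((8 * K * kk y)%:E + (8 * K * kk y)%:E = (16 * K * kk y)%:E)%E.
  by rewrite -EFinD; congr EFin; ring.
by rewrite -!EFinM -EFinD lee_fin le_eqVlt; apply/orP; left; apply/eqP; ring.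
Qed.

(** Integrates [gain_compare] over pairs. With [d] of order e^2 the error is of order [e], which is
    the source of continuity in time. *)
Lemma dissipation_compare :
  (dissipation u <= dissipation w + (8 * (d / e + 4 * e * K) * kk_mass)%:E)%E.
Proof.
have d0 : 0 <= d := nice_K nd; have K0 : 0 <= K := nice_K nu.
have c0 : (0 <= (8 * (d / e + 4 * e * K))%:E)%E.
  by rewrite lee_fin mulr_ge0// addr_ge0 ?divr_ge0 ?mulr_ge0 ?(ltW e0).
have gp (g : RR R -> R) (z : RR R * RR R) : (0 <= (gain g z.1 z.2)%:E)%E by rewrite lee_fin gain_ge0.
have gp1 (g : RR R -> R) y x : setT x -> (0 <= (gain g x y)%:E)%E by move=> _; rewrite lee_fin gain_ge0.
have mkk := @measurable_kk R.
have mkE : measurable_fun setT (fun y : RR R => (kk y)%:E) by mfun.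
have kk0 (y : RR R) : setT y -> (0 <= (kk y)%:E)%E by move=> _; rewrite lee_fin kk_ge0.
have mdomy y : measurable_fun setT (fun x : RR R => (dom x y)%:E).
  by rewrite /dom /gain_dom /dl; mfun.
rewrite EFinM kk_massE -(ge0_integralZl (leb2 R) measurableT mkE kk0 c0) /dissipation.
have mW := tonelli4_measurable2 (mgain mw) (gp w).
have pW (y : RR R) : setT y -> (0 <= \int[leb2 R]_x (gain w x y)%:E)%E.
  by move=> _; apply: integral_ge0 => x; exact: gp1.
have pk (y : RR R) : setT y -> (0 <= (8 * (d / e + 4 * e * K))%:E * (kk y)%:E)%E.
  by move=> Ty; apply: mule_ge0 => //; exact: kk0.
have mk : measurable_fun setT (fun y : RR R => (8 * (d / e + 4 * e * K))%:E * (kk y)%:E)%E.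
  exact: measurable_funeM.
rewrite -(ge0_integralD (leb2 R) measurableT pW mW pk mk).
apply: ge0_le_integral; first exact: measurableT.
- by move=> y _; apply: integral_ge0 => x; exact: gp1.
- exact: tonelli4_measurable2 (mgain mu) (gp u).
- exact: emeasurable_funD.
move=> y _; apply: le_trans (leeD (le_refl _) (dom_int y)).
have pd x : setT x -> (0 <= (dom x y)%:E)%E by move=> _; rewrite lee_fin.
rewrite -(ge0_integralD (leb2 R) measurableT (gp1 w y) (mgain1 y mw) pd (mdomy y)).
apply: ge0_le_integral; first exact: measurableT.
- exact: gp1.
- exact: mgain1.
- by apply: emeasurable_funD; [exact: mgain1|exact: mdomy].
- by move=> x _; rewrite -EFinD lee_fin; exact: gain_compare.
Qed.

End compare.

(** Written with the actual partial derivatives instead of witnesses, so that it depends on [g]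
    alone and can be followed in time. *)
Definition vel (g : RR R -> R) := velocity g (partial1 g) (partial2 g).

Lemma regularE K (g : R * R -> R) : regular K g ->
  [/\ nice K g, nice K (partial1 g), nice K (partial2 g), der1 g (partial1 g) & der2 g (partial2 g)].
Proof.
move=> [g1 [g2 [ng n1 n2 dg1 dg2]]].
have -> : partial1 g = g1 by apply/funext => x; exact: partial1_der (dg1 x).
by have -> : partial2 g = g2 by apply/funext => x; exact: partial2_der (dg2 x).
Qed.

Definition vel_sup (K : R) : R := (12 * bnd K ^+ 2 + 8 * bnd K) * kh_mass.
Definition vel_L2 (K : R) : R := kk_mass * (kk_mass * (600 * K + 864 * bnd K ^+ 2 * K)).

Section regular_vel.
Variables (K : R) (g : R * R -> R).
Hypothesis rg : regular K g.

Lemma vel_le x : `|vel g x| <= vel_sup K.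
Proof.
have [ng n1 n2 d1 d2] := regularE rg.
rewrite -lee_fin /vel_sup EFinM kh_massE; exact: (velocity_bound ng n1 n2 d1 d2).
Qed.

Lemma vel_sqn : (sqn (vel g) <= (vel_L2 K)%:E)%E.
Proof.
have [ng n1 n2 d1 d2] := regularE rg.
rewrite /vel_L2 2!(EFinM kk_mass) kk_massE; exact: (velocity_sqn ng n1 n2 d1 d2).
Qed.

Lemma measurable_vel : measurable_fun setT (vel g).
Proof. by have [ng n1 n2 d1 d2] := regularE rg; exact: measurable_velocity ng n1 n2. Qed.

Lemma vel_pv x v : has_pv (muskat_integrand g x) v -> v = vel g x.
Proof. by have [ng n1 n2 d1 d2] := regularE rg; exact: (velocity_pv ng n1 n2 d1 d2). Qed.

Lemma dissipation_fin : dissipation g \is a fin_num.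
Proof.
have [ng n1 n2 d1 d2] := regularE rg.
rewrite ge0_fin_numE; first exact: (energy_balance ng n1 n2 d1 d2).1.
by apply: integral_ge0 => y _; apply: integral_ge0 => x _; rewrite lee_fin gain_ge0.
Qed.

Lemma vel_energy_integrable : (leb2 R).-integrable setT (EFin \o (fun x => g x * vel g x)).
Proof.
have [ng n1 n2 d1 d2] := regularE rg.
exact: (energy_velocity_integrable ng n1 n2 d1 d2).
Qed.

Lemma vel_energy : \int[leb2 R]_x (g x * vel g x) = - fine (dissipation g).
Proof.
have [ng n1 n2 d1 d2] := regularE rg.
by rewrite /Rintegral (energy_balance ng n1 n2 d1 d2).2 fineN.
Qed.

End regular_vel.

End dissipation_continuity.

(** * Evolution in time *)

Section time_tools.
Context {R : realType}.

Lemma within_ball (T t : R) (P : R -> Prop) :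
  (\forall s \near within `[0, T] (nbhs t), P s) ->
  exists2 d : R, 0 < d & forall s, 0 <= s <= T -> `|s - t| < d -> P s.
Proof.
move=> [d /= d0 h]; exists d => // s sT st; apply: h => /=; first by rewrite distrC.
by rewrite in_itv.
Qed.

Lemma cvg_within (T t : R) (F : R -> R) :
  (forall e, 0 < e -> exists2 d : R, 0 < d &
    forall s, 0 <= s <= T -> `|s - t| < d -> `|F s - F t| <= e) ->
  F s @[s --> within `[0, T] (nbhs t)] --> F t.
Proof.
move=> h; apply/cvgrPdist_le => e e0; have [d d0 hd] := h e e0.
exists d => //= s /= st; rewrite in_itv/= => sT; rewrite distrC; apply: hd => //.
by rewrite distrC.
Qed.

Lemma is_derive_bound (F : R -> R) (t a : R) :
  (forall e, 0 < e -> exists2 d : R, 0 < d &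
    forall s, s != t -> `|s - t| < d -> `|F s - F t - a * (s - t)| <= e * `|s - t|) ->
  is_derive t 1 F a.
Proof.
move=> h; suff H : (fun h : R => h^-1 *: (F (h *: 1 + t) - F t)) h @[h --> 0^'] --> a.
  apply: DeriveDef; first by apply/cvg_ex; exists a; exact: H.
  by apply/cvg_lim.
apply/cvgrPdist_le => e e0; have [d d0 hd] := h e e0.
exists d => //= s /=; rewrite sub0r normrN => sd s0.
have E : s *: (1 : R) + t - t = s by rewrite addrK /GRing.scale /= mulr1.
have := hd (s *: 1 + t); rewrite E => H.
have {}H := H _ sd.
rewrite -(ler_pM2r (_ : 0 < `|s|)) ?normr_gt0// -normrM mulrBl distrC.
have -> : s^-1 *: (F (s *: (1 : R) + t) - F t) * s = F (s *: (1 : R) + t) - F t.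
  by rewrite /GRing.scale /= mulrAC mulVf// mul1r.
by apply: H; rewrite -subr_eq0 E.
Qed.

Lemma sqn_add_e (u v : RR R -> R) (e : R) : 0 < e ->
  measurable_fun setT u -> measurable_fun setT v ->
  (sqn (fun x => u x + v x)%R <= (1 + e)%:E * sqn u + (1 + e^-1)%:E * sqn v)%E.
Proof.
move=> e0 mu mv.
have pos (w : RR R -> R) x : setT x -> (0 <= (w x ^+ 2)%:E)%E by move=> _; rewrite lee_fin sqr_ge0.
have mu2 : measurable_fun setT (fun x => (u x ^+ 2)%:E) by mfun.
have mv2 : measurable_fun setT (fun x => (v x ^+ 2)%:E) by mfun.
have c1 : (0 <= (1 + e)%:E)%E by rewrite lee_fin addr_ge0// ltW.
have c2 : (0 <= (1 + e^-1)%:E)%E by rewrite lee_fin addr_ge0// invr_ge0 ltW.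
rewrite /sqn -(ge0_integralZl (leb2 R) measurableT mu2 (pos u) c1).
rewrite -(ge0_integralZl (leb2 R) measurableT mv2 (pos v) c2).
have p1 x : setT x -> (0 <= (1 + e)%:E * (u x ^+ 2)%:E)%E by move=> Tx; apply: mule_ge0 => //; exact: pos.
have p2 x : setT x -> (0 <= (1 + e^-1)%:E * (v x ^+ 2)%:E)%E by move=> Tx; apply: mule_ge0 => //; exact: pos.
have m1 : measurable_fun setT (fun x => (1 + e)%:E * (u x ^+ 2)%:E)%E by exact: measurable_funeM.
have m2 : measurable_fun setT (fun x => (1 + e^-1)%:E * (v x ^+ 2)%:E)%E by exact: measurable_funeM.
rewrite -(ge0_integralD (leb2 R) measurableT p1 m1 p2 m2).
apply: ge0_le_integral; first exact: measurableT.
- by move=> x _; rewrite lee_fin sqr_ge0.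
- by mfun.
- exact: emeasurable_funD.
move=> x _; rewrite -!EFinM -EFinD lee_fin.
rewrite -(ler_pM2l e0).
have -> : e * ((1 + e) * u x ^+ 2 + (1 + e^-1) * v x ^+ 2) =
   e * (u x + v x) ^+ 2 + (e * u x - v x) ^+ 2 by field; rewrite gt_eqF.
by rewrite lerDl sqr_ge0.
Qed.

Lemma MVT_sym (F F1 : R -> R) (a b : R) : a != b ->
  (forall s : R, Num.min a b <= s <= Num.max a b -> is_derive s 1 F (F1 s)) ->
  exists2 s, Num.min a b <= s <= Num.max a b & F b - F a = F1 s * (b - a).
Proof.
wlog ab : a b / a < b.
  move=> H ab; have [lt|] := boolP (a < b); first exact: H.
  rewrite -leNgt => lt; have ba : b < a by rewrite lt_neqAle eq_sym ab.
  rewrite minC maxC => /(H _ _ ba); rewrite eq_sym => /(_ ab)[s hs E].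
  by exists s => //; rewrite -opprB E -mulrN opprB.
move=> _; rewrite (min_idPl (ltW ab)) (max_idPr (ltW ab)) => dF.
have dF' s : s \in `]a, b[ -> is_derive s 1 F (F1 s).
  by rewrite in_itv/= => /andP[s1 s2]; apply: dF; rewrite !ltW.
have cF : {within `[a, b], continuous F}.
  apply: derivable_within_continuous => s; rewrite in_itv/= => /dF; by case.
have [s] := MVT ab dF' cF; rewrite in_itv/= => /andP[s1 s2] E.
by exists s => //; rewrite !ltW.
Qed.

End time_tools.

(** * Truncation to a box *)

Section cutoff.
Context {R : realType}.

Definition cut (m : nat) : R * R -> R := box (- m%:R) m%:R (- m%:R) m%:R.

Lemma measurable_cut m : measurable_fun setT (cut m : RR R -> R).
Proof. exact: measurable_box. Qed.

Lemma cut01 m x : 0 <= cut m x <= 1.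
Proof. by rewrite /cut boxE ler0n/= lern1 leq_b1. Qed.

Lemma cut_near (x : R * R) : \forall m \near \oo, cut m x = 1.
Proof.
exists (maxn (Num.truncn `|x.1|).+1 (Num.truncn `|x.2|).+1) => // m /=.
rewrite geq_max => /andP[m1 m2].
have h (a : R) : (Num.truncn `|a| < m)%N -> `|a| <= m%:R.
  move=> am; apply: ltW; apply: lt_le_trans (truncnS_gt _) _; by rewrite ler_nat.
by rewrite /cut boxE -!ler_norml !h.
Qed.

Lemma cut_integral_cvg (u : RR R -> R) : measurable_fun setT u ->
  (leb2 R).-integrable setT (EFin \o u) ->
  \int[leb2 R]_x (cut m x * u x) @[m --> \oo] --> \int[leb2 R]_x u x.
Proof.
move=> mu iu; have iau := integrable_abse iu.
apply: (@dct_Rcvg _ _ _ (fun x => `|u x|)) => //.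
- by move=> m; have := measurable_cut m => ?; mfun.
- move=> x _; apply: cvg_near_cst; apply: filterS (cut_near x) => m ->.
  by rewrite mul1r.
- move=> m x _; have /andP[c0 c1] := cut01 m x.
  by rewrite normrM (ger0_norm c0) ler_piMl.
Qed.

End cutoff.

Section evolution.
Context {R : realType}.
Variables (rho1 rho2 T l : R) (f : R -> R * R -> R) (f0 : R * R -> R).
Hypothesis hl : 3 <= l.
Hypothesis hf : continuous_in_sobolev T l f.
Hypothesis hsol : muskat_solution rho1 rho2 T f f0.

Let c : R := (rho2 - rho1) / (4 * pi).

Let l3 : (3 <= Num.truncn l)%N.
Proof. by rewrite truncn_ge_nat//; apply: le_trans hl. Qed.

Let hcont t : 0 <= t <= T -> continuous (f t).
Proof. by have [h _ _] := hsol; exact: h. Qed.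

Lemma regular_time t : 0 <= t <= T -> exists K, regular K (f t).
Proof.
move=> tT; have [[h2 hw hn] _] := hf tT.
have s0 : (0 <= sobolev_norm l (f t))%E by rewrite /sobolev_norm poweR_ge0.
exists (fine (sobolev_norm l (f t)) ^+ 2); apply: (sobolev_nice hl) => //.
- exact: fine_ge0.
- exact: hcont.
- by move=> a a3; apply: hw; exact: leq_trans a3 l3.
- by rewrite fineK// ge0_fin_numE.
Qed.

(** The constant in [regular] is quadratic in the norm of H^l, hence the square root of [h].
    Differences of solutions inherit weak derivatives from [weak_partial_sub]. *)
Lemma regular_near t (h : R) : 0 <= t <= T -> 0 < h ->
  exists2 d : R, 0 < d & forall s, 0 <= s <= T -> `|s - t| < d ->
    regular h (fun x => f s x - f t x).
Proof.
move=> tT h0; have [[t2 tw _] cvg] := hf tT.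
have r0 : 0 < Num.sqrt h by rewrite sqrtr_gt0.
have nb : nbhs (0%:E : \bar R) [set x | (x < (Num.sqrt h)%:E)%E].
  by apply: (@near_ltr R 0 (Num.sqrt h) r0).
have [d d0 hd] := within_ball (cvg _ nb).
exists d => // s sT st; have [[s2 sw _] _] := hf sT.
rewrite -(sqr_sqrtr (ltW h0)); apply: (sobolev_nice hl (sqrtr_ge0 _)).
- by move=> x; apply: cvgB; exact: hcont.
- exact: L2_sub.
- move=> a a3; have [hs [hs2 ws]] := sw a (leq_trans a3 l3).
  have [ht [ht2 wt]] := tw a (leq_trans a3 l3).
  by exists (hs \- ht); split; [exact: L2_sub|exact: weak_partial_sub].
- exact: ltW (hd s sT st).
Qed.

(** One constant for a whole neighbourhood of t, from [f s = (f s - f t) + f t]. *)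
Lemma regular_local t : 0 <= t <= T -> exists K, exists2 d : R, 0 < d &
  forall s, 0 <= s <= T -> `|s - t| < d -> regular K (f s).
Proof.
move=> tT; have [K rK] := regular_time tT; have [d d0 hd] := regular_near tT ltr01.
exists (2 * (1 + K)), d => // s sT st.
have -> : f s = (fun x => f s x - f t x + f t x) by apply/funext => x; rewrite subrK.
exact: regular_add (hd s sT st) rK.
Qed.

Let diss s : R := fine (dissipation (f s)).
Let energy s : R := \int[leb2 R]_x (f s x ^+ 2).

Lemma regular_nice K (g : R * R -> R) : regular K g -> nice K g.
Proof. by case=> [g1 [g2 []]]. Qed.

Let local_pair t (h : R) : 0 <= t <= T -> 0 < h -> exists K, 0 <= K /\ forall e : R, 0 < e ->
  exists2 d : R, 0 < d & forall s, 0 <= s <= T -> `|s - t| < d ->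
   [/\ regular K (f s), regular K (f t) & regular (h * e ^+ 2) (fun x => f s x - f t x)].
Proof.
move=> tT h0; have [K [d1 d10 h1]] := regular_local tT.
have rt : regular K (f t) by apply: h1 => //; rewrite subrr normr0.
exists K; split; first exact: nice_K (regular_nice rt).
move=> e e0; have [d2 d20 h2] := regular_near tT (mulr_gt0 h0 (exprn_gt0 2 e0)).
exists (Num.min d1 d2); first by rewrite lt_min d10.
by move=> s sT; rewrite lt_min => /andP[s1 s2]; split; [exact: h1|exact: rt|exact: h2].
Qed.

Lemma diss_continuous t : 0 <= t <= T -> forall e, 0 < e -> exists2 d : R, 0 < d &
  forall s, 0 <= s <= T -> `|s - t| < d -> `|diss s - diss t| <= e.
Proof.
move=> tT e e0; have [K [K0 hK]] := local_pair tT ltr01.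
(* With d = q^2 and Young parameter q the error in [dissipation_compare] is q (A - 1); the summand 1
   keeps [A] positive. *)
pose A : R := 8 * (1 + 4 * K) * kk_mass + 1.
have k0 : 0 <= kk_mass :> R by exact: kk_mass_ge0.
have A1 : 1 <= A by rewrite lerDr !mulr_ge0// addr_ge0// mulr_ge0.
have A0 : 0 < A by exact: lt_le_trans A1.
pose q := e / A; have q0 : 0 < q by rewrite divr_gt0.
have [d d0 hd] := hK q q0; exists d => // s sT st.
have [rs rt rd] := hd s sT st; rewrite mul1r in rd.
have bound : 8 * (q ^+ 2 / q + 4 * q * K) * kk_mass <= e.
  have -> : 8 * (q ^+ 2 / q + 4 * q * K) * kk_mass = q * (A - 1) by rewrite /A; field; rewrite gt_eqF.
  apply: (@le_trans _ _ (q * A)); first by rewrite ler_wpM2l ?(ltW q0)// gerBl.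
  by rewrite /q divfK// gt_eqF.
have Es : dissipation (f s) = (diss s)%:E by rewrite /diss fineK// (dissipation_fin rs).
have Et : dissipation (f t) = (diss t)%:E by rewrite /diss fineK// (dissipation_fin rt).
have h1 := dissipation_compare (regular_nice rs) (regular_nice rt) (regular_nice rd) q0.
have rd' : regular (q ^+ 2) (fun x => f t x - f s x).
  have -> : (fun x => f t x - f s x) = (fun x => - (f s x - f t x)) by apply/funext => x; rewrite opprB.
  exact: regular_opp.
have h2 := dissipation_compare (regular_nice rt) (regular_nice rs) (regular_nice rd') q0.
rewrite Es Et -EFinD lee_fin in h1; rewrite Es Et -EFinD lee_fin in h2.
have k1 := le_trans h1 (lerD (lexx _) bound); have k2 := le_trans h2 (lerD (lexx _) bound).
by move: (diss s) (diss t) k1 k2 => a b k1 k2; rewrite ler_distl lerBlDr k1 k2.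
Qed.

Let energyE K s : regular K (f s) -> ((energy s)%:E = sqn (f s))%E.
Proof.
move=> /regular_nice n; rewrite /energy /Rintegral fineK// ge0_fin_numE ?sqn_ge0//.
by apply: le_lt_trans (nice_sqn n) _; exact: ltry.
Qed.

Lemma energy_continuous t : 0 <= t <= T -> forall e, 0 < e -> exists2 d : R, 0 < d &
  forall s, 0 <= s <= T -> `|s - t| < d -> `|energy s - energy t| <= e.
Proof.
move=> tT e e0; have [K [K0 hK]] := local_pair tT ltr01.
(* [sqn_add_e] with parameter q, applied to a difference of squared norm at most q^2, gives the
   error q (K + 1 + q), which is at most q (K + 2) because q <= 1. *)
pose q := Num.min 1 (e / (K + 2)).
have K2 : 0 < K + 2 by rewrite ltr_wpDl.
have q0 : 0 < q by rewrite lt_min ltr01 divr_gt0.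
have q1 : q <= 1 by rewrite ge_min lexx.
have qe : q * (K + 2) <= e by rewrite -ler_pdivlMr// ge_min lexx orbT.
have [d d0 hd] := hK q q0; exists d => // s sT st.
have [rs rt rd] := hd s sT st; rewrite mul1r in rd.
have ns := regular_nice rs; have nt := regular_nice rt; have nd := regular_nice rd.
have comp u w : nice K u -> nice K w -> nice (q ^+ 2) (fun x => u x - w x) ->
    (sqn u <= sqn w + e%:E)%E.
  move=> nu nw nuw; have mw := nice_m nw; have muw := nice_m nuw.
  have -> : u = (fun x => w x + (u x - w x)) by apply/funext => x; ring.
  apply: le_trans (sqn_add_e q0 mw muw) _.
  rewrite (EFinD 1 q) ge0_muleDl ?lee_fin ?(ltW q0)// mul1e -addeA; apply: leeD => //.
  apply: (@le_trans _ _ (q%:E * K%:E + (1 + q^-1)%:E * (q ^+ 2)%:E)%E).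
    apply: leeD; apply: lee_wpmul2l.
    - by rewrite lee_fin ltW.
    - exact: nice_sqn nw.
    - by rewrite lee_fin addr_ge0// invr_ge0 ltW.
    - exact: nice_sqn nuw.
  rewrite -!EFinM -EFinD lee_fin; apply: le_trans qe.
  have -> : q * K + (1 + q^-1) * q ^+ 2 = q * (K + 1 + q) by field; rewrite gt_eqF.
  by rewrite ler_wpM2l ?(ltW q0)//; lra.
have h1 := comp _ _ ns nt nd.
have nd' : nice (q ^+ 2) (fun x => f t x - f s x).
  have -> : (fun x => f t x - f s x) = (fun x => - (f s x - f t x)) by apply/funext => x; rewrite opprB.
  exact: regular_nice (regular_opp rd).
have h2 := comp _ _ nt ns nd'.
rewrite -(energyE rs) -(energyE rt) -EFinD lee_fin in h1.
rewrite -(energyE rs) -(energyE rt) -EFinD lee_fin in h2.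
by move: (energy s) (energy t) h1 h2 => a b h1 h2; rewrite ler_distl lerBlDr h1 h2.
Qed.

(** Only at interior times does the limit within [0, T] become a two-sided derivative. *)
Lemma f_derive t x : 0 < t < T -> is_derive t 1 (fun s => f s x) (c * vel (f t) x).
Proof.
move=> /andP[t0 tT]; have tT' : 0 <= t <= T by rewrite !ltW.
have [_ h _] := hsol; have [v [hv cv]] := h t x tT'.
have [K rK] := regular_time tT'; rewrite -(vel_pv rK hv).
apply: is_derive_bound => e e0; have /cvgrPdist_le/(_ e e0) := cv.
case=> d /= d0 hd; exists (Num.min d (Num.min t (T - t))).
  by rewrite !lt_min d0 t0 subr_gt0.
move=> s st; rewrite !lt_min => /and3P[s1 s2 s3].
have := hd s; rewrite /= distrC => /(_ s1 st).
rewrite in_itv/= => H.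
have sT : 0 <= s <= T.
  by move: s2 s3; rewrite !ltr_norml => /andP[? ?] /andP[? ?]; apply/andP; split; lra.
have {H} := H sT.
have st0 : s - t != 0 by rewrite subr_eq0.
rewrite -(ler_pM2r (_ : 0 < `|s - t|)) ?normr_gt0// -normrM mulrBl divfK// distrC.
by [].
Qed.

End evolution.

(** * Derivative of the energy in time *)

Section energy_derivative.
Context {R : realType}.
Variables (rho1 rho2 T l : R) (f : R -> R * R -> R) (f0 : R * R -> R).
Hypotheses (hrho : rho1 < rho2) (hl : 3 <= l).
Hypothesis hf : continuous_in_sobolev T l f.
Hypothesis hsol : muskat_solution rho1 rho2 T f f0.

Let c : R := (rho2 - rho1) / (4 * pi).
Let c0 : 0 < c.
Proof. by rewrite divr_gt0 ?subr_gt0// mulr_gt0// pi_gt0. Qed.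

Definition diss (g : R -> R * R -> R) (s : R) : R := fine (dissipation (g s)).
Definition energy (g : R -> R * R -> R) (s : R) : R := \int[leb2 R]_x (g s x ^+ 2).
Definition cut_energy (g : R -> R * R -> R) m (s : R) : R := \int[leb2 R]_x (cut m x * g s x ^+ 2).

Let sqr_integrable' K (g : R * R -> R) : regular K g -> (leb2 R).-integrable setT (EFin \o (fun x => g x ^+ 2)).
Proof.
move=> /regular_nice n; apply: sqr_integrable; apply/L2P; split; first exact: nice_m n.
by apply: le_lt_trans (nice_sqn n) _; exact: ltry.
Qed.

(** Locally in time the solution and its velocity are bounded uniformly in x, so the derivative of
    the integrand is at most a constant times [cut m]. On a box, unlike on the plane, a constant is
    an integrable majorant. *)
Lemma cut_energy_derive K (a b : R) m (s : R) : 0 <= a -> b <= T ->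
  (forall r, a < r < b -> regular K (f r)) -> a < s < b ->
  is_derive s 1 (cut_energy f m) (2 * c * \int[leb2 R]_x (cut m x * (f s x * vel (f s) x))).
Proof.
move=> a0 bT rK sab; have mc := @measurable_cut R m.
pose F (r : R) (x : RR R) := cut m x * f r x ^+ 2.
pose F1 (r : R) (x : RR R) := 2 * c * (cut m x * (f r x * vel (f r) x)).
have dF (r : R) x : a < r < b -> is_derive r 1 (F^~ x) (F1 r x).
  move=> /andP[r1 r2].
  have rT : 0 < r < T by rewrite (le_lt_trans a0 r1) (lt_le_trans r2 bT).
  have d := der_mul (der_cst r (cut m x)) (der_exp 2 (f_derive hl hf hsol x rT)).
  by apply: (der_eq d); rewrite /F1 -/c /= expr1; ring.
have Ia : `]a, b[%classic s by rewrite /= in_itv.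
have If r : `]a, b[%classic r -> (leb2 R).-integrable setT (EFin \o F r).
  rewrite /= in_itv/= => /rK rr; have mr := nice_m (regular_nice rr).
  apply: (integrable_le _ _ (sqr_integrable' rr)) => //; first by rewrite /F; mfun.
  move=> x _; have /andP[c1 c2] := cut01 m x.
  rewrite /F ger0_norm; last by rewrite mulr_ge0 ?sqr_ge0.
  by rewrite ler_piMl ?sqr_ge0.
have Df r x : `]a, b[%classic r -> [set: RR R] x -> derivable (F^~ x) r 1.
  by rewrite /= in_itv/= => rab _; have [] := dF r x rab.
pose C := 2 * c * (bnd K * vel_sup K).
have rs := rK _ sab.
have k0 : 0 <= 2 * c by apply: mulr_ge0 => //; exact: ltW.
have C0 : 0 <= C.
  apply: mulr_ge0 => //; apply: mulr_ge0.
    by apply: le_trans ler01 (bnd_ge1 (regular_nice rs)).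
  by apply: le_trans (normr_ge0 _) (vel_le rs (0, 0)).
have G0 (x : RR R) : 0 <= C * cut m x by have /andP[c1 c2] := cut01 m x; apply: mulr_ge0.
have iG : (leb2 R).-integrable setT (EFin \o (fun x => C * cut m x)).
  by apply: integrable_scale; exact: box_integrable.
have Ub r x : `]a, b[%classic r -> [set: RR R] x -> `|partial1of2 F r x| <= C * cut m x.
  rewrite /= in_itv/= => rab _; rewrite partial1of2E; have [_ ->] := dF r x rab.
  have /andP[c1 c2] := cut01 m x; have rr := rK _ rab.
  rewrite /F1 normrM (ger0_norm k0) normrM (ger0_norm c1) /C -[leRHS]mulrA.
  apply: ler_wpM2l => //; rewrite mulrC; apply: ler_wpM2r => //; rewrite normrM.
  by apply: ler_pM => //; [exact: nice_abs (regular_nice rr)|exact: vel_le].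
apply: DeriveDef.
  exact: (derivable_under_integral measurableT Ia If Df G0 iG Ub).
rewrite -derive1E (differentiation_under_integral measurableT Ia If Df G0 iG Ub).
have mv := measurable_vel rs; have ms := nice_m (regular_nice rs).
rewrite -RintegralZl//; last first.
  apply: (integrable_le _ _ (integrable_abse (vel_energy_integrable rs))) => //; first by mfun.
  move=> x _; have /andP[c1 c2] := cut01 m x.
  by rewrite normrM (ger0_norm c1) ler_piMl.
by apply: eq_Rintegral => x _; rewrite partial1of2E; have [_ ->] := dF s x sab.
Qed.

Lemma cut_energy_cvg K s : regular K (f s) -> cut_energy f m s @[m --> \oo] --> energy f s.
Proof.
move=> rs; have ms := nice_m (regular_nice rs).
by apply: cut_integral_cvg; [mfun|exact: sqr_integrable' rs].
Qed.

(** The error is the flux outside the box, estimated by Cauchy-Schwarz against the L^2 bound of the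
    velocity. The tail of [f s] is controlled by that of [f t] and by [f s - f t], so one choice of
    box serves all times near t. *)
Lemma cut_flux K t s h m : 0 <= h -> regular K (f s) -> regular K (f t) ->
  regular h (fun x => f s x - f t x) -> energy f t - cut_energy f m t <= h ->
  (\int[leb2 R]_x (cut m x * (f s x * vel (f s) x)) + diss f s) ^+ 2 <= 4 * h * vel_L2 K.
Proof.
move=> h0 rs rt rd hm; have mc := @measurable_cut R m.
have ms : measurable_fun setT (f s : RR R -> R) := nice_m (regular_nice rs).
have mt : measurable_fun setT (f t : RR R -> R) := nice_m (regular_nice rt).
have mv := measurable_vel rs.
have ie := vel_energy_integrable rs.
have ic : (leb2 R).-integrable setT (EFin \o (fun x => cut m x * (f s x * vel (f s) x))).
  apply: (integrable_le _ _ (integrable_abse ie)) => //; first by mfun.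
  move=> x _; have /andP[c1 c2] := cut01 m x.
  by rewrite normrM (ger0_norm c1) ler_piMl.
pose u (x : RR R) := (1 - cut m x) * f s x.
have mu : measurable_fun setT u by rewrite /u; mfun.
have iuv : (leb2 R).-integrable setT (EFin \o (fun x => u x * vel (f s) x)).
  have -> : (fun x => u x * vel (f s) x) = (fun x => f s x * vel (f s) x - cut m x * (f s x * vel (f s) x)).
    by apply/funext => x; rewrite /u; ring.
  exact: integrable_minus.
have -> : \int[leb2 R]_x (cut m x * (f s x * vel (f s) x)) + diss f s = - \int[leb2 R]_x (u x * vel (f s) x).
  have -> : diss f s = - \int[leb2 R]_x (f s x * vel (f s) x) by rewrite (vel_energy rs) opprK.
  rewrite -RintegralB// -mulN1r -RintegralZl//.
  by apply: eq_Rintegral => x _; rewrite /u; ring.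
have ia := integrable_abse iuv.
rewrite sqrrN -(real_normK (num_real _)).
have le1 := le_normr_Rintegral measurableT iuv.
apply: (@le_trans _ _ ((\int[leb2 R]_x `|u x * vel (f s) x|) ^+ 2)).
  by rewrite lerXn2r ?nnegrE// Rintegral_ge0.
rewrite -lee_fin EFin_expe /Rintegral fineK; last exact: integrable_fin_num ia.
apply: le_trans (cauchy_schwarz (leb2 R) mu mv) _.
have st : (sqn (fun x => ((1 - cut m x) * f t x)%R) <= h%:E)%E.
  have it := sqr_integrable' rt.
  have ict : (leb2 R).-integrable setT (EFin \o (fun x => cut m x * f t x ^+ 2)).
    apply: (integrable_le _ _ it) => //; first by mfun.
    move=> x _; have /andP[c1 c2] := cut01 m x.
    rewrite ger0_norm; last by rewrite mulr_ge0 ?sqr_ge0.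
    by rewrite ler_piMl ?sqr_ge0.
  have id := integrable_minus it ict.
  apply: (@le_trans _ _ (energy f t - cut_energy f m t)%:E); last by rewrite lee_fin.
  rewrite /energy /cut_energy -RintegralB// /Rintegral fineK; last exact: integrable_fin_num id.
  apply: ge0_le_integral; first exact: measurableT.
  - by move=> x _; rewrite lee_fin sqr_ge0.
  - by mfun.
  - by mfun.
  move=> x _; rewrite lee_fin exprMn; have /andP[c1 c2] := cut01 m x.
  have -> : f t x ^+ 2 - cut m x * f t x ^+ 2 = (1 - cut m x) * f t x ^+ 2 by ring.
  by apply: ler_wpM2r; [exact: sqr_ge0|rewrite expr2 ler_piMl ?subr_ge0// gerBl].
have sd : (sqn (fun x => (1 - cut m x) * (f s x - f t x))%R <= h%:E)%E.
  apply: (@sqn_dom _ _ (fun x => `|f s x - f t x|)).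
  - by mfun.
  - by mfun.
  - move=> x; have /andP[c1 c2] := cut01 m x.
    by rewrite normrM ger0_norm ?subr_ge0// ler_piMl// gerBl.
  - by rewrite sqn_norm; exact: nice_sqn (regular_nice rd).
have su : (sqn u <= (4 * h)%:E)%E.
  have -> : u = (fun x => (1 - cut m x) * f t x + (1 - cut m x) * (f s x - f t x)).
    by apply/funext => x; rewrite /u; ring.
  have m1 : measurable_fun setT (fun x : RR R => (1 - cut m x) * f t x) by mfun.
  have m2 : measurable_fun setT (fun x : RR R => (1 - cut m x) * (f s x - f t x)) by mfun.
  apply: le_trans (sqn_add_le m1 m2 st sd) _; rewrite lee_fin; lra.
rewrite EFinM; apply: lee_pmul => //.
- exact: sqn_ge0.
- exact: sqn_ge0.
- exact: vel_sqn.
Qed.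

Lemma energy_derive t : 0 < t < T -> is_derive t 1 (energy f) (- (2 * c) * diss f t).
Proof.
move=> /andP[t0 tT]; have tT' : 0 <= t <= T by rewrite !ltW.
apply: is_derive_bound => e e0.
have [K [d1 d10 rK]] := regular_local hl hf hsol tT'.
have rt : regular K (f t) by apply: rK => //; rewrite subrr normr0.
have K0 : 0 <= vel_L2 K.
  by rewrite -lee_fin; apply: le_trans (vel_sqn rt); exact: sqn_ge0.
(* Two errors of size q, one from the truncated flux and one from the continuity of [diss], are
   multiplied by 2 c and add up to e. *)
pose q := e / (4 * c); have q0 : 0 < q by rewrite divr_gt0// mulr_gt0.
have [d2 d20 hD] := diss_continuous hl hf hsol tT' q0.
(* Makes the bound of [cut_flux] at most q^2; the summand 1 excludes a zero denominator. *)
pose h := q ^+ 2 / (4 * (vel_L2 K + 1)).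
have v1 : 0 < vel_L2 K + 1 by rewrite ltr_wpDl.
have h0 : 0 < h by rewrite divr_gt0 ?exprn_gt0// mulr_gt0.
have hq : 4 * h * vel_L2 K <= q ^+ 2.
  have -> : 4 * h * vel_L2 K = q ^+ 2 * (vel_L2 K / (vel_L2 K + 1)) by rewrite /h; field; rewrite gt_eqF.
  by rewrite ler_piMr ?sqr_ge0// ler_pdivrMr// mul1r lerDl.
have [d3 d30 rh] := regular_near hl hf hsol tT' h0.
pose d := Num.min (Num.min d1 (Num.min d2 d3)) (Num.min t (T - t)).
have d0 : 0 < d by rewrite !lt_min d10 d20 d30 t0 subr_gt0.
have near_t s : `|s - t| < d -> [/\ 0 <= s <= T, `|s - t| < d1, `|s - t| < d2 & `|s - t| < d3].
  rewrite !lt_min => /andP[/and3P[s1 s2 s3] /andP[s4 s5]]; split => //.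
  by move: s4 s5; rewrite !ltr_norml => /andP[? ?] /andP[? ?]; apply/andP; split; lra.
exists d => // s st sd.
have [sT s1 s2 s3] := near_t s sd.
have cEm : (cut_energy f m s - cut_energy f m t - - (2 * c) * diss f t * (s - t)) @[m --> \oo]
   --> energy f s - energy f t - - (2 * c) * diss f t * (s - t).
  apply: cvgB; last exact: cvg_cst.
  by apply: cvgB; [exact: cut_energy_cvg (rK s sT s1)|exact: cut_energy_cvg rt].
apply: (cvgr_to_le (cvg_norm cEm)).
have cO : (energy f t - cut_energy f m t) @[m --> \oo] --> (0 : R).
  rewrite -(subrr (energy f t)); apply: cvgB; first exact: cvg_cst.
  exact: cut_energy_cvg rt.
have /cvgrPdist_le/(_ h h0) nO := cO.
(* For fixed s the estimate is proved for all large m and then passes to the limit; how large m must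
   be depends only on the tail at the time t. *)
apply: filterS nO => m; rewrite sub0r normrN => /(le_trans (ler_norm _)) hm.
have tball r : t - d < r < t + d -> `|r - t| < d.
  by rewrite ltr_distl => /andP[? ?]; apply/andP; split; lra.
have da : 0 <= t - d by rewrite subr_ge0 /d !ge_min lexx !orbT.
have db : t + d <= T by rewrite -lerBrDl /d !ge_min lexx !orbT.
have rab r : t - d < r < t + d -> regular K (f r).
  by move=> /tball/near_t[rT r1 _ _]; exact: rK.
have mid x : Num.min t s <= x <= Num.max t s -> `|x - t| < d /\ t - d < x < t + d.
  move=> hx; have xd : `|x - t| < d.
    apply: le_lt_trans sd; move: hx; case: (leP t s) => ts /andP[x1 x2].
      by rewrite !ger0_norm ?subr_ge0// lerB.
    by rewrite !ler0_norm ?subr_le0 ?(ltW ts)// lerN2 lerB.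
  by split=> //; rewrite -ltr_distl.
(* The intermediate time [x] depends on m, which is harmless: the bounds below hold at every time
   between t and s. *)
have [x hx E] := MVT_sym (F := cut_energy f m)
  (F1 := fun r => 2 * c * \int[leb2 R]_x (cut m x * (f r x * vel (f r) x))) (a := t) (b := s)
  ltac:(by rewrite eq_sym) (fun r hr => cut_energy_derive m da db rab (mid r hr).2).
have [xd _] := mid x hx; have [xT x1 x2 x3] := near_t x xd.
pose I := \int[leb2 R]_z (cut m z * (f x z * vel (f x) z)).
have {}E : cut_energy f m s - cut_energy f m t = 2 * c * I * (s - t) := E.
have fl : (I + diss f x) ^+ 2 <= q ^+ 2.
  exact: le_trans (cut_flux (ltW h0) (rK x xT x1) rt (rh x xT x3) hm) hq.
have dx : `|diss f x - diss f t| <= q := hD x xT x2.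
rewrite E; move: I (diss f x) (diss f t) fl dx {E} => I a b fl dx.
have Ia : `|I + a| <= q.
  rewrite -(@ler_pXn2r _ 2)// ?nnegrE ?normr_ge0 ?(ltW q0)//.
  by rewrite real_normK ?num_real.
have Ib : `|I + b| <= 2 * q.
  have -> : I + b = (I + a) - (a - b) by ring.
  by apply: le_trans (ler_normB _ _) _; lra.
have -> : 2 * c * I * (s - t) - - (2 * c) * b * (s - t) = 2 * c * ((I + b) * (s - t)) by ring.
have k0 : 0 <= 2 * c by apply: mulr_ge0 => //; exact: ltW.
rewrite normrM (ger0_norm k0) normrM mulrA; apply: ler_wpM2r => //.
apply: le_trans (ler_wpM2l k0 Ib) _.
have -> : 2 * c * (2 * q) = e by rewrite /q; field; rewrite gt_eqF.
exact: lexx.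
Qed.

End energy_derivative.

(** * Integration in time *)

Section energy_identity.
Context {R : realType}.
Variables (rho1 rho2 T l : R) (f : R -> R * R -> R) (f0 : R * R -> R).
Hypotheses (hrho : rho1 < rho2) (hl : 3 <= l).
Hypothesis hf : continuous_in_sobolev T l f.
Hypothesis hsol : muskat_solution rho1 rho2 T f f0.

Let c : R := (rho2 - rho1) / (4 * pi).
Let c0 : 0 < c.
Proof. by rewrite divr_gt0 ?subr_gt0// mulr_gt0// pi_gt0. Qed.

Lemma L2norm_energy t : 0 <= t <= T -> (L2norm (f t) ^+ 2 = (energy f t)%:E)%E.
Proof.
move=> tT; have [K [g1 [g2 [n _ _]]]] := regular_time hl hf hsol tT.
rewrite L2norm_sqr /energy /Rintegral fineK// ge0_fin_numE; last exact: sqn_ge0.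
by apply: le_lt_trans (nice_sqn n) _; exact: ltry.
Qed.

(** Fundamental theorem of calculus for the energy divided by -2 c: the derivative is known at
    interior times only, and continuity within [0, T] supplies the end points. *)
Lemma diss_integral t : 0 < t -> t <= T ->
  (\int[@lebesgue_measure R]_(s in `[0%R, t]%classic) dissipation (f s) =
   ((2 * c)^-1 * (energy f 0 - energy f t))%:E)%E.
Proof.
move=> t0 tT.
have sub s : 0 <= s <= t -> 0 <= s <= T.
  by move=> /andP[-> st]; exact: le_trans st tT.
have c2 : 0 < 2 * c by exact: mulr_gt0.
pose F s := - (2 * c)^-1 * energy f s.
have dF s : 0 < s < T -> is_derive s 1 F (diss f s).
  move=> sT; have d := der_mul (der_cst s (- (2 * c)^-1)) (energy_derive hrho hl hf hsol sT).
  apply: (der_eq d); rewrite mul0r add0r -/c mulrA mulrNN mulVf ?mul1r//.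
  by rewrite gt_eqF.
have cF s : 0 <= s <= T -> F r @[r --> within `[0, T] (nbhs s)] --> F s.
  move=> sT; apply: cvgM; first exact: cvg_cst.
  apply: cvg_within => e e0.
  by have h := energy_continuous hl hf hsol sT e0; exact: h.
have cD s : 0 <= s <= T -> diss f r @[r --> within `[0, T] (nbhs s)] --> diss f s.
  move=> sT; apply: cvg_within => e e0.
  by have h := diss_continuous hl hf hsol sT e0; exact: h.
transitivity (\int[@lebesgue_measure R]_(s in `[0%R, t]%classic) (diss f s)%:E)%E.
  apply: eq_integral => s; rewrite inE/= in_itv/= => /sub sT.
  have [K rK] := regular_time hl hf hsol sT.
  by rewrite /diss fineK// (dissipation_fin rK).
have tT' : 0 <= t <= T by rewrite ltW.
have T0 : 0 < T by exact: lt_le_trans tT.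
have T0' : 0 <= (0 : R) <= T by rewrite lexx ltW.
rewrite (@continuous_FTC2 _ (diss f) F)//.
- by rewrite -EFinB; congr EFin; rewrite /F; ring.
- apply/subspace_continuousP => s; rewrite /= in_itv/= => st.
  apply: cvg_trans (cD s (sub s st)); apply: cvg_app => P [d /= d0 h].
  exists d => // r /= rd; rewrite in_itv/= => /sub rT; apply: h => //=.
- split.
  + move=> s; rewrite in_itv/= => /andP[s0 st].
    have sT : 0 < s < T by rewrite s0 (lt_le_trans st tT).
    by have [] := dF s sT.
  + apply: cvg_trans (cF 0 T0'); apply: cvg_app => P [d /= d0 h].
    (* Capping the radius by [T] keeps r inside [0, T], where continuity is known; at the other end
       the cap is t. *)
    exists (Num.min d T); first by rewrite /= lt_min d0.
    move=> r /=; rewrite sub0r normrN lt_min => /andP[rd rT] r0; apply: h => /=.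
      by rewrite sub0r normrN.
    by rewrite in_itv/= (ltW r0) (ltW (le_lt_trans (ler_norm _) rT)).
  + apply: cvg_trans (cF t tT'); apply: cvg_app => P [d /= d0 h].
    exists (Num.min d t); first by rewrite /= lt_min d0.
    move=> r /=; rewrite lt_min => /andP[rd rt] r0; apply: h => //=.
    rewrite in_itv/= (le_trans (ltW r0) tT) andbT -(lerD2r t) add0r addrC -lerBlDr.
    exact: le_trans (ler_norm _) (ltW rt).
- move=> s; rewrite in_itv/= => /andP[s0 st].
  have sT : 0 < s < T by rewrite s0 (lt_le_trans st tT).
  by rewrite derive1E; have [_ ->] := dF s sT.
Qed.
End energy_identity.

Unset Implicit Arguments.

Theorem mainTheorem1 (R : realType) (rho1 rho2 T l : R)
    (f : R -> R * R -> R) (f0 : R * R -> R)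
    (hrho : rho1 < rho2) (hT : 0 < T) (hl : 3 <= l)
    (hf : continuous_in_sobolev T l f)
    (hsol : muskat_solution rho1 rho2 T f f0) :
  let rho := (rho2 - rho1) / 2 in
  forall t : R, 0 <= t <= T ->
    (L2norm (f t) ^+ 2
     + (rho / pi)%:E *
       \int[@lebesgue_measure R]_(s in `[0%R, t]%classic)
         \int[leb2 R]_y \int[leb2 R]_x
           ((enorm y)^-1
            - (Num.sqrt (enorm y ^+ 2 + (f s x - f s (x - y)) ^+ 2))^-1)%R%:E
     = L2norm f0 ^+ 2)%E.
Proof.
move=> rho t tT; have [t0 tle] := andP tT.
have -> : f0 = f 0 by apply/funext => x; have [_ _ ->] := hsol.
have T0' : 0 <= (0 : R) <= T by rewrite lexx ltW.
rewrite (L2norm_energy hl hf hsol tT) (L2norm_energy hl hf hsol T0').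
(* At t = 0 the time integral runs over a single point; otherwise the interval is nondegenerate, as
   [diss_integral] requires. *)
move: t0; rewrite le_eqVlt => /predU1P[<-|t0].
  by rewrite set_itv1 integral_set1 mule0 adde0.
have E := diss_integral hrho hl hf hsol t0 tle.
(* The integrand is [gain] unfolded, so the two triple integrals are convertible. *)
rewrite -[X in (_ + _ * X)%E]/(\int[@lebesgue_measure R]_(s in `[0%R, t]%classic) dissipation (f s))%E.
rewrite E -EFinM -EFinD; congr EFin.
have p0 : 0 < pi :> R by exact: pi_gt0.
have d0 : 0 < rho2 - rho1 by rewrite subr_gt0.
(* The factor rho/pi equals (rho2 - rho1)/(2 pi), the quantity whose inverse appears in
   [diss_integral], so the energy difference remains with coefficient 1. *)
move: (pi : R) p0 => p p0; rewrite /rho; field.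
by rewrite !gt_eqF.
Qed.
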